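(* Let $\bar E>1$, $\varepsilon<0.005$ and $n\ge10$. Any algorithm that learns an unknown zero-mean $n$-mode Gaussian state $\rho(0,\Sigma)$, promised to satisfy $\|\Sigma\|_{\mathrm{op}}\le\bar E$, to trace distance $\varepsilon$ with probability at least $2/3$, using only heterodyne measurements (each copy measured individually by heterodyne, followed by arbitrary classical processing), must use $N=\Omega(\bar E^2n^3/\varepsilon^2)$ copies.
   Context: $n$ bosonic modes have quadrature vector $\hat R=(\hat x_1,\dots,\hat x_n,\hat p_1,\dots,\hat p_n)$ with $[\hat R_j,\hat R_k]=i\Omega_{jk}$, $\Omega=\begin{pmatrix}0_n&I_n\\-I_n&0_n\end{pmatrix}$. Mean $\mu_j=\mathrm{Tr}(\rho\hat R_j)$, covariance $\Sigma_{jk}=\tfrac12\mathrm{Tr}(\rho\{\hat R_j-\mu_j,\hat R_k-\mu_k\})$ (vacuum: $\tfrac12I_{2n}$). A Gaussian state $\rho(\mu,\Sigma)$ has Wigner function $\mathcal N(\mu,\Sigma)$. With $\hat D(\xi)=\exp(i\xi^T\Omega\hat R)$, heterodyne measurement is the POVM $\{(2\pi)^{-n}\hat D(\xi)\rho(0,\tfrac12I_{2n})\hat D(\xi)^\dagger\}_{\xi\in\mathbb R^{2n}}$, whose outcome on $\rho(\mu,\Sigma)$ is distributed as $\mathcal N(\mu,\Sigma+\tfrac12I_{2n})$. $D_{\mathrm{tr}}(\rho,\sigma)=\tfrac12\|\rho-\sigma\|_1$. *)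

(* Defs.v *)
From HB Require Import structures.
From mathcomp Require Import all_boot all_order all_algebra.
From mathcomp Require Import all_classical all_reals all_analysis.

Set Implicit Arguments.
Unset Strict Implicit.
Unset Printing Implicit Defensive.

Import Order.TTheory GRing.Theory Num.Theory.
Import numFieldNormedType.Exports.
Local Open Scope classical_set_scope.
Local Open Scope ring_scope.

Section Defs.
Variable R : realType.

(* Iterated Lebesgue integral over R^m of an extended-real function;
   for non-negative measurable functions this is the Lebesgue integral on R^m
   (Tonelli). *)
Fixpoint iint (m : nat) : (m.-tuple R -> \bar R) -> \bar R :=
  match m as m0 return (m0.-tuple R -> \bar R) -> \bar R with
  | 0 => fun f => f [tuple]
  | m'.+1 => fun f =>
      (\int[@lebesgue_measure R]_x iint (fun t => f (cons_tuple x t)))%E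
  end.

Definition Rint (m : nat) (h : m.-tuple R -> R) : R :=
  fine (iint (fun t => (Num.max (h t) 0)%:E)) -
  fine (iint (fun t => (Num.max (- h t) 0)%:E)).

Definition Rint2 (m : nat) (h : m.-tuple R -> m.-tuple R -> R) : R :=
  fine (iint (fun x => iint (fun y => (Num.max (h x y) 0)%:E))) -
  fine (iint (fun x => iint (fun y => (Num.max (- h x y) 0)%:E))).

Definition tcol (m : nat) (t : m.-tuple R) : 'cV[R]_m := \col_i tnth t i.

Definition vnorm (m : nat) (v : 'cV[R]_m) : R := Num.sqrt ((v^T *m v) 0 0).

Definition mx_opnorm (m : nat) (S : 'M[R]_m) : \bar R :=
  ereal_sup [set (vnorm (S *m v))%:E | v in [set v : 'cV[R]_m | vnorm v <= 1]].

Definition cmul (z w : R * R) : R * R := (z.1 * w.1 - z.2 * w.2, z.1 * w.2 + z.2 * w.1).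
Definition cconj (z : R * R) : R * R := (z.1, - z.2).
Definition cabs (z : R * R) : R := Num.sqrt (z.1 ^+ 2 + z.2 ^+ 2).

Definition L2fun (n : nat) (f : n.-tuple R -> R * R) : Prop :=
  measurable_fun setT (fun x => (f x).1) /\
  measurable_fun setT (fun x => (f x).2) /\
  (iint (fun x => ((cabs (f x)) ^+ 2)%:E) < +oo)%E.

Definition ip (n : nat) (f g : n.-tuple R -> R * R) : R * R :=
  (Rint (fun x => (cmul (cconj (f x)) (g x)).1),
   Rint (fun x => (cmul (cconj (f x)) (g x)).2)).

Definition orthonormal (n m : nat) (e : 'I_m -> n.-tuple R -> R * R) : Prop :=
  (forall i, L2fun (e i)) /\
  (forall i j, ip (e i) (e j) = ((if i == j then 1 else 0), 0)).

(* Operators on L^2(R^n) given by integral kernels K(x,y) (complex valued) *)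
Definition kernel (n : nat) := n.-tuple R -> n.-tuple R -> R * R.

Definition melt (n : nat) (f : n.-tuple R -> R * R) (K : kernel n)
  (g : n.-tuple R -> R * R) : R * R :=
  (Rint2 (fun x y => (cmul (cmul (cconj (f x)) (K x y)) (g y)).1),
   Rint2 (fun x y => (cmul (cmul (cconj (f x)) (K x y)) (g y)).2)).

(* trace norm: ||K||_1 = sup over finite orthonormal systems (e_i), (f_i)
   of sum_i |<f_i, K e_i>|  (equals the trace norm for every operator, and is
   +oo exactly when K is not trace class) *)
Definition trnorm (n : nat) (K : kernel n) : \bar R :=
  ereal_sup [set r | exists (m : nat) (e f : 'I_m -> n.-tuple R -> R * R),
     orthonormal e /\ orthonormal f /\
     r = (\sum_(i < m) cabs (melt (f i) K (e i)))%:E].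

Definition Dtr (n : nat) (K1 K2 : kernel n) : \bar R :=
  (((2%:R)^-1)%:E * trnorm (fun x y => (((K1 x y).1 - (K2 x y).1)%R,
                                       ((K1 x y).2 - (K2 x y).2)%R)))%E.

Definition is_density (n : nat) (K : kernel n) : Prop :=
  measurable_fun setT (fun xy : n.-tuple R * n.-tuple R => (K xy.1 xy.2).1) /\
  measurable_fun setT (fun xy : n.-tuple R * n.-tuple R => (K xy.1 xy.2).2) /\
  (iint (fun x => iint (fun y => ((cabs (K x y)) ^+ 2)%:E)) < +oo)%E /\
  (forall f, L2fun f -> (melt f K f).2 = 0 /\ 0 <= (melt f K f).1) /\
  trnorm K = 1%E.

(* ---------- phase space R^{2n}, ordering (x_1..x_n, p_1..p_n) *)
Definition Omega (n : nat) : 'M[R]_(n + n) := block_mx 0 1%:M (- 1%:M) 0.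

(* Sigma is a (real, symmetric) quantum covariance matrix: Sigma + i Omega/2 >= 0,
   written out for z = a + i b:  z^* (Sigma + i Omega/2) z = a'Sa + b'Sb - a'Omega b *)
Definition is_qcm (n : nat) (S : 'M[R]_(n + n)) : Prop :=
  S^T = S /\
  forall a b : 'cV[R]_(n + n),
    0 <= ((a^T *m S *m a) + (b^T *m S *m b) - (a^T *m Omega n *m b)) 0 0.

Definition gauss_pdf (n : nat) (C : 'M[R]_(n + n)) (xi : (n + n).-tuple R) : R :=
  expR (- ((2%:R)^-1 * ((tcol xi)^T *m invmx C *m tcol xi) 0 0)) /
  ((2%:R * pi) ^+ n * Num.sqrt (\det C)).

(* The Gaussian state rho(0, Sigma): the operator whose Wigner function is
   N(0, Sigma); its position-space kernel is given by the inverse Wigner-Weyl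
   transform  rho(x,y) = int W((x+y)/2, p) e^{i p.(x-y)} dp. *)
Definition gauss_state (n : nat) (S : 'M[R]_(n + n)) : kernel n :=
  fun x y =>
    let mid := [tuple (tnth x i + tnth y i) / 2%:R | i < n] in
    let dp p := \sum_(i < n) tnth p i * (tnth x i - tnth y i) in
    (Rint (fun p => gauss_pdf S (cat_tuple mid p) * cos (dp p)),
     Rint (fun p => gauss_pdf S (cat_tuple mid p) * sin (dp p))).

Fixpoint het_int (n : nat) (C : 'M[R]_(n + n)) (N : nat) :
    (N.-tuple ((n + n).-tuple R) -> \bar R) -> \bar R :=
  match N as N0 return (N0.-tuple ((n + n).-tuple R) -> \bar R) -> \bar R with
  | 0 => fun F => F [tuple]
  | N'.+1 => fun F =>
      iint (fun xi => ((gauss_pdf C xi)%:E *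
                       het_int C (fun rest => F (cons_tuple xi rest)))%E)
  end.

(* A (possibly randomized, via a uniform seed u in [0,1]) classical algorithm
   processing the N heterodyne outcomes of rho(0,Sigma) and outputting a state. *)
Definition algorithm (n N : nat) :=
  N.-tuple ((n + n).-tuple R) -> R -> kernel n.

(* The algorithm outputs a state eps-close in trace distance to rho(0,Sigma)
   with probability at least 2/3 (inner probability: a measurable subset of
   the success event has probability >= 2/3).  The heterodyne outcome
   distribution on rho(0,Sigma) is N(0, Sigma + I/2). *)
Definition learns_whp (n N : nat) (A : algorithm n N) (S : 'M[R]_(n + n))
  (eps : R) : Prop :=
  exists E : set (N.-tuple ((n + n).-tuple R) * R),
    measurable E /\
    E `<=` [set du | (Dtr (A du.1 du.2) (gauss_state S) <= eps%:E)%E] /\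
    ((2%:R / 3%:R)%:E <=
       het_int (S + ((2%:R)^-1)%:M) (fun d =>
         (\int[@lebesgue_measure R]_(u in `[0%R, 1%R]) (\1_E (d, u))%:E)%E))%E.

End Defs.

(* Main.v *)
(* Write n = 2m + r with r <= 1 and E for the energy bound.  An orthogonal m x m
   matrix W gives a symmetric involution R_W of R^n that exchanges two groups of m
   modes through W, and a state with position covariance ((1 + eta) + eta R_W) / (4E)
   and momentum covariance E, where eta is of order eps / m.  Since the positions are
   squeezed to variance about 1/(4E), the state depends on W at relative scale eta:
   summing matrix elements between one-photon states of the two groups recovers
   kappa tr(V^T W) with kappa of order eta, so two states that are both eps-close to
   the same output have tr(V^T W) >= 3m/4.  Heterodyne detection adds variance 1/2 to
   every position, hence it sees the coupling only at absolute scale eta / E: the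
   chi-square divergence of one outcome to a reference independent of W is
   exp(O(n eta^2 / E^2)) - 1.  A finite family of orthogonal matrices, products of
   reflections sending basis vectors to normalised sign vectors, contains at most a
   fraction exp(-m^2/16) of members with tr(V^T W) >= 3m/4, for every orthogonal V.
   A Fano-type counting argument then forces N n eta^2 / E^2 >= const m^2. *)

Require Import Defs.
From HB Require Import structures.
From mathcomp Require Import all_boot all_order all_algebra.
From mathcomp Require Import all_classical all_reals all_analysis.
From mathcomp Require Import measurable_realfun.
From mathcomp Require Import ring lra zify.
Import Order.TTheory GRing.Theory Num.Theory.
Import numFieldNormedType.Exports.
Local Open Scope classical_set_scope.
Local Open Scope ring_scope.

Set Implicit Arguments.
Unset Strict Implicit.
Unset Printing Implicit Defensive.

(** * A packing of orthogonal matrices *)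

(** The power n^3 comes from testing m matrix elements at once. A single one has size about eta, but
    the trace norm dominates the sum over two orthonormal systems, which is about eta m; hence eta
    of order eps / m already separates the states, and inserting it into N n eta^2 / E^2 >= const
    m^2 gives the rate. The product eta m must stay bounded, because kappa carries a loss (1 +
    eta)^(-(m + r) / 2); this is where the smallness of eps enters. All matrices that occur are
    combinations a + b R_W of the identity and an involution, so inverses, determinants and Gaussian
    masses are explicit in the scalars a and b and free of W. The algorithm is an arbitrary function
    into density operators, whose values may be far from every Gaussian state. The argument
    therefore never decodes an output: for each outcome and seed it counts the members of the family
    that would accept it, and any accepted member serves as the centre V. Information is measured by
    integrals of p^2 / q, which multiply over the outcomes. *)

Section cosh_bound.
Variable R : realType.
Implicit Types x : R.

Lemma ndecr_of_derive_ge0 (f f' : R -> R) (x : R) :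
  (forall t : R, is_derive t (1 : R) f (f' t)) ->
  (forall t, 0 < t -> 0 <= f' t) -> 0 <= x -> f 0 <= f x.
Proof.
move=> df f'0 x0.
apply: (@ger0_derive1_ndecry R f 0) => //.
- by move=> t; rewrite in_itv/= andbT => t0; rewrite derive1E derive_val f'0.
- by apply: derivable_within_continuous => t _.
Qed.

(** This is tanh x <= x. Times a Gaussian factor, the difference of the two sides is the derivative
    of [h] in [cosh_le_gauss]. *)
Let cosh_aux x : 0 <= x -> (1 - x) * expR x <= (1 + x) * expR (- x).
Proof.
move=> x0; rewrite -subr_ge0.
pose h := fun t : R => (1 + t) * expR (- t) - (1 - t) * expR t.
pose h' := fun t : R => t * (expR t - expR (- t)).
suff : h 0 <= h x by rewrite /h oppr0 expR0; lra.
apply: (@ndecr_of_derive_ge0 h h') => // [t|t t0].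
  rewrite /h /h'; apply: is_derive_eq.
  rewrite /GRing.scale /=; ring.
by apply: mulr_ge0; [exact: ltW|rewrite subr_ge0 ler_expR; lra].
Qed.

(** The map t -> cosh t exp(- t^2 / 2) is nonincreasing on t >= 0 by [cosh_aux]. This is the
    subgaussian moment bound of a random sign. *)
Lemma cosh_le_gauss x : expR x + expR (- x) <= 2 * expR (x ^+ 2 / 2).
Proof.
wlog x0 : x / 0 <= x.
  move=> H; have [/H//|/ltW] := leP 0 x.
  by rewrite -oppr_ge0 => /H; rewrite opprK addrC sqrrN.
rewrite -ler_pdivrMr ?expR_gt0// -expRN.
pose h := fun t : R => - (expR t + expR (- t)) * expR (- (t ^+ 2 / 2)).
pose h' := fun t : R => ((1 + t) * expR (- t) - (1 - t) * expR t) *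
  expR (- (t ^+ 2 / 2)).
suff : h 0 <= h x by rewrite /h expr0n/= mul0r oppr0 expR0; lra.
apply: (@ndecr_of_derive_ge0 h h') => // [t|t t0].
  rewrite /h /h'; apply: is_derive_eq.
  by rewrite /GRing.scale /=; field.
by apply: mulr_ge0; [rewrite subr_ge0 cosh_aux // ltW|exact: expR_ge0].
Qed.

End cosh_bound.

Section orthogonal_packing.
Variable R : realType.

Definition orthogonal_mx d (W : 'M[R]_d) := W^T *m W = 1%:M.

Lemma orthogonal_mxT d (W : 'M[R]_d) : orthogonal_mx W -> W *m W^T = 1%:M.
Proof. by move=> /mulmx1C. Qed.

Lemma orthogonal_mxM d (V W : 'M[R]_d) :
  orthogonal_mx V -> orthogonal_mx W -> orthogonal_mx (V *m W).
Proof.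
rewrite /orthogonal_mx => HV HW.
by rewrite trmx_mul -mulmxA (mulmxA V^T) HV mul1mx.
Qed.

Definition sqn d (v : 'cV[R]_d) : R := \sum_i v i 0 ^+ 2.

Lemma sqnE d (v : 'cV[R]_d) : (v^T *m v) = (sqn v)%:M.
Proof.
apply/matrixP => i j; rewrite !ord1 !mxE /sqn /=.
by rewrite mulr1n; apply: eq_bigr => k _; rewrite mxE expr2.
Qed.

Lemma sqn_orthogonal d (W : 'M[R]_d) (v : 'cV[R]_d) :
  orthogonal_mx W -> sqn (W *m v) = sqn v.
Proof.
move=> HW; have /matrixP/(_ 0 0) : (W *m v)^T *m (W *m v) = v^T *m v.
  by rewrite trmx_mul -mulmxA (mulmxA W^T) HW mul1mx.
by rewrite !sqnE !mxE /= !mulr1n.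
Qed.

(* If w is the first basis vector then sqn u = 0, and 2 / 0 = 0 yields the identity. *)
Definition householder d (w : 'cV[R]_d.+1) : 'M[R]_d.+1 :=
  let u := delta_mx 0 0 - w in 1%:M - (2 / sqn u) *: (u *m u^T).

Lemma sqn_eq0 d (v : 'cV[R]_d) : sqn v = 0 -> v = 0.
Proof.
move=> /eqP; rewrite psumr_eq0; last by move=> i _; exact: sqr_ge0.
move=> /allP h; apply/matrixP => i j; rewrite ord1 mxE.
by have := h i (mem_index_enum i); rewrite sqrf_eq0 => /eqP.
Qed.

Lemma householder_orthogonal d (w : 'cV[R]_d.+1) :
  orthogonal_mx (householder w).
Proof.
rewrite /orthogonal_mx /householder; set u := delta_mx 0 0 - w.
rewrite [_^T](_ : _ = 1%:M - (2 / sqn u) *: (u *m u^T)); last first.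
  by apply/matrixP => i j; rewrite !mxE eq_sym !big_ord1 ![_^T _ _]mxE [u j 0 * _]mulrC.
rewrite mulmxBl mul1mx mulmxBr mulmx1 -scalemxAl -scalemxAr.
rewrite -mulmxA (mulmxA u^T) sqnE mul_scalar_mx -scalemxAr.
have [/sqn_eq0 ->|u0] := eqVneq (sqn u) 0.
  by rewrite !mul0mx !scaler0 !subr0.
set P := u *m u^T; apply/matrixP => i j; rewrite !mxE; by field.
Qed.

(** [w] and the basis vector have equal norm, so the squared length of their difference [u] is twice
    the component of [u] along the basis vector; the reflection in the hyperplane orthogonal to [u]
    thus exchanges the two. *)
Lemma householder_col d (w : 'cV[R]_d.+1) : sqn w = 1 ->
  householder w *m delta_mx 0 0 = w.
Proof.
move=> w1; rewrite /householder; set u := delta_mx 0 0 - w.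
have uE : (u^T *m (delta_mx 0 0 : 'cV_d.+1)) = (sqn u / 2)%:M.
  apply/matrixP => i j; rewrite !ord1 !mxE /= mulr1n (bigD1 0)//= big1.
    rewrite addr0 !mxE /= mulr1 /u /sqn.
    under eq_bigr do rewrite !mxE /= andbT sqrrB.
    rewrite big_split /= -/(sqn w) w1 sumrB.
    rewrite (bigD1 0)//= big1 ?addr0; last first.
      by move=> k /negPf ->; rewrite expr0n.
    rewrite (bigD1 0)//= big1 ?addr0; last first.
      by move=> k /negPf ->; rewrite mul0r mul0rn.
    by field.
  by move=> k /negPf k0; rewrite !mxE k0 mulr0.
rewrite mulmxBl mul1mx -scalemxAl -mulmxA uE mul_mx_scalar scalerA.
have [u0|u0] := eqVneq (sqn u) 0.
  rewrite u0 mul0r mulr0 scale0r subr0.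
  by move/sqn_eq0/eqP : u0; rewrite subr_eq0 => /eqP.
rewrite [X in X *: _](_ : _ = 1); last by field.
by rewrite scale1r /u opprB addrC addrNK.
Qed.

Definition sign_col d (s : {ffun 'I_d -> bool}) : 'cV[R]_d :=
  \col_i ((-1) ^+ s i / Num.sqrt d%:R).

Lemma sqn_sign_col d (s : {ffun 'I_d.+1 -> bool}) : sqn (sign_col s) = 1.
Proof.
rewrite /sqn; under eq_bigr do rewrite mxE exprMn sqrr_sign mul1r.
rewrite sumr_const card_ord exprVn sqr_sqrtr ?ler0n//.
by rewrite -[LHS]mulr_natr mulVf// pnatr_eq0.
Qed.

(** The first column is a free sign vector; the other columns are the image, under the reflection
    producing it, of a smaller member acting on the complement of the first basis vector. A sequence
    counts members with multiplicity, so the sign choices are uniform without an injectivity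
    argument. *)
Fixpoint orthogonal_family d : seq 'M[R]_d :=
  match d with
  | 0 => [:: 1%:M]
  | d'.+1 => [seq householder (sign_col s) *m lift0_mx W
               | s <- enum {ffun 'I_d'.+1 -> bool}, W <- orthogonal_family d']
  end.

Lemma size_orthogonal_familyS d : size (orthogonal_family d.+1) =
  (2 ^ d.+1 * size (orthogonal_family d))%N.
Proof.
by rewrite size_allpairs -cardE card_ffun card_bool card_ord.
Qed.

Lemma size_orthogonal_family_gt0 d : (0 < size (orthogonal_family d))%N.
Proof.
by elim: d => [//|d IH]; rewrite size_orthogonal_familyS muln_gt0 IH expn_gt0.
Qed.

Lemma lift0_orthogonal d (W : 'M[R]_d) :
  orthogonal_mx W -> orthogonal_mx (lift0_mx W).
Proof.
rewrite /orthogonal_mx /lift0_mx => HW.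
rewrite tr_block_mx mulmx_block !trmx0 HW.
rewrite !mul0mx !mulmx0 trmx1 mulmx1 !addr0 add0r.
by rewrite -(scalar_mx_block 1 d 1).
Qed.

Lemma orthogonal_familyP d W : W \in orthogonal_family d -> orthogonal_mx W.
Proof.
elim: d W => [|d IH] W /=.
  by rewrite inE => /eqP ->; rewrite /orthogonal_mx trmx1 mulmx1.
move=> /allpairsP[[s V] /= [_ /IH HV ->]].
apply: orthogonal_mxM; first exact: householder_orthogonal.
exact: lift0_orthogonal.
Qed.

(* Column k of a member of the family is a sign vector with d - k entries of size
   (d - k)^(-1/2), up to rotation; the weights d - k make its contribution to the
   logarithm of the exponential moment linear in d - k. *)
Definition wtrace d (X W : 'M[R]_d) : R :=
  \sum_(i < d) (d - i)%:R * (X^T *m W) i i.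

(** Independence of the signs: the sum over sign vectors of a product is the product over
    coordinates of 2 cosh (v i), and [cosh_le_gauss] bounds each factor. *)
Lemma sum_sign_expR d (v : 'cV[R]_d) :
  \sum_(s : {ffun 'I_d -> bool}) expR (\sum_i (-1) ^+ s i * v i 0) <=
  (2 ^ d)%:R * expR (sqn v / 2).
Proof.
under eq_bigr do rewrite expR_sum.
rewrite -(bigA_distr_bigA (fun i (b : bool) => expR ((-1) ^+ b * v i 0))) /=.
rewrite (_ : _%:R * _ = \prod_(i < d) (2 * expR (v i 0 ^+ 2 / 2))); last first.
  rewrite big_split /= prodr_const card_ord natrX -expR_sum.
  by rewrite -mulr_suml.
apply: ler_prod => i _; rewrite big_bool /= expr0 expr1 mul1r mulN1r.
by rewrite addr_ge0 ?expR_ge0//= addrC cosh_le_gauss.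
Qed.

Lemma lift0_mxE d (W : 'M[R]_d) :
  [/\ lift0_mx W 0 0 = 1, forall i, lift0_mx W 0 (lift 0 i) = 0,
      forall i, lift0_mx W (lift 0 i) 0 = 0
    & forall i j, lift0_mx W (lift 0 i) (lift 0 j) = W i j].
Proof.
have e0 : (0 : 'I_(1 + d)) = lshift d 0 by exact: val_inj.
have eS i : lift 0 i = rshift 1 i :> 'I_(1 + d) by exact: val_inj.
pose B : 'M[R]_(1 + d) := block_mx 1 0 0 W.
rewrite /lift0_mx; split=> [|i|i|i j].
- transitivity (B (lshift d 0) (lshift d 0)); first by rewrite -e0.
  by rewrite block_mxEul mxE.
- transitivity (B (lshift d 0) (rshift 1 i)); first by rewrite -e0 -eS.
  by rewrite block_mxEur mxE.
- transitivity (B (rshift 1 i) (lshift d 0)); first by rewrite -e0 -eS.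
  by rewrite block_mxEdl mxE.
- transitivity (B (rshift 1 i) (rshift 1 j)); first by rewrite -!eS.
  by rewrite block_mxEdr.
Qed.

(** The first column carries weight d + 1, and the weights of the rest start again at d, so the
    remainder is the weighted trace of the smaller member against a minor of H^T X. *)
Lemma wtraceS d (X H : 'M[R]_d.+1) (W : 'M[R]_d) :
  wtrace X (H *m lift0_mx W) =
  d.+1%:R * (X^T *m (H *m delta_mx 0 0 : 'cV_d.+1)) 0 0 +
  wtrace (row' 0 (col' 0 (H^T *m X))) W.
Proof.
have [L00 L0i Li0 Lij] := lift0_mxE W.
rewrite /wtrace big_ord_recl /= subn0; congr (_ * _ + _).
  have e (M : 'M[R]_d.+1) : M *m (delta_mx 0 0 : 'cV_d.+1) = col 0 M.
    by rewrite colE.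
  rewrite e [LHS]mxE [RHS]mxE; apply: eq_bigr => i _; congr (_ * _).
  rewrite [LHS]mxE [RHS]mxE big_ord_recl L00 mulr1 big1 ?addr0//.
  by move=> k _; rewrite Li0 mulr0.
apply: eq_bigr => i _; congr (_ * _).
rewrite mulmxA -{1}[H]trmxK -trmx_mul.
rewrite [LHS]mxE big_ord_recl L0i mulr0 add0r [RHS]mxE.
by apply: eq_bigr => k _; rewrite Lij !mxE.
Qed.

(** Induction over the columns, with the signs of the first column averaged out. The hypothesis
    bounds column norms because a minor of an orthogonal matrix keeps only that property. A column
    of weight k multiplies its signs by sqrt k / 2 times a vector of norm at most 1, hence costs at
    most k / 8 in the exponent, and these costs add up to d (d + 1) / 16. *)
Lemma sum_expR_wtrace d (X : 'M[R]_d) : (forall j, sqn (col j X) <= 1) ->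
  \sum_(W <- orthogonal_family d) expR (wtrace X W / 2) <=
  (size (orthogonal_family d))%:R * expR ((d * d.+1)%:R / 16).
Proof.
elim: d X => [|d IH] X HX.
  by rewrite big_seq1 /wtrace big_ord0 mul0n !mul0r mul1r.
rewrite size_orthogonal_familyS.
rewrite [orthogonal_family _]/= big_allpairs_dep /=.
pose a s := d.+1%:R * (X^T *m sign_col s) 0 0 / 2 : R.
apply: (@le_trans _ _ (\sum_(s <- enum {ffun 'I_d.+1 -> bool}) expR (a s) *
    ((size (orthogonal_family d))%:R * expR ((d * d.+1)%:R / 16)))).
  apply: ler_sum => s _.
  under eq_bigr do rewrite wtraceS (householder_col (sqn_sign_col s)) mulrDl expRD.
  rewrite -mulr_sumr ler_wpM2l ?expR_ge0// IH// => j.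
  rewrite (le_trans _ (HX (lift 0 j)))//.
  have /orthogonal_mxT HH := householder_orthogonal (sign_col s).
  rewrite -(@sqn_orthogonal _ (householder (sign_col s))^T (col _ X)); last first.
    by rewrite /orthogonal_mx trmxK.
  rewrite /sqn [leRHS]big_ord_recl ler_wpDl ?sqr_ge0//.
  apply: ler_sum => i _; rewrite le_eqVlt; apply/orP; left; apply/eqP.
  congr (_ ^+ 2); rewrite !mxE; apply: eq_bigr => k _; by rewrite !mxE.
rewrite -mulr_suml big_enum /=.
pose v : 'cV[R]_d.+1 := \col_i (Num.sqrt d.+1%:R / 2 * X i 0).
have aE s : a s = \sum_i (-1) ^+ s i * v i 0.
  rewrite /a mxE mulr_sumr mulr_suml; apply: eq_bigr => i _; rewrite !mxE.
  have := sqr_sqrtr (ler0n R d.+1); have : Num.sqrt d.+1%:R != 0 :> R.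
    by rewrite gt_eqF// sqrtr_gt0 ltr0n.
  by set q := Num.sqrt _ => q0 <-; field.
under eq_bigr do rewrite aE.
have sqnv : sqn v = d.+1%:R / 4 * sqn (col 0 X).
  rewrite /sqn mulr_sumr; apply: eq_bigr => i _; rewrite !mxE exprMn.
  by rewrite exprMn sqr_sqrtr ?ler0n//; field.
have sv : expR (sqn v / 2) <= expR ((2 * d.+1)%:R / 16).
  rewrite ler_expR sqnv natrM.
  have := HX 0; have : 0 <= d.+1%:R :> R by exact: ler0n.
  nra.
rewrite [(2 ^ _ * _)%:R]natrM.
rewrite [(d.+1 * d.+2)%N](_ : _ = d * d.+1 + 2 * d.+1)%N; last by lia.
rewrite natrD mulrDl expRD.
set S := (size _)%:R; set A := expR ((d * _)%:R / _).
apply: (@le_trans _ _ ((2 ^ d.+1)%:R * expR (sqn v / 2) * (S * A))).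
  by rewrite ler_wpM2r ?sum_sign_expR// mulr_ge0 ?expR_ge0 ?ler0n.
rewrite [leRHS](_ : _ = (2 ^ d.+1)%:R * expR ((2 * d.+1)%:R / 16) * (S * A)).
  by rewrite ler_wpM2r ?mulr_ge0 ?expR_ge0 ?ler0n// ler_wpM2l.
by rewrite -!mulrA; congr (_ * _); rewrite [RHS]mulrC -!mulrA.
Qed.

(** Diagonal entries of an orthogonal matrix are at most 1, so the deficits 1 - M_ii are nonnegative
    with sum at most d / 4. Each has weight at most d, hence at most d^2 / 4 is lost from the
    maximum d (d + 1) / 2. *)
Lemma wtrace_orthogonal_ge d (X W : 'M[R]_d) :
  orthogonal_mx X -> orthogonal_mx W -> 3 / 4 * d%:R <= \tr (X^T *m W) ->
  (d * d.+1)%:R / 2 - d%:R ^+ 2 / 4 <= wtrace X W.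
Proof.
move=> HX HW htr; set M := X^T *m W.
have M1 i : M i i <= 1.
  have : sqn (col i M) = 1.
    rewrite colE sqn_orthogonal ?/sqn; last first.
      by apply: orthogonal_mxM => //; rewrite /orthogonal_mx trmxK orthogonal_mxT.
    rewrite (bigD1 i)//= big1 ?mxE ?eqxx ?expr1n ?addr0//.
    by move=> k /negPf ki; rewrite mxE ki expr0n.
  rewrite /sqn (bigD1 i)//= mxE => h.
  have : M i i ^+ 2 <= 1 by rewrite -h lerDl sumr_ge0// => k _; rewrite sqr_ge0.
  by nra.
have : \sum_(i < d) (d - i)%:R * (1 - M i i) <= \sum_(i < d) d%:R * (1 - M i i).
  by apply: ler_sum => i _; rewrite ler_wpM2r ?subr_ge0// ler_nat leq_subr.
under eq_bigr do rewrite mulrBr mulr1.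
rewrite sumrB -/(wtrace X W) -mulr_sumr sumrB -/(mxtrace M) -natr_sum.
have -> : (\sum_(i < d) (d - i))%:R = (d * d.+1)%:R / 2 :> R.
  rewrite (reindex_inj rev_ord_inj) /=; under eq_bigr do rewrite subKn//.
  elim: (d) => [|n IH]; first by rewrite big_ord0 mul0r.
  by rewrite big_ord_recr/= natrD IH !natrM -!natr1; field.
rewrite sumr_const card_ord; have : 0 <= d%:R :> R by exact: ler0n.
by move: htr; rewrite -/M; set x := d%:R; set y := \tr M; nra.
Qed.

(** Chernoff bound with parameter 1/2: the exponent d (d + 1) / 16 - d (d + 1) / 4 + d^2 / 8 is at
    most - d^2 / 16. *)
Lemma count_close_orthogonal d (X : 'M[R]_d) : orthogonal_mx X ->
  (count (fun W => 3 / 4 * d%:R <= \tr (X^T *m W)) (orthogonal_family d))%:R <=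
  (size (orthogonal_family d))%:R * expR (- (d%:R ^+ 2 / 16) : R).
Proof.
move=> HX; rewrite -sum1_count natr_sum /=.
set t := ((d * d.+1)%:R / 2 - d%:R ^+ 2 / 4) / 2 : R.
have HX1 j : sqn (col j X) <= 1.
  by rewrite colE sqn_orthogonal// /sqn (bigD1 j)//= big1 ?mxE ?eqxx ?expr1n ?addr0//
    => k /negPf kj; rewrite mxE kj expr0n.
apply: (@le_trans _ _ (expR (- t) *
    \sum_(W <- orthogonal_family d) expR (wtrace X W / 2))).
  rewrite mulr_sumr big_mkcond /= big_seq [leRHS]big_seq.
  apply: ler_sum => W /orthogonal_familyP HW; case: ifPn => [h|_]; last first.
    by rewrite mulr_ge0 ?expR_ge0.
  have hw := wtrace_orthogonal_ge HX HW h.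
  by rewrite -expRD -[leLHS]expR0 ler_expR; rewrite /t; lra.
apply: (le_trans (ler_wpM2l (expR_ge0 _) (sum_expR_wtrace HX1))).
rewrite mulrCA ler_wpM2l ?ler0n// -expRD ler_expR /t.
rewrite natrM -natr1; have : 0 <= d%:R :> R by exact: ler0n.
by set x := d%:R; nra.
Qed.

End orthogonal_packing.

(** * Gaussian integrals on tuples *)

Section tuple_measure.
Variable R : realType.
Local Notation leb := (@lebesgue_measure R).

Section cons_measure.
Variables (m : nat) (mu : {sigma_finite_measure set (m.-tuple R) -> \bar R}).

Definition pair_cons (p : R * m.-tuple R) : m.+1.-tuple R := cons_tuple p.1 p.2.
Definition pair_uncons (t : m.+1.-tuple R) : R * m.-tuple R :=
  (tnth t ord0, [tuple of behead t]).

Lemma pair_consK : cancel pair_cons pair_uncons.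
Proof.
by move=> [x t]; rewrite /pair_uncons /pair_cons /=; congr (_, _); exact: val_inj.
Qed.

Lemma measurable_pair_cons : measurable_fun setT pair_cons.
Proof. exact: measurable_cons. Qed.

Lemma measurable_pair_uncons : measurable_fun setT pair_uncons.
Proof.
apply/measurable_fun_pairP; split; first exact: measurable_tnth.
exact: measurable_behead.
Qed.

(** The iterated integral [iint] is not given as an integral against a measure. Pushing the product
    measure forward along [cons_tuple], one coordinate at a time, gives a sigma-finite measure on
    tuples for which [iintE] holds, and so access to Fubini and domination. *)
Definition cons_measure := pushforward (leb \x mu)%E pair_cons.

Let cons_measure0 : cons_measure set0 = 0%E.
Proof. by rewrite /cons_measure /pushforward preimage_set0 measure0. Qed.

Let cons_measure_ge0 A : (0 <= cons_measure A)%E.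
Proof. by rewrite /cons_measure /pushforward; exact: measure_ge0. Qed.

Let cons_measure_sigma_additive : semi_sigma_additive cons_measure.
Proof.
have mpre A : measurable A -> measurable (pair_cons @^-1` A).
  by move=> mA; rewrite -[X in measurable X]setTI; exact: measurable_pair_cons.
move=> F mF tF mUF; rewrite /cons_measure /pushforward preimage_bigcup.
apply: measure_semi_sigma_additive.
- by move=> n; exact: mpre.
- apply/trivIsetP => /= i j _ _ ij; rewrite -preimage_setI.
  by move/trivIsetP : tF => /(_ _ _ _ _ ij) ->//; rewrite preimage_set0.
- by rewrite -preimage_bigcup; exact: mpre.
Qed.

HB.instance Definition _ := isMeasure.Build _ _ _ cons_measure
  cons_measure0 cons_measure_ge0 cons_measure_sigma_additive.

Let cons_measure_sigma_finite : sigma_finite setT cons_measure.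
Proof.
have /sigma_finiteP[F [TF ndF Foo]] := sigma_finiteT leb.
have /sigma_finiteP[G [TG ndG Goo]] := sigma_finiteT mu.
exists (fun k => pair_uncons @^-1` (F k `*` G k)).
  rewrite -preimage_bigcup; apply/esym; rewrite -[RHS](preimage_setT pair_uncons).
  congr (_ @^-1` _); apply/seteqP; split => // -[x y] _.
  have [k _ Fx] : (\bigcup_k F k) x by rewrite -TF.
  have [l _ Gy] : (\bigcup_k G k) y by rewrite -TG.
  exists (maxn k l) => //; split => /=.
    by move: Fx; exact/subsetPset/ndF/leq_maxl.
  by move: Gy; exact/subsetPset/ndG/leq_maxr.
move=> k; have [mF Fk] := Foo k; have [mG Gk] := Goo k; split.
  rewrite -[X in measurable X]setTI; apply: measurable_pair_uncons => //.
  exact: measurableX.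
rewrite /cons_measure /pushforward.
rewrite (_ : _ @^-1` _ = F k `*` G k).
  by rewrite product_measure1E// lte_mul_pinfty// ge0_fin_numE.
rewrite -comp_preimage [_ \o _](_ : _ = id) ?preimage_id//.
by apply/funext => p; exact: pair_consK.
Qed.

HB.instance Definition _ := Measure_isSigmaFinite.Build _ _ _ cons_measure
  cons_measure_sigma_finite.

End cons_measure.

Fixpoint tmeas m : {sigma_finite_measure set (m.-tuple R) -> \bar R} :=
  match m with
  | 0 => \d_([tuple] : 0.-tuple R)
  | m'.+1 => cons_measure (tmeas m')
  end.

Lemma ge0_integral_tmeasS m (f : m.+1.-tuple R -> \bar R) :
  measurable_fun setT f -> (forall t, 0 <= f t)%E ->
  (\int[tmeas m.+1]_t f t = \int[leb \x tmeas m]_p f (pair_cons p))%E.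
Proof.
move=> mf f0; rewrite ge0_integral_pushforward//.
exact: measurable_pair_cons.
Qed.

Lemma iintE m (f : m.-tuple R -> \bar R) :
  measurable_fun setT f -> (forall t, 0 <= f t)%E ->
  iint f = (\int[tmeas m]_t f t)%E.
Proof.
elim: m f => [|m IH] f mf f0.
  rewrite /= integral_dirac// diracT mul1e; congr f; exact: val_inj.
rewrite ge0_integral_tmeasS// fubini_tonelli1//=; last first.
  by apply: (measurableT_comp mf); exact: measurable_pair_cons.
apply: eq_integral => x _; apply: IH => //.
have mfx : measurable_fun setT (fun t : m.-tuple R => pair_cons (x, t)).
  by apply: (measurableT_comp (@measurable_pair_cons m)); exact: measurable_pair1.
exact: (measurableT_comp mf mfx).
Qed.

End tuple_measure.

(** * One-dimensional Gaussian integrals *)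

Section gaussian1.
Variable R : realType.
Local Notation leb := (@lebesgue_measure R).

(** The linear term [h] is a generating parameter: differentiating an integral in [h] multiplies the
    integrand by x. *)
Definition gq (a h x : R) : R := expR (- (a / 2 * x ^+ 2) + h * x).
Definition gZ (a : R) : R := Num.sqrt (2 * pi / a).

Lemma gZ_gt0 a : 0 < a -> 0 < gZ a.
Proof. by move=> a0; rewrite sqrtr_gt0 divr_gt0// mulr_gt0// pi_gt0. Qed.

Lemma gq_ge0 a h x : 0 <= gq a h x. Proof. exact: expR_ge0. Qed.

Lemma measurable_gq a h : measurable_fun setT (gq a h).
Proof.
apply: measurableT_comp => //; apply: measurable_funD => //.
by apply: measurableT_comp => //; apply: measurable_funM.
Qed.

Lemma gqE a h x : 0 < a -> gq a h x =
  gZ a * expR (h ^+ 2 / (2 * a)) * normal_pdf (h / a) (Num.sqrt a)^-1 x.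
Proof.
move=> a0; have sa0 : Num.sqrt a != 0 by rewrite gt_eqF// sqrtr_gt0.
rewrite normal_pdfE ?invr_eq0// /normal_peak /normal_fun exprVn sqr_sqrtr ?ltW//.
rewrite (_ : a^-1 * pi *+ 2 = 2 * pi / a); last by rewrite -mulr_natr; ring.
rewrite -/(gZ a) [X in X * (_^-1 * _)]mulrC mulrA mulfK ?gt_eqF ?gZ_gt0//.
rewrite -expRD /gq; congr expR; field.
by rewrite gt_eqF.
Qed.

Lemma integral_gq a h : 0 < a ->
  (\int[leb]_x (gq a h x)%:E = (gZ a * expR (h ^+ 2 / (2 * a)))%:E)%E.
Proof.
move=> a0; under eq_integral do rewrite gqE// EFinM.
rewrite integralZl//=; last exact: integrable_normal_pdf.
by rewrite integral_normal_pdf mule1.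
Qed.

Lemma integrable_gq a h : 0 < a -> leb.-integrable setT (EFin \o gq a h).
Proof.
move=> a0; apply/integrableP; split.
  by apply/measurable_EFinP; exact: measurable_gq.
under eq_integral do rewrite /= ger0_norm ?gq_ge0//.
by rewrite integral_gq// ltry.
Qed.

(** From t <= exp t and exp(c |x|) <= exp(c x) + exp(- c x). The bound is uniform over |h| <= H, as
    domination under the integral sign requires. *)
Lemma exp_gq_le a j H h x : `|h| <= H ->
  `|x| ^+ j * gq a h x <= gq a (j%:R + H) x + gq a (- (j%:R + H)) x.
Proof.
move=> hH; have H0 : 0 <= j%:R + H by rewrite addr_ge0 ?ler0n// (le_trans _ hH).
have xj : `|x| ^+ j <= expR (j%:R * `|x|).
  rewrite expRM_natl lerXn2r ?nnegrE ?expR_ge0//.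
  by rewrite (le_trans _ (expR_ge1Dx _))// lerDr.
apply: (@le_trans _ _ (expR (- (a / 2 * x ^+ 2) + (j%:R + H) * `|x|))).
  apply: (le_trans (ler_wpM2r (gq_ge0 _ _ _) xj)).
  rewrite -expRD ler_expR.
  have : h * x <= H * `|x|.
    by rewrite (le_trans (ler_norm _))// normrM ler_wpM2r.
  lra.
rewrite /gq; have [x0|x0] := leP 0 x.
  by rewrite ger0_norm// lerDl expR_ge0.
by rewrite ltr0_norm// mulrN mulNr lerDr expR_ge0.
Qed.

Lemma integrable_gq_dom a H : 0 < a ->
  leb.-integrable setT (EFin \o (fun x => gq a H x + gq a (- H) x)).
Proof.
move=> a0; apply: (integrableD _ (integrable_gq _ a0) (integrable_gq _ a0)) => //.
Qed.

Section bounded_factor.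
Variables (u : R -> R).
Hypotheses (mu : measurable_fun setT u) (u1 : forall x, `|u x| <= 1).

Lemma measurable_mono_gq j a h :
  measurable_fun setT (fun x => u x * x ^+ j * gq a h x).
Proof.
apply: measurable_funM; last exact: measurable_gq.
by apply: measurable_funM => //; exact: exprn_measurable.
Qed.

Lemma mono_gq_le a j H h x : `|h| <= H -> `|u x * x ^+ j * gq a h x| <=
  gq a (j%:R + H) x + gq a (- (j%:R + H)) x.
Proof.
move=> hH; apply: le_trans (exp_gq_le _ _ _ hH).
rewrite !normrM normrX [`|gq _ _ _|]ger0_norm ?gq_ge0// -mulrA.
by rewrite ler_piMl ?mulr_ge0 ?gq_ge0.
Qed.

Lemma integrable_mono_gq j a h : 0 < a ->
  leb.-integrable setT (EFin \o (fun x => u x * x ^+ j * gq a h x)).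
Proof.
move=> a0; apply: le_integrable (integrable_gq_dom (j%:R + `|h|) a0) => //.
  by apply/measurable_EFinP; exact: measurable_mono_gq.
move=> x _; rewrite /= lee_fin (le_trans (mono_gq_le _ _ _ (lexx _)))//.
exact: ler_norm.
Qed.

(** Differentiation under the integral on the interval of radius 1 around [h], dominated by
    [exp_gq_le] with H = |h| + 1. The bounded factor [u] will be 1, a sine or a cosine. *)
Lemma is_derive_mono_gq j a h : 0 < a ->
  is_derive (h : R) (1 : R) (fun t : R => \int[leb]_x (u x * x ^+ j * gq a t x))
  (\int[leb]_x (u x * x ^+ j.+1 * gq a h x)).
Proof.
move=> a0.
pose f (t : R) (x : measurableTypeR R) : R := u x * x ^+ j * gq a t x.
have df t x : is_derive (t : R) (1 : R) (f^~ x) (u x * x ^+ j.+1 * gq a t x).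
  rewrite /f /gq; apply: is_derive_eq.
  rewrite /GRing.scale /= [x ^+ j.+1]exprSr mulr0 !add0r mulr1 mul1r.
  by rewrite -!mulrA [expR _ * x]mulrC.
have hI : `](h - 1), (h + 1)[%classic h by rewrite /= in_itv/=; lra.
pose H := `|h| + 1.
pose G x := gq a (j.+1%:R + H) x + gq a (- (j.+1%:R + H)) x.
have d1E t x : partial1of2 f t x = u x * x ^+ j.+1 * gq a t x.
  by rewrite partial1of2E derive_val.
have hyp1 t : `](h - 1), (h + 1)[%classic t -> leb.-integrable setT (EFin \o f t).
  by move=> _; exact: integrable_mono_gq.
have hyp2 t x : `](h - 1), (h + 1)[%classic t -> [set: measurableTypeR R] x ->
    derivable (f^~ x) t 1 by [].
have hyp3 x : 0 <= G x by rewrite addr_ge0 ?gq_ge0.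
have hyp4 : leb.-integrable setT (EFin \o G) by exact: integrable_gq_dom.
have hyp5 t x : `](h - 1), (h + 1)[%classic t -> [set: measurableTypeR R] x ->
    `|partial1of2 f t x| <= G x.
  move=> ht _; rewrite d1E; apply: mono_gq_le; rewrite /H.
  move: ht; rewrite /= in_itv/= => /andP[h1 h2].
  have := ler_norm h; have := ler_norm (- h); rewrite normrN => h3 h4.
  by rewrite ler_norml; apply/andP; split; lra.
apply: DeriveDef.
  exact: (derivable_under_integral measurableT hI hyp1 hyp2 hyp3 hyp4 hyp5).
rewrite -derive1E.
rewrite (differentiation_under_integral measurableT hI hyp1 hyp2 hyp3 hyp4 hyp5).
by apply: eq_Rintegral => x _; rewrite -d1E.
Qed.

End bounded_factor.

End gaussian1.

Section lebesgue_affine.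
Variable R : realType.
Local Notation leb := (@lebesgue_measure R).

Let affine (k c : R) : measurableTypeR R -> measurableTypeR R := fun x => k * x + c.

Let measurable_affine k c : measurable_fun setT (affine k c).
Proof. by apply: measurable_funD => //; exact: measurable_funM. Qed.

(** The pushforward of Lebesgue measure under x -> k x + c, rescaled by k, agrees with it on
    half-open intervals, hence everywhere by uniqueness. *)
Lemma ge0_integral_affine (k c : R) (f : R -> \bar R) : 0 < k ->
  measurable_fun setT f -> (forall x, 0 <= f x)%E ->
  (\int[leb]_x f x = k%:E * \int[leb]_x f (k * x + c)%R)%E.
Proof.
move=> k0 mf f0.
pose nu := pushforward leb (affine k c).
have H (A : set (measurableTypeR R)) : measurable A ->
    leb A = mscale (NngNum (ltW k0)) (pushforward leb (affine k c)) A.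
  apply: lebesgue_measure_unique => //= _ [[a b]] _ <-.
  rewrite /mscale /= /pushforward.
  have -> : affine k c @^-1` `]a, b]%classic = `](a - c) / k, (b - c) / k]%classic.
    apply/seteqP; split => x; rewrite /preimage /affine /= !in_itv /=.
      by rewrite ltr_pdivrMr// ler_pdivlMr// mulrC ltrBlDr lerBrDr.
    by rewrite ltr_pdivrMr// ler_pdivlMr// [x * k]mulrC ltrBlDr lerBrDr.
  rewrite !lebesgue_measure_itv /= !lte_fin ltr_pM2r ?invr_gt0// ltrD2r.
  case: ifPn => [ab|_]; last by rewrite mule0.
  by rewrite -!EFinB -EFinM; congr EFin; field; rewrite gt_eqF.
rewrite (eq_measure_integral (mscale (NngNum (ltW k0)) nu)) => [|A mA _].
  rewrite ge0_integral_mscale//=; congr (_ * _)%E.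
  by rewrite ge0_integral_pushforward.
exact: (H (measurable_affine k c)).
Qed.

Lemma integral_translate (c : R) (f : R -> \bar R) : measurable_fun setT f ->
  (\int[leb]_x f (x + c)%R = \int[leb]_x f x)%E.
Proof.
move=> mf; rewrite integralE [RHS]integralE; congr (_ - _)%E.
  rewrite [RHS](@ge0_integral_affine 1 c)//; last exact: measurable_funepos.
  by rewrite mul1e; apply: eq_integral => x _; rewrite mul1r funeposE funeposE.
rewrite [RHS](@ge0_integral_affine 1 c)//; last exact: measurable_funeneg.
by rewrite mul1e; apply: eq_integral => x _; rewrite mul1r funenegE funenegE.
Qed.

End lebesgue_affine.

Section gaussian1_moments.
Variable R : realType.
Local Notation leb := (@lebesgue_measure R).
Implicit Types a h p q c d x z : R.

Let one : R -> R := cst 1.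
Let one1 x : `|one x| <= 1. Proof. by rewrite /one /= normr1. Qed.
Let mone : measurable_fun setT one. Proof. by []. Qed.

Lemma Rintegral_gq a h : 0 < a ->
  \int[leb]_x (gq a h x) = gZ a * expR (h ^+ 2 / (2 * a)).
Proof. by move=> a0; rewrite /Rintegral integral_gq. Qed.

Let K0 a h : 0 < a -> \int[leb]_x (one x * x ^+ 0 * gq a h x) =
  gZ a * expR (h ^+ 2 / (2 * a)).
Proof.
move=> a0; rewrite -Rintegral_gq//; apply: eq_Rintegral => x _.
by rewrite /one /= expr0 !mul1r.
Qed.

(** Each moment is the derivative in [h] of the closed form of the previous one. *)
Let K1 a h : 0 < a -> \int[leb]_x (one x * x ^+ 1 * gq a h x) =
  h / a * (gZ a * expR (h ^+ 2 / (2 * a))).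
Proof.
move=> a0; have d := is_derive_mono_gq mone one1 0 h a0.
rewrite -(@derive_val _ _ _ _ _ _ _ d).
under eq_fun do rewrite K0//.
rewrite derive_val /GRing.scale /=; field.
by rewrite gt_eqF.
Qed.

Let K2 a h : 0 < a -> \int[leb]_x (one x * x ^+ 2 * gq a h x) =
  (a^-1 + (h / a) ^+ 2) * (gZ a * expR (h ^+ 2 / (2 * a))).
Proof.
move=> a0; have d := is_derive_mono_gq mone one1 1 h a0.
rewrite -(@derive_val _ _ _ _ _ _ _ d).
under eq_fun do rewrite K1//.
rewrite derive_val /GRing.scale /=; field.
by rewrite gt_eqF.
Qed.

Lemma integrable_quad_gq a h p c q d : 0 < a ->
  leb.-integrable setT (EFin \o (fun x => (p + c * x) * (q + d * x) * gq a h x)).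
Proof.
move=> a0.
have I j := integrable_mono_gq mone one1 j h a0.
rewrite (_ : _ \o _ = fun x => ((p * q)%:E * (one x * x ^+ 0 * gq a h x)%:E +
  (p * d + c * q)%:E * (one x * x ^+ 1 * gq a h x)%:E +
  (c * d)%:E * (one x * x ^+ 2 * gq a h x)%:E)%E); last first.
  apply/funext => x /=; rewrite -!EFinM -!EFinD; congr EFin.
  by rewrite /one /=; ring.
apply: integrableD => //; last exact: integrableZl (I 2%N).
by apply: integrableD => //; [exact: integrableZl (I 0%N)|exact: integrableZl (I 1%N)].
Qed.

Lemma Rintegral_quad_gq a h p c q d : 0 < a ->
  \int[leb]_x ((p + c * x) * (q + d * x) * gq a h x) =
  ((p + c * h / a) * (q + d * h / a) + c * d / a) *
    (gZ a * expR (h ^+ 2 / (2 * a))).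
Proof.
move=> a0.
have I j := integrable_mono_gq mone one1 j h a0.
have IZ j (k : R) : leb.-integrable setT
    (EFin \o (fun x => k * (one x * x ^+ j * gq a h x))).
  exact: integrableZl (I j).
transitivity (\int[leb]_x (p * q * (one x * x ^+ 0 * gq a h x) +
  (p * d + c * q) * (one x * x ^+ 1 * gq a h x) +
  (c * d) * (one x * x ^+ 2 * gq a h x))).
  by apply: eq_Rintegral => x _; rewrite /one /=; ring.
rewrite RintegralD//; last exact: (integrableD _ (IZ _ _) (IZ _ _)).
rewrite RintegralD// !RintegralZl// K0// K1// K2//.
by field; rewrite gt_eqF.
Qed.

Let phase z th a h := \int[leb]_x (cos (z * x + th) * gq a h x).

Let mcos z th : measurable_fun setT (fun x => cos (z * x + th)).
Proof.
apply: measurableT_comp; first exact: continuous_measurable_fun (@continuous_cos R).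
by apply: measurable_funD => //; exact: measurable_funM.
Qed.

Let cos1 z th x : `|cos (z * x + th)| <= 1.
Proof. exact: cos_max. Qed.



Let msin z th : measurable_fun setT (fun x => sin (z * x + th)).
Proof.
apply: measurableT_comp; first exact: continuous_measurable_fun (@continuous_sin R).
by apply: measurable_funD => //; exact: measurable_funM.
Qed.

Let sin1 z th x : `|sin (z * x + th)| <= 1.
Proof. exact: sin_max. Qed.

Lemma integrable_cos_gq a z th : 0 < a ->
  leb.-integrable setT (EFin \o (fun x => cos (z * x + th) * gq a 0 x)).
Proof.
move=> a0; have := integrable_mono_gq (mcos z th) (cos1 z th) 0 0 a0.
by apply: eq_integrable => // x _; rewrite /= expr0 mulr1.
Qed.

Let isin a z th : 0 < a ->
  leb.-integrable setT (EFin \o (fun x => sin (z * x + th) * gq a 0 x)).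
Proof.
move=> a0; have := integrable_mono_gq (msin z th) (sin1 z th) 0 0 a0.
by apply: eq_integrable => // x _; rewrite /= expr0 mulr1.
Qed.

Let Rintegral_sin_shift a z th c : 0 < a ->
  \int[leb]_x (sin (z * x + th + c) * gq a 0 x) =
  sin c * phase z th a 0 + cos c * \int[leb]_x (sin (z * x + th) * gq a 0 x).
Proof.
move=> a0; rewrite /phase -RintegralZl//; last exact: integrable_cos_gq.
rewrite -RintegralZl//; last exact: isin.
rewrite -RintegralD//.
- by apply: eq_Rintegral => x _; rewrite sinD; ring.
- exact: integrableZl (integrable_cos_gq _ _ _).
- exact: integrableZl (isin _ _ _).
Qed.

(** Completing the square turns the tilt into a translation by h / a, which shifts the phase by z h
    / a. *)
Let Rintegral_sin_tilt a z th h : 0 < a ->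
  \int[leb]_x (sin (z * x + th) * x ^+ 0 * gq a h x) = expR (h ^+ 2 / (2 * a)) *
  (sin (z * h / a) * phase z th a 0 +
   cos (z * h / a) * \int[leb]_x (sin (z * x + th) * gq a 0 x)).
Proof.
move=> a0; rewrite -Rintegral_sin_shift//.
set g := fun x => sin (z * x + th + z * h / a) * gq a 0 x.
have mg : measurable_fun setT (EFin \o g).
  have := measurable_int _ (isin z (th + z * h / a) a0).
  by apply: eq_measurable_fun => x _; rewrite /g /= addrA.
have gE x : sin (z * x + th) * x ^+ 0 * gq a h x =
    expR (h ^+ 2 / (2 * a)) * g (x - h / a).
  rewrite /g expr0 mulr1 [in RHS](_ : z * _ + th + _ = z * x + th); last first.
    by field; rewrite gt_eqF.
  rewrite mulrCA; congr (_ * _); rewrite /gq -expRD; congr expR.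
  by field; rewrite gt_eqF.
have ig : leb.-integrable setT (EFin \o (fun x => g (x - h / a))).
  have := integrableZl measurableT (expR (- (h ^+ 2 / (2 * a))))
    (integrable_mono_gq (msin z th) (sin1 z th) 0 h a0).
  apply: eq_integrable => // x _.
  rewrite /= -EFinM; congr EFin; rewrite gE.
  by rewrite mulrA -expRD addNr expR0 mul1r.
under eq_Rintegral do rewrite gE.
rewrite RintegralZl//; congr (_ * _).
by rewrite /Rintegral (integral_translate (- (h / a)) mg).
Qed.

(** Integration by parts for the Gaussian weight, obtained by differentiating the translation
    identity [Rintegral_sin_tilt] at h = 0. *)
Let stein a z th : 0 < a ->
  \int[leb]_x (sin (z * x + th) * x ^+ 1 * gq a 0 x) = z / a * phase z th a 0.
Proof.
move=> a0; have d := is_derive_mono_gq (msin z th) (sin1 z th) 0 0 a0.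
rewrite -(@derive_val _ _ _ _ _ _ _ d).
under eq_fun do rewrite Rintegral_sin_tilt//.
rewrite derive_val /GRing.scale /= expr0n /= !(mulr0, mul0r) sin0 cos0 expR0.
by field; rewrite gt_eqF.
Qed.

Let is_derive_phase a z th : 0 < a ->
  is_derive (z : R) (1 : R) (fun t : R => phase t th a 0) (- (z / a) * phase z th a 0).
Proof.
move=> a0.
pose f (t : R) (x : measurableTypeR R) : R := cos (t * x + th) * gq a 0 x.
have df t x : is_derive (t : R) (1 : R) (f^~ x) (- (x * sin (t * x + th)) * gq a 0 x).
  rewrite /f; apply: is_derive_eq.
  rewrite /GRing.scale /=; ring.
have hI : `](z - 1), (z + 1)[%classic z by rewrite /= in_itv/=; lra.
pose G x := gq a (1%:R + 0) x + gq a (- (1%:R + 0)) x.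
have d1E t x : partial1of2 f t x = - (x * sin (t * x + th)) * gq a 0 x.
  by rewrite partial1of2E derive_val.
have hyp1 t : `](z - 1), (z + 1)[%classic t -> leb.-integrable setT (EFin \o f t).
  by move=> _; exact: integrable_cos_gq.
have hyp2 t x : `](z - 1), (z + 1)[%classic t -> [set: measurableTypeR R] x ->
    derivable (f^~ x) t 1 by [].
have hyp3 x : 0 <= G x by rewrite addr_ge0 ?gq_ge0.
have hyp4 : leb.-integrable setT (EFin \o G) by exact: integrable_gq_dom.
have hyp5 t x : `](z - 1), (z + 1)[%classic t -> [set: measurableTypeR R] x ->
    `|partial1of2 f t x| <= G x.
  move=> ht _; rewrite d1E.
  have := @exp_gq_le R a 1 0 0 x; rewrite normr0 => /(_ (lexx _)).
  apply: le_trans; rewrite expr1 normrM normrN normrM.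
  by rewrite [`|gq _ _ _|]ger0_norm ?gq_ge0// ler_wpM2r ?gq_ge0// ler_piMr// sin_max.
apply: DeriveDef.
  exact: (derivable_under_integral measurableT hI hyp1 hyp2 hyp3 hyp4 hyp5).
rewrite -derive1E.
rewrite (differentiation_under_integral measurableT hI hyp1 hyp2 hyp3 hyp4 hyp5).
rewrite mulNr -stein// -mulN1r -RintegralZl//; last first.
  exact: integrable_mono_gq.
apply: eq_Rintegral => x _; by rewrite d1E expr1; ring.
Qed.

(** As a function of z the integral solves y' = - (z / a) y, so its product with exp(z^2 / (2 a)) is
    constant and can be read off at z = 0. *)
Lemma Rintegral_cos_gq a z th : 0 < a ->
  \int[leb]_x (cos (z * x + th) * gq a 0 x) =
  cos th * (gZ a * expR (- (z ^+ 2 / (2 * a)))).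
Proof.
move=> a0.
pose f (t : R) := phase t th a 0 * expR (t ^+ 2 / (2 * a)).
have df (t : R) : is_derive (t : R) (1 : R) f 0.
  have ? := is_derive_phase t th a0.
  rewrite /f; apply: is_derive_eq.
  rewrite /GRing.scale /=; field.
  by rewrite gt_eqF.
have : f z = f 0 by exact: is_derive_0_is_cst.
rewrite /f expr0n/= mul0r expR0 mulr1 => h.
rewrite expRN mulrA; apply/eqP.
rewrite -(can2_eq (mulfK (lt0r_neq0 (expR_gt0 _))) (mulfVK (lt0r_neq0 (expR_gt0 _)))).
rewrite -/(phase z th a 0) h /phase.
under eq_Rintegral do rewrite mul0r add0r.
by rewrite RintegralZl ?Rintegral_gq ?expr0n ?mul0r ?expR0 ?mulr1//; exact: integrable_gq.
Qed.

End gaussian1_moments.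

(** * Iterated integrals of signed functions *)

Section fubini_real.
Context d1 d2 (T1 : measurableType d1) (T2 : measurableType d2) (R : realType).
Variables (m1 : {sigma_finite_measure set T1 -> \bar R})
  (m2 : {sigma_finite_measure set T2 -> \bar R}).

(** [Rint2] subtracts iterated integrals of the positive and the negative part. Tonelli makes each
    an integral over the product, where they recombine; integrability of every section keeps [fine]
    harmless on the inner integrals. *)
Lemma fubini_Rintegral (h : T1 -> T2 -> R) :
  (m1 \x m2)%E.-integrable setT (EFin \o (fun p => h p.1 p.2)) ->
  (forall x, m2.-integrable setT (EFin \o h x)) ->
  fine (\int[m1]_x \int[m2]_y (Num.max (h x y) 0)%:E)%E -
  fine (\int[m1]_x \int[m2]_y (Num.max (- h x y) 0)%:E)%E =
  \int[m1]_x (\int[m2]_y h x y).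
Proof.
move=> ih ihx; set H := EFin \o _ in ih.
have mH : measurable_fun setT H := measurable_int _ ih.
have posE : (\int[m1 \x m2]_p H^\+ p =
    \int[m1]_x \int[m2]_y (Num.max (h x y) 0)%:E)%E.
  rewrite fubini_tonelli1//; last exact: measurable_funepos.
  by apply: eq_integral => x _; apply: eq_integral => y _;
     rewrite funeposE /H /= EFin_max.
have negE : (\int[m1 \x m2]_p H^\- p =
    \int[m1]_x \int[m2]_y (Num.max (- h x y) 0)%:E)%E.
  rewrite fubini_tonelli1//; last exact: measurable_funeneg.
  by apply: eq_integral => x _; apply: eq_integral => y _;
     rewrite funenegE /H /= EFin_max.
rewrite -posE -negE -fineB; first last.
- exact: integrable_neg_fin_num.
- exact: integrable_pos_fin_num.
rewrite -integralE -integral12_prod_meas1// /Rintegral; congr fine.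
by apply: eq_integral => x _; rewrite fineK//; exact: (integrable_fin_num measurableT (ihx x)).
Qed.

End fubini_real.

Section tuple_integral.
Variable R : realType.
Local Notation leb := (@lebesgue_measure R).

Lemma measurable_iint d (T : measurableType d) m (G : T -> m.-tuple R -> \bar R) :
  measurable_fun setT (fun p : T * m.-tuple R => G p.1 p.2) ->
  (forall x t, 0 <= G x t)%E ->
  measurable_fun setT (fun x => iint (G x)).
Proof.
move=> mG G0; rewrite (_ : (fun x => _) = fubini_F (tmeas R m) (fun p => G p.1 p.2)).
  exact: measurable_fun_fubini_tonelli_F.
apply/funext => x; rewrite iintE//.
exact: (measurableT_comp mG (measurable_pair1 x)).
Qed.

Lemma iint_cat m n (f : (m + n).-tuple R -> \bar R) :
  iint f = iint (fun x : m.-tuple R => iint (fun y : n.-tuple R => f (cat_tuple x y))).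
Proof.
elim: m f => [|m IH] f /=.
  by congr iint; apply/funext => y; congr f; exact: val_inj.
apply: eq_integral => x _; rewrite IH; congr iint; apply/funext => t.
by congr iint; apply/funext => y; congr f; exact: val_inj.
Qed.

Lemma iint_ge0 m (f : m.-tuple R -> \bar R) :
  (forall t, 0 <= f t)%E -> (0 <= iint f)%E.
Proof.
elim: m f => [|m IH] f f0 //=.
by apply: integral_ge0 => x _; exact: IH.
Qed.

Lemma iintZ m (k : \bar R) (f : m.-tuple R -> \bar R) : (0 <= k)%E ->
  measurable_fun setT f -> (forall t, 0 <= f t)%E ->
  iint (fun t => k * f t)%E = (k * iint f)%E.
Proof.
move=> k0 mf f0; rewrite !iintE//.
- by rewrite ge0_integralZl.
- exact: emeasurable_funM.
- by move=> t; rewrite mule_ge0.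
Qed.

Lemma iintD m (f g : m.-tuple R -> \bar R) :
  measurable_fun setT f -> (forall t, 0 <= f t)%E ->
  measurable_fun setT g -> (forall t, 0 <= g t)%E ->
  iint (fun t => f t + g t)%E = (iint f + iint g)%E.
Proof.
move=> mf f0 mg g0; rewrite !iintE ?ge0_integralD//.
  exact: emeasurable_funD.
by move=> t; rewrite adde_ge0.
Qed.

Lemma le_iint m (f g : m.-tuple R -> \bar R) :
  measurable_fun setT f -> (forall t, 0 <= f t)%E ->
  measurable_fun setT g -> (forall t, f t <= g t)%E ->
  (iint f <= iint g)%E.
Proof.
move=> mf f0 mg fg; have g0 t : (0 <= g t)%E by exact: le_trans (fg t).
by rewrite !iintE// ge0_le_integral.
Qed.

Lemma iint_prod m (g : 'I_m -> R -> R) (v : 'I_m -> R) :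
  (forall i, measurable_fun setT (g i)) -> (forall i x, 0 <= g i x) ->
  (forall i, \int[leb]_x (g i x)%:E = (v i)%:E)%E ->
  iint (fun t : m.-tuple R => (\prod_i g i (tnth t i))%:E) = (\prod_i v i)%:E.
Proof.
elim: m g v => [|m IH] g v mg g0 vE /=.
  by rewrite !big_ord0.
under eq_integral => x _.
  under [X in iint X]eq_fun => t.
    rewrite big_ord_recl.
    under eq_bigr do rewrite tnthS.
    rewrite (_ : tnth _ _ = x); last by [].
    rewrite EFinM.
    over.
  rewrite iintZ; first last.
  - by move=> t; rewrite lee_fin prodr_ge0.
  - apply/measurable_EFinP; apply: measurable_prod => i _.
    by apply: measurableT_comp => //; exact: measurable_tnth.
  - by rewrite lee_fin.
  rewrite (IH (fun i => g (lift ord0 i)) (fun i => v (lift ord0 i)))//.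
  over.
rewrite ge0_integralZr//=.
- by rewrite vE -EFinM big_ord_recl.
- by apply/measurable_EFinP; exact: mg.
- by move=> x _; rewrite lee_fin.
- rewrite lee_fin prodr_ge0// => i _.
  by rewrite -lee_fin -vE integral_ge0// => x _; rewrite lee_fin.
Qed.

Definition sqt m (t : m.-tuple R) : R := \sum_i tnth t i ^+ 2.
Definition dott m (c : 'I_m -> R) (t : m.-tuple R) : R := \sum_i c i * tnth t i.

Lemma sqt_ge0 m (t : m.-tuple R) : 0 <= sqt t.
Proof. by apply: sumr_ge0 => i _; exact: sqr_ge0. Qed.

Lemma tnth_cons0 m (x : R) (t : m.-tuple R) : tnth (cons_tuple x t) ord0 = x.
Proof. by []. Qed.

Lemma tnth_consS m (x : R) (t : m.-tuple R) i :
  tnth (cons_tuple x t) (lift ord0 i) = tnth t i.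
Proof. by rewrite tnthS. Qed.

Lemma sqt_cons m (x : R) (t : m.-tuple R) : sqt (cons_tuple x t) = x ^+ 2 + sqt t.
Proof.
rewrite /sqt big_ord_recl tnth_cons0; congr (_ + _).
by apply: eq_bigr => i _; rewrite tnth_consS.
Qed.

Lemma dott_cons m (c : 'I_m.+1 -> R) (x : R) (t : m.-tuple R) :
  dott c (cons_tuple x t) = c ord0 * x + dott (fun i => c (lift ord0 i)) t.
Proof.
rewrite /dott big_ord_recl tnth_cons0; congr (_ + _).
by apply: eq_bigr => i _; rewrite tnth_consS.
Qed.

Lemma measurable_dott m c : measurable_fun setT (@dott m c).
Proof.
apply: measurable_sum => i; apply: measurable_funM => //.
exact: measurable_tnth.
Qed.

Lemma measurable_sqt m : measurable_fun setT (@sqt m).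
Proof.
apply: measurable_sum => i; apply: measurable_funX; exact: measurable_tnth.
Qed.

Lemma iint_exp_sqt m (a : R) : 0 < a ->
  iint (fun t : m.-tuple R => (expR (- (a * sqt t)))%:E) = (gZ (2 * a) ^+ m)%:E.
Proof.
move=> a0; have a20 : 0 < 2 * a by rewrite mulr_gt0.
rewrite -[in RHS](card_ord m) -prodr_const.
rewrite -(@iint_prod m (fun=> gq (2 * a) 0) (fun=> gZ (2 * a))).
- congr iint; apply/funext => t; congr EFin; rewrite /gq -expR_sum; congr expR.
  rewrite mulr_sumr -sumrN; apply: eq_bigr => i _; by field.
- by move=> _; exact: measurable_gq.
- by move=> _ x; exact: gq_ge0.
- by move=> _; rewrite integral_gq// expr0n/= mul0r expR0 mulr1.
Qed.

(** One condition that gives integrability, passes to sections over initial coordinates and is easy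
    to check for a polynomial times a Gaussian. *)
Definition gauss_dom m (h : m.-tuple R -> R) :=
  exists C a, [/\ 0 <= C, 0 < a & forall t, `|h t| <= C * expR (- (a * sqt t))].

Lemma integrable_exp_sqt m (a C : R) : 0 < a ->
  (tmeas R m).-integrable setT (EFin \o (fun t => C * expR (- (a * sqt t)))).
Proof.
move=> a0.
have mE : measurable_fun setT (EFin \o (fun t : m.-tuple R => expR (- (a * sqt t)))).
  apply/measurable_EFinP; apply: measurableT_comp => //.
  by apply: measurableT_comp => //; apply: measurable_funM => //; exact: measurable_sqt.
apply: (@integrableZl _ _ _ _ _ measurableT C
  (EFin \o (fun t : m.-tuple R => expR (- (a * sqt t))))).
apply/integrableP; split => //.
under eq_integral do rewrite gee0_abs ?lee_fin ?expR_ge0//.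
by rewrite -iintE ?iint_exp_sqt ?ltry// => t; rewrite lee_fin expR_ge0.
Qed.

Lemma integrable_gauss_dom m (h : m.-tuple R -> R) :
  measurable_fun setT h -> gauss_dom h ->
  (tmeas R m).-integrable setT (EFin \o h).
Proof.
move=> mh [C [a [C0 a0 hC]]].
apply: le_integrable (integrable_exp_sqt m C a0) => //.
  exact/measurable_EFinP.
move=> t _; rewrite /= lee_fin (le_trans (hC t))// ler_norm//.
Qed.

Lemma RintE m (h : m.-tuple R -> R) : (tmeas R m).-integrable setT (EFin \o h) ->
  Defs.Rint h = \int[tmeas R m]_t h t.
Proof.
move=> ih; have mh := measurable_int _ ih.
rewrite /Defs.Rint /Rintegral integralE fineB; first last.
- exact: integrable_neg_fin_num.
- exact: integrable_pos_fin_num.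
have E1 : (fun t => (Num.max (h t) 0)%:E) = ((EFin \o h)^\+)%E.
  by apply/funext => t; rewrite funeposE /= EFin_max.
have E2 : (fun t => (Num.max (- h t) 0)%:E) = ((EFin \o h)^\-)%E.
  by apply/funext => t; rewrite funenegE /= EFin_max.
rewrite E1 E2 !iintE//.
- exact: measurable_funeneg.
- exact: measurable_funepos.
Qed.

Definition pair_gauss_dom m n (h : m.-tuple R -> n.-tuple R -> R) :=
  exists C a, [/\ 0 <= C, 0 < a &
    forall s t, `|h s t| <= C * expR (- (a * sqt s)) * expR (- (a * sqt t))].

Lemma integrable_pair_gauss_dom m n (h : m.-tuple R -> n.-tuple R -> R) :
  measurable_fun setT (fun p : m.-tuple R * n.-tuple R => h p.1 p.2) ->
  pair_gauss_dom h ->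
  (tmeas R m \x tmeas R n)%E.-integrable setT (EFin \o (fun p => h p.1 p.2)).
Proof.
move=> mh [C [a [C0 a0 hC]]].
apply/integrable12ltyP; first exact/measurable_EFinP.
pose g1 (s : m.-tuple R) := C * expR (- (a * sqt s)).
pose g2 (t : n.-tuple R) := expR (- (a * sqt t)).
have g10 s : 0 <= g1 s by rewrite mulr_ge0 ?expR_ge0.
have mg2 : measurable_fun setT (EFin \o g2).
  apply/measurable_EFinP; apply: measurableT_comp => //.
  by apply: measurableT_comp => //; apply: measurable_funM => //; exact: measurable_sqt.
have ig2 : (\int[tmeas R n]_t (g2 t)%:E = (gZ (2 * a) ^+ n)%:E)%E.
  by rewrite -iintE ?iint_exp_sqt// => t; rewrite lee_fin expR_ge0.
have mabs : measurable_fun setT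
    (fun p : m.-tuple R * n.-tuple R => `|(EFin \o (fun p => h p.1 p.2)) p|%E).
  by apply: measurableT_comp => //; exact/measurable_EFinP.
apply: (@le_lt_trans _ _ (\int[tmeas R m]_s ((gZ (2 * a) ^+ n)%:E * (g1 s)%:E))%E).
  apply: ge0_le_integral => //.
  - by move=> s _; apply: integral_ge0.
  - exact: (measurable_fun_fubini_tonelli_F _ mabs).
  - by have /integrableP[] := integrableZl measurableT (gZ (2 * a) ^+ n)
      (integrable_exp_sqt m C a0).
  - move=> s _; rewrite -ig2 -ge0_integralZr ?lee_fin//; last first.
      by move=> t _; rewrite lee_fin expR_ge0.
    apply: ge0_le_integral => //.
    + exact: (measurableT_comp mabs (measurable_pair1 s)).
    + exact: emeasurable_funM.
    + by move=> t _; rewrite /= lee_fin /g1 mulrC.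
have /integrableP[mk] := integrableZl measurableT (gZ (2 * a) ^+ n)
  (integrable_exp_sqt m C a0).
apply: le_lt_trans; apply: ge0_le_integral => //.
- move=> s _; rewrite mule_ge0// lee_fin; last exact: g10.
  by rewrite exprn_ge0// ltW// gZ_gt0// mulr_gt0.
- exact: measurableT_comp.
- by move=> s _; exact: lee_abs.
Qed.

End tuple_integral.

Section tuple_fubini.
Variable R : realType.
Local Notation leb := (@lebesgue_measure R).

Lemma Rint_fubini m n (h : m.-tuple R -> n.-tuple R -> R) :
  measurable_fun setT (fun p : m.-tuple R * n.-tuple R => h p.1 p.2) ->
  pair_gauss_dom h ->
  fine (iint (fun s => iint (fun t => (Num.max (h s t) 0)%:E))) -
  fine (iint (fun s => iint (fun t => (Num.max (- h s t) 0)%:E))) =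
  Defs.Rint (fun s => Defs.Rint (h s)).
Proof.
move=> mh dh; have ih := integrable_pair_gauss_dom mh dh.
have mhs s : measurable_fun setT (h s).
  exact: (measurableT_comp mh (measurable_pair1 s)).
have dhs s : gauss_dom (h s).
  have [C [a [C0 a0 hC]]] := dh.
  exists (C * expR (- (a * sqt s))), a; split => // .
  by rewrite mulr_ge0 ?expR_ge0.
have ihs s : (tmeas R n).-integrable setT (EFin \o h s).
  exact: integrable_gauss_dom.
have mmax (g : m.-tuple R -> n.-tuple R -> R) :
    measurable_fun setT (fun p : m.-tuple R * n.-tuple R => g p.1 p.2) ->
    iint (fun s => iint (fun t => (Num.max (g s t) 0)%:E)) =
    (\int[tmeas R m]_s \int[tmeas R n]_t (Num.max (g s t) 0)%:E)%E.
  move=> mg.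
  have mg' : measurable_fun setT
      (fun p : m.-tuple R * n.-tuple R => (Num.max (g p.1 p.2) 0)%:E).
    by apply/measurable_EFinP; exact: measurable_maxr.
  have g0 s t : (0 <= (Num.max (g s t) 0)%:E)%E by rewrite lee_fin le_max lexx orbT.
  rewrite iintE; first last.
  - by move=> s; apply: iint_ge0.
  - exact: (measurable_iint mg').
  apply: eq_integral => s _; rewrite iintE//.
  exact: (measurableT_comp mg' (measurable_pair1 s)).
rewrite mmax// (mmax (fun s t => - h s t)); last exact: measurableT_comp.
rewrite fubini_Rintegral// RintE.
  by apply: eq_Rintegral => s _; rewrite RintE.
have := integrable_fubini_F ih.
apply: eq_integrable => // s _; rewrite /fubini_F /=.
by rewrite RintE// /Rintegral fineK//; exact: (integrable_fin_num measurableT (ihs s)).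
Qed.

Lemma Rint2E n (h : n.-tuple R -> n.-tuple R -> R) :
  measurable_fun setT (fun p : n.-tuple R * n.-tuple R => h p.1 p.2) ->
  pair_gauss_dom h ->
  Rint2 h = Defs.Rint (fun s => Defs.Rint (h s)).
Proof. exact: Rint_fubini. Qed.

Lemma measurable_cat_tuple m n : measurable_fun setT
  (fun p : m.-tuple R * n.-tuple R => cat_tuple p.1 p.2 : (m + n).-tuple R).
Proof.
apply/measurable_fun_tnthP => i.
case: (split_ordP i) => j ->.
  rewrite (_ : _ \o _ = fun p => tnth p.1 j).
    by apply: (measurableT_comp (measurable_tnth _)).
  by apply/funext => p /=; rewrite tnth_lshift.
rewrite (_ : _ \o _ = fun p => tnth p.2 j).
  by apply: (measurableT_comp (measurable_tnth _)).
by apply/funext => p /=; rewrite tnth_rshift.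
Qed.

Lemma sqt_cat m n (s : m.-tuple R) (t : n.-tuple R) :
  sqt (cat_tuple s t) = sqt s + sqt t.
Proof.
by rewrite /sqt big_split_ord /=; congr (_ + _); apply: eq_bigr => i _;
   rewrite ?tnth_lshift ?tnth_rshift.
Qed.

Lemma Rint_cat m n (h : (m + n).-tuple R -> R) :
  measurable_fun setT h -> gauss_dom h ->
  Defs.Rint h = Defs.Rint (fun s => Defs.Rint (fun t => h (cat_tuple s t))).
Proof.
move=> mh [C [a [C0 a0 hC]]]; rewrite -Rint_fubini.
- by rewrite {1}/Defs.Rint !iint_cat.
- exact: (measurableT_comp mh (@measurable_cat_tuple m n)).
- exists C, a; split => // s t.
  by rewrite -mulrA -expRD -opprD -mulrDr -sqt_cat.
Qed.

Lemma Rint_cons m (h : m.+1.-tuple R -> R) :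
  measurable_fun setT h -> gauss_dom h ->
  Defs.Rint h = \int[leb]_x Defs.Rint (fun t => h (cons_tuple x t)).
Proof.
move=> mh dh; have ih := integrable_gauss_dom mh dh.
have mp (g : m.+1.-tuple R -> \bar R) : measurable_fun setT g ->
    measurable_fun setT (fun p : R * m.-tuple R => g (cons_tuple p.1 p.2)).
  by move=> mg; apply: (measurableT_comp mg); exact: measurable_pair_cons.
have ms x (g : m.+1.-tuple R -> \bar R) : measurable_fun setT g ->
    measurable_fun setT (fun t : m.-tuple R => g (cons_tuple x t)).
  by move=> mg; exact: (measurableT_comp (mp _ mg) (measurable_pair1 x)).
have mEh : measurable_fun setT (EFin \o h) by exact/measurable_EFinP.
have ip : (leb \x tmeas R m)%E.-integrable setT
    (EFin \o (fun p => h (cons_tuple p.1 p.2))).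
  apply/integrableP; split; first exact: (mp _ mEh).
  have /integrableP[_] := ih; rewrite ge0_integral_tmeasS//.
  exact: measurableT_comp.
have is_ x : (tmeas R m).-integrable setT
    (EFin \o (fun t => h (cons_tuple x t))).
  apply: integrable_gauss_dom; first by apply/measurable_EFinP; exact: (ms x _ mEh).
  have [C [a [C0 a0 hC]]] := dh; exists C, a; split => // t.
  apply: le_trans (hC _) _; rewrite ler_wpM2l// ler_expR lerN2 (ler_wpM2l (ltW a0))//.
  by rewrite sqt_cons lerDr sqr_ge0.
have mmax (g : m.+1.-tuple R -> R) : measurable_fun setT g ->
    iint (fun t => (Num.max (g t) 0)%:E) =
    (\int[leb]_x \int[tmeas R m]_t (Num.max (g (cons_tuple x t)) 0)%:E)%E.
  move=> mg /=; apply: eq_integral => x _; rewrite iintE//.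
    apply: (ms x (fun t => (Num.max (g t) 0)%:E)).
    by apply/measurable_EFinP; exact: measurable_maxr.
  by move=> t; rewrite lee_fin le_max lexx orbT.
rewrite /Defs.Rint mmax// (mmax (fun t => - h t)); last exact: measurableT_comp.
transitivity (\int[leb]_x (\int[tmeas R m]_t h (cons_tuple x t))).
  exact: (@fubini_Rintegral _ _ _ _ _ leb (tmeas R m) (fun x t => h (cons_tuple x t))).
by apply: eq_Rintegral => x _; rewrite -RintE.
Qed.

Lemma RintZl m (k : R) (h : m.-tuple R -> R) :
  (tmeas R m).-integrable setT (EFin \o h) ->
  Defs.Rint (fun t => k * h t) = k * Defs.Rint h.
Proof.
by move=> ih; rewrite !RintE ?RintegralZl//; exact: (integrableZl measurableT k ih).
Qed.

End tuple_fubini.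

(** * Isotropic Gaussian integrals in several variables *)

Section gaussian_tuple.
Variable R : realType.
Local Notation leb := (@lebesgue_measure R).
Implicit Types m : nat.

Definition gexp m (a : R) (h : 'I_m -> R) (t : m.-tuple R) : R :=
  expR (- (a / 2 * sqt t) + dott h t).

Lemma measurable_gexp m a (h : 'I_m -> R) : measurable_fun setT (gexp a h).
Proof.
apply: measurableT_comp => //; apply: measurable_funD; last exact: measurable_dott.
apply: measurableT_comp => //; apply: measurable_funM => //.
exact: measurable_sqt.
Qed.

Lemma gexp_cons m a (h : 'I_m.+1 -> R) x (t : m.-tuple R) :
  gexp a h (cons_tuple x t) =
  gq a (h ord0) x * gexp a (fun i => h (lift ord0 i)) t.
Proof.
by rewrite /gexp /gq -expRD sqt_cons dott_cons; congr expR; ring.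
Qed.

Lemma tnth_sqt_le m (t : m.-tuple R) i : tnth t i ^+ 2 <= sqt t.
Proof. by rewrite /sqt (bigD1 i)//= lerDl sumr_ge0// => j _; rewrite sqr_ge0. Qed.

Lemma affine_le_exp m (b p : R) (c : 'I_m -> R) : 0 < b ->
  exists2 C, 0 <= C & forall t, `|p + dott c t| <= C * expR (b * sqt t).
Proof.
move=> b0; pose S := \sum_i `|c i|.
have S0 : 0 <= S by apply: sumr_ge0.
have pS : 0 <= `|p| + S by rewrite addr_ge0.
exists ((`|p| + S) * (1 + b^-1)).
  by rewrite mulr_ge0// addr_ge0// invr_ge0 ltW.
move=> t; rewrite -mulrA.
have s0 := sqt_ge0 t.
apply: (@le_trans _ _ ((`|p| + S) * (1 + sqt t))).
  rewrite (le_trans (ler_normD _ _))// mulrDl lerD//.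
    by rewrite ler_peMr// lerDl.
  rewrite (le_trans (ler_norm_sum _ _ _))// /S mulr_suml ler_sum// => i _.
  rewrite normrM ler_wpM2l//.
  have := tnth_sqt_le t i; rewrite -(real_normK (num_real (tnth t i))).
  have := normr_ge0 (tnth t i); nra.
rewrite ler_wpM2l//.
apply: (@le_trans _ _ ((1 + b^-1) * (1 + b * sqt t))).
  rewrite mulrDl mulrDr mul1r mulrDr mulKf ?gt_eqF// mulr1 mul1r.
  have : 0 <= b^-1 by rewrite invr_ge0 ltW.
  have : 0 <= b * sqt t by rewrite mulr_ge0// ltW.
  lra.
rewrite ler_wpM2l ?expR_ge1Dx//.
by rewrite addr_ge0// invr_ge0 ltW.
Qed.

Lemma dott_le m (b : R) (h : 'I_m -> R) (t : m.-tuple R) : 0 < b ->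
  dott h t <= (\sum_i h i ^+ 2) / (4 * b) + b * sqt t.
Proof.
move=> b0; rewrite /dott /sqt mulr_suml mulr_sumr -big_split /=.
apply: ler_sum => i _; set x := h i; set y := tnth t i.
rewrite -subr_ge0 (_ : _ - _ = (x - 2 * b * y) ^+ 2 / (4 * b)); last first.
  by field; rewrite gt_eqF.
by rewrite divr_ge0 ?sqr_ge0// mulr_ge0// ltW.
Qed.

Definition quad_gexp m (a : R) h p c q d (t : m.-tuple R) :=
  (p + dott c t) * (q + dott d t) * gexp a h t.

Lemma measurable_quad_gexp m a (h : 'I_m -> R) p c q d :
  measurable_fun setT (quad_gexp a h p c q d).
Proof.
apply: measurable_funM; last exact: measurable_gexp.
by apply: measurable_funM; apply: measurable_funD => //; exact: measurable_dott.
Qed.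

Lemma gauss_dom_quad_gexp m a (h : 'I_m -> R) p c q d : 0 < a ->
  gauss_dom (quad_gexp a h p c q d).
Proof.
(* Of the decay a / 2, one share a / 8 pays for each affine factor and one for the tilt, which
   leaves a / 8. *)
move=> a0; have b0 : 0 < a / 8 by rewrite divr_gt0.
have [C1 C10 hC1] := affine_le_exp p c b0.
have [C2 C20 hC2] := affine_le_exp q d b0.
pose H := (\sum_i h i ^+ 2) / (4 * (a / 8)).
exists (C1 * C2 * expR H), (a / 8); split => //.
  by rewrite !mulr_ge0 ?expR_ge0.
move=> t; rewrite /quad_gexp !normrM [`|gexp _ _ _|]ger0_norm ?expR_ge0//.
apply: (@le_trans _ _ (C1 * expR (a / 8 * sqt t) * (C2 * expR (a / 8 * sqt t)) *
    expR (- (a / 2 * sqt t) + (H + a / 8 * sqt t)))).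
  rewrite ler_pM ?mulr_ge0 ?expR_ge0//; first by rewrite ler_pM.
  by rewrite ler_expR lerD2l dott_le.
rewrite (_ : C1 * _ * _ * _ = C1 * C2 * (expR (a / 8 * sqt t) *
  expR (a / 8 * sqt t) * expR (- (a / 2 * sqt t) + (H + a / 8 * sqt t)))); last by ring.
rewrite -2![in leRHS]mulrA [leRHS]mulrA ler_wpM2l ?mulr_ge0//.
rewrite -!expRD ler_expR; lra.
Qed.

Definition sdot m (c h : 'I_m -> R) : R := \sum_i c i * h i.

(** Product of the means plus the covariance, times the mass. Fixing the first coordinate x only
    moves the constants to p + c_0 x and q + d_0 x, so the class of integrands is stable under
    induction on the dimension. *)
Lemma Rint_quad_gexp m a (h : 'I_m -> R) p c q d : 0 < a ->
  Defs.Rint (quad_gexp a h p c q d) =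
  ((p + sdot c h / a) * (q + sdot d h / a) + sdot c d / a) *
  (gZ a ^+ m * expR (sdot h h / (2 * a))).
Proof.
move=> a0; elim: m h p c q d => [|m IH] h p c q d.
  rewrite RintE; last first.
    by apply: integrable_gauss_dom; [exact: measurable_quad_gexp|exact: gauss_dom_quad_gexp].
  rewrite /Rintegral integral_dirac//; last first.
    by apply/measurable_EFinP; exact: measurable_quad_gexp.
  rewrite diracT mul1e /= /quad_gexp /gexp /sdot /dott /sqt !big_ord0.
  by rewrite !mul0r mulr0 oppr0 !addr0 expr0 expR0 mul1r.
rewrite Rint_cons; [|exact: measurable_quad_gexp|exact: gauss_dom_quad_gexp].
pose h' i := h (lift ord0 i); pose c' i := c (lift ord0 i).
pose d' i := d (lift ord0 i).
have E x : Defs.Rint (fun t => quad_gexp a h p c q d (cons_tuple x t)) =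
    gq a (h ord0) x * Defs.Rint (quad_gexp a h' (p + c ord0 * x) c' (q + d ord0 * x) d').
  rewrite -RintZl; last first.
    by apply: integrable_gauss_dom; [exact: measurable_quad_gexp|exact: gauss_dom_quad_gexp].
  congr Defs.Rint; apply/funext => t.
  by rewrite /quad_gexp gexp_cons !dott_cons; ring.
under eq_Rintegral do rewrite E IH.
set G := gZ a ^+ m * expR (sdot h' h' / (2 * a)).
set A := sdot c' h' / a; set B := sdot d' h' / a; set D := sdot c' d' / a.
(* The covariance [D] already collected is written as a product of constant affine functions, so
   that the one-variable formula applies to both terms. *)
transitivity (\int[leb]_x (G * ((p + A + c ord0 * x) * (q + B + d ord0 * x) * gq a (h ord0) x
   + (D + 0 * x) * (1 + 0 * x) * gq a (h ord0) x))).
  by apply: eq_Rintegral => x _; ring.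
have I1 := integrable_quad_gq (h ord0) (p + A) (c ord0) (q + B) (d ord0) a0.
have I2 := integrable_quad_gq (h ord0) D 0 1 0 a0.
rewrite RintegralZl//; last exact: (integrableD _ I1 I2).
rewrite RintegralD// !Rintegral_quad_gq//.
rewrite /sdot !big_ord_recl -/(sdot c' h') -/(sdot d' h') -/(sdot c' d') -/(sdot h' h').
rewrite expr2 (exprS (gZ a)) (mulrDl _ _ (2 * a)^-1) expRD /G /A /B /D; field.
by rewrite gt_eqF.
Qed.

Lemma sdot0 m (h : 'I_m -> R) : sdot (fun=> 0) h = 0.
Proof. by rewrite /sdot big1// => i _; rewrite mul0r. Qed.

Lemma iint_gexp m a (h : 'I_m -> R) : 0 < a ->
  iint (fun t => (gexp a h t)%:E) = (gZ a ^+ m * expR (sdot h h / (2 * a)))%:E.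
Proof.
move=> a0.
have -> : gZ a ^+ m * expR (sdot h h / (2 * a)) =
    \prod_(i < m) (gZ a * expR (h i ^+ 2 / (2 * a))).
  rewrite big_split /= prodr_const card_ord -expR_sum; congr (_ * expR _).
  by rewrite /sdot mulr_suml; apply: eq_bigr => i _; rewrite expr2.
rewrite -(@iint_prod R m (fun i => gq a (h i))).
- congr iint; apply/funext => t; congr EFin; rewrite /gexp /gq -expR_sum.
  congr expR; rewrite /sqt /dott mulr_sumr -sumrN -big_split /=.
  by [].

- by move=> i; exact: measurable_gq.
- by move=> i x; exact: gq_ge0.
- by move=> i; exact: integral_gq.
Qed.

Definition cos_gexp m (a th : R) (z : 'I_m -> R) (t : m.-tuple R) :=
  cos (th + dott z t) * gexp a (fun=> 0) t.

Lemma measurable_cos_gexp m a th (z : 'I_m -> R) :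
  measurable_fun setT (cos_gexp a th z).
Proof.
apply: measurable_funM; last exact: measurable_gexp.
apply: measurableT_comp; first exact: continuous_measurable_fun (@continuous_cos R).
by apply: measurable_funD => //; exact: measurable_dott.
Qed.

Lemma gauss_dom_cos_gexp m a th (z : 'I_m -> R) : 0 < a ->
  gauss_dom (cos_gexp a th z).
Proof.
move=> a0; exists 1, (a / 2); split; rewrite ?divr_gt0// => t.
rewrite normrM ler_pM ?cos_max// ger0_norm ?expR_ge0// ler_expR.
by rewrite /dott big1 ?addr0// => i _; rewrite mul0r.
Qed.

(** The free phase [th] absorbs the contribution of the first coordinate in the induction; it also
    yields the sine integral later. *)
Lemma Rint_cos_gexp m a th (z : 'I_m -> R) : 0 < a ->
  Defs.Rint (cos_gexp a th z) =
  cos th * (gZ a ^+ m * expR (- (sdot z z / (2 * a)))).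
Proof.
move=> a0; elim: m th z => [|m IH] th z.
  rewrite RintE; last first.
    by apply: integrable_gauss_dom; [exact: measurable_cos_gexp|exact: gauss_dom_cos_gexp].
  rewrite /Rintegral integral_dirac//; last first.
    by apply/measurable_EFinP; exact: measurable_cos_gexp.
  rewrite diracT mul1e /= /cos_gexp /gexp /sdot /dott /sqt !big_ord0.
  by rewrite !mul0r mulr0 oppr0 !addr0 expr0 expR0 mul1r.
rewrite Rint_cons; [|exact: measurable_cos_gexp|exact: gauss_dom_cos_gexp].
pose z' i := z (lift ord0 i).
have E x : Defs.Rint (fun t => cos_gexp a th z (cons_tuple x t)) =
    gq a 0 x * Defs.Rint (cos_gexp a (th + z ord0 * x) z').
  rewrite -RintZl; last first.
    by apply: integrable_gauss_dom; [exact: measurable_cos_gexp|exact: gauss_dom_cos_gexp].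
  congr Defs.Rint; apply/funext => t.
  by rewrite /cos_gexp gexp_cons dott_cons addrA; ring.
under eq_Rintegral do rewrite E IH.
set G := gZ a ^+ m * expR (- (sdot z' z' / (2 * a))).
transitivity (\int[leb]_x (G * (cos (z ord0 * x + th) * gq a 0 x))).
  by apply: eq_Rintegral => x _; rewrite [_ + th]addrC; ring.
rewrite RintegralZl//; last exact: integrable_cos_gq.
rewrite Rintegral_cos_gq// /sdot big_ord_recl -/(sdot z' z').
by rewrite expr2 (exprS (gZ a)) (mulrDl _ _ (2 * a)^-1) opprD expRD /G; ring.
Qed.

End gaussian_tuple.

(** * Covariance matrices coupling two groups of modes *)

Section reflection_form.
Variables (R : realType) (m r : nat) (W : 'M[R]_m).
Hypothesis HW : orthogonal_mx W.
Local Notation n := (m + (m + r))%N.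

Definition refl : 'M[R]_(m + (m + r)) :=
  block_mx 0 (row_mx W 0) (col_mx W^T 0) (block_mx 0 0 0 1%:M).

Lemma refl_tr : refl^T = refl.
Proof.
by rewrite /refl !tr_block_mx tr_row_mx tr_col_mx trmxK !trmx0 trmx1.
Qed.

Lemma refl_sqr : refl *m refl = 1%:M.
Proof.
have WW := orthogonal_mxT HW.
rewrite /refl mulmx_block mul_row_col mul_row_block mul_block_col mul_col_row.
rewrite mulmx_block add_block_mx WW HW.
rewrite !(mul0mx, mulmx0, mul1mx, mulmx1, addr0, add0r) row_mx0 col_mx0.
by rewrite -(scalar_mx_block m r 1) -scalar_mx_block.
Qed.

(** These matrices form a commutative algebra with eigenvalues a + b and a - b, because [refl] is an
    involution. Covariances, precisions and their differences all stay in it. *)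
Definition reflin (a b : R) : 'M[R]_(m + (m + r)) := a%:M + b *: refl.

Lemma reflin_inv (a b : R) : a ^+ 2 != b ^+ 2 ->
  invmx (reflin a b) =
  reflin (a / (a ^+ 2 - b ^+ 2)) (- b / (a ^+ 2 - b ^+ 2)).
Proof.
rewrite -subr_eq0 => ab.
have E : reflin a b *m reflin (a / (a ^+ 2 - b ^+ 2)) (- b / (a ^+ 2 - b ^+ 2)) = 1%:M.
  rewrite /reflin mulmxDl !mulmxDr -!scalemxAl -!scalemxAr refl_sqr.
  rewrite !mul_scalar_mx mul_mx_scalar.
  move: refl => P; apply/matrixP => i j; rewrite !mxE.
  by case: (i == j); rewrite /= ?mulr1n ?mulr0n; field.
have /mulmx1_unit[U _] := E.
by rewrite -[RHS](mulKmx U) E mulmx1.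
Qed.

(** One block row elimination: by orthogonality of W the Schur complement is again diagonal. *)
Lemma det_reflin (a b : R) : 0 < a ->
  \det (reflin a b) = (a ^+ 2 - b ^+ 2) ^+ m * (a + b) ^+ r.
Proof.
move=> a0; have an0 : a != 0 by rewrite gt_eqF.
pose B : 'M[R]_(m, m + r) := b *: row_mx W 0.
pose C : 'M[R]_(m + r, m) := b *: col_mx W^T 0.
pose D : 'M[R]_(m + r) := block_mx a%:M 0 0 (a + b)%:M.
have E : reflin a b = block_mx a%:M B C D.
  rewrite /reflin /refl scale_block_mx (scalar_mx_block m (m + r)) add_block_mx.
  rewrite scaler0 !add0r addr0; congr block_mx.
  rewrite (scalar_mx_block m r) scale_block_mx add_block_mx !scaler0 !addr0.
  rewrite /D; congr block_mx.
  by apply/matrixP => i j; rewrite !mxE mulrnDl mulr_natr.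
have F : block_mx 1%:M 0 (- a^-1 *: C) 1%:M *m reflin a b =
    block_mx a%:M B 0 (block_mx (a - b ^+ 2 / a)%:M 0 0 (a + b)%:M).
  rewrite E mulmx_block !mul1mx !mul0mx !addr0; congr block_mx.
    by rewrite -scalemxAl mul_mx_scalar scalerA mulNr mulVf// scaleN1r addNr.
  rewrite -scalemxAl -scalemxAl -scalemxAr mul_col_row HW mulmx0 !mul0mx.
  rewrite !scale_block_mx add_block_mx !scaler0 !add0r; congr block_mx.
  by apply/matrixP => i j; rewrite !mxE; case: (i == j); rewrite /= ?mulr1n ?mulr0n; field.
have : \det (block_mx 1%:M 0 (- a^-1 *: C) 1%:M *m reflin a b) = \det (reflin a b).
  by rewrite det_mulmx det_lblock !det1 !mul1r.
rewrite F det_ublock (det_ublock (n1 := m)) !det_scalar => <-.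
by rewrite mulrA -exprMn; congr (_ ^+ _ * _); field.
Qed.

Lemma tcol_cat k l (s : k.-tuple R) (t : l.-tuple R) :
  tcol (cat_tuple s t) = col_mx (tcol s) (tcol t).
Proof.
apply/matrixP => i j; rewrite !mxE; case: (split_ordP i) => h ->.
  by rewrite tnth_lshift mxE.
by rewrite tnth_rshift mxE.
Qed.

Lemma sqt_tcol k (s : k.-tuple R) : sqt s = sqn (tcol s).
Proof. by apply: eq_bigr => i _; rewrite mxE. Qed.

Definition qrefl (x : n.-tuple R) : R := ((tcol x)^T *m refl *m tcol x) 0 0.

Definition bil (s t : m.-tuple R) : R := ((tcol s)^T *m W *m tcol t) 0 0.

Lemma qrefl_cat (s t : m.-tuple R) (u : r.-tuple R) :
  qrefl (cat_tuple s (cat_tuple t u)) = 2 * bil s t + sqt u.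
Proof.
rewrite /qrefl /bil !tcol_cat -mulmxA /refl mul_block_col.
rewrite mul0mx add0r mul_row_col mul0mx addr0 mul_block_col mul_col_mx.
rewrite !mul0mx mul1mx add_col_mx !(add0r, addr0).
rewrite !tr_col_mx !mul_row_col sqnE -sqt_tcol mulmxA.
rewrite mxE [X in _ + X]mxE [X in _ + (_ + X)]mxE eqxx mulr1n addrA; congr (_ + _).
have -> : (tcol t)^T *m (W^T *m tcol s) = ((tcol s)^T *m W *m tcol t)^T.
  by rewrite !trmx_mul trmxK.
by rewrite [X in _ + X]mxE; ring.
Qed.

(** For a symmetric involution, v + refl v and v - refl v have squared norms 2 (|v|^2 + q) and 2
    (|v|^2 - q), both nonnegative. *)
Lemma qrefl_le (x : n.-tuple R) : `|qrefl x| <= sqt x.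
Proof.
have tD (A B : 'cV[R]_n) : (A + B)^T = A^T + B^T by exact: linearD.
have tZ k (A : 'cV[R]_n) : (k *: A)^T = k *: A^T by exact: linearZ.
have H (k : R) : k ^+ 2 = 1 -> 0 <= sqt x + k * qrefl x.
  move=> k1; set v := tcol x.
  have : 0 <= sqn (v + k *: (refl *m v)) by apply: sumr_ge0 => i _; exact: sqr_ge0.
  suff -> : sqn (v + k *: (refl *m v)) = 2 * (sqt x + k * qrefl x).
    by rewrite pmulr_rge0.
  have /matrixP/(_ 0 0) := sqnE (v + k *: (refl *m v)).
  rewrite [RHS]mxE mulr1n => <-.
  rewrite tD tZ trmx_mul refl_tr mulmxDl !mulmxDr -!scalemxAl -!scalemxAr.
  rewrite -[v^T *m refl *m (refl *m v)]mulmxA (mulmxA refl) refl_sqr mul1mx mulmxA.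
  rewrite sqnE -sqt_tcol scalerA -expr2 k1 scale1r.
  rewrite !mxE /= mulr1n -/(qrefl x) /qrefl -/v.
  set q := (\sum_j _); rewrite (_ : (v^T *m refl *m v) 0 0 = q); last by rewrite mxE.
  ring.
rewrite ler_norml; have := H 1 (expr1n _ _); have := H (-1).
rewrite sqrrN expr1n => /(_ erefl); lra.
Qed.

Lemma quad_reflin (a b : R) (x : n.-tuple R) :
  ((tcol x)^T *m reflin a b *m tcol x) 0 0 = a * sqt x + b * qrefl x.
Proof.
rewrite /reflin mulmxDr mulmxDl mul_mx_scalar -!scalemxAl -scalemxAr -scalemxAl.
by rewrite mxE [X in X + _]mxE [X in _ + X]mxE sqnE mxE mulr1n -sqt_tcol.
Qed.

End reflection_form.

Section cat_sections.
Variables (R : realType) (m n : nat) (h : (m + n).-tuple R -> R).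

Lemma measurable_cat_section (s : m.-tuple R) : measurable_fun setT h ->
  measurable_fun setT (fun t : n.-tuple R => h (cat_tuple s t)).
Proof.
move=> mh; have mp := measurableT_comp mh (@measurable_cat_tuple R m n).
exact: (measurableT_comp mp (measurable_pair1 s)).
Qed.

Lemma gauss_dom_cat_section (s : m.-tuple R) : gauss_dom h ->
  gauss_dom (fun t : n.-tuple R => h (cat_tuple s t)).
Proof.
move=> [C [a [C0 a0 hC]]]; exists C, a; split => // t.
apply: le_trans (hC _) _; rewrite ler_wpM2l// ler_expR lerN2 (ler_wpM2l (ltW a0))//.
by rewrite sqt_cat lerDr sqt_ge0.
Qed.

End cat_sections.

Section reflection_gaussian.
Variables (R : realType) (m r : nat) (W : 'M[R]_m).
Hypothesis HW : orthogonal_mx W.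
Local Notation n := (m + (m + r))%N.
Local Notation qW := (@qrefl R m r W).

Definition phi (a b : R) (x : n.-tuple R) : R :=
  expR (- ((a * sqt x + b * qW x) / 2)).

(** The mass of [phi]: the second group has conditional precision a, the first is left with the
    Schur complement (a^2 - b^2) / a, and the r remaining modes have precision a + b. *)
Definition Zr (a b : R) : R :=
  (gZ a * gZ ((a ^+ 2 - b ^+ 2) / a)) ^+ m * gZ (a + b) ^+ r.

Lemma measurable_qrefl : measurable_fun setT qW.
Proof.
rewrite (_ : qW = fun x =>
    \sum_j (\sum_i tnth x i * refl r W i j) * tnth x j); last first.
  apply/funext => x; rewrite /qrefl mxE; apply: eq_bigr => j _; rewrite !mxE.
  by congr (_ * _); apply: eq_bigr => i _; rewrite !mxE.
apply: measurable_sum => j; apply: measurable_funM; last exact: measurable_tnth.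
apply: measurable_sum => i; apply: measurable_funM => //; exact: measurable_tnth.
Qed.

Lemma measurable_phi a b : measurable_fun setT (phi a b).
Proof.
apply: measurableT_comp => //; apply: measurableT_comp => //.
apply: measurable_funM => //; apply: measurable_funD; apply: measurable_funM => //.
  exact: measurable_sqt.
exact: measurable_qrefl.
Qed.

Definition wdot (s : m.-tuple R) : 'I_m -> R := fun j => \sum_i tnth s i * W i j.

Lemma bilE (s t : m.-tuple R) : bil W s t = dott (wdot s) t.
Proof.
rewrite /bil mxE; apply: eq_bigr => j _; rewrite !mxE; congr (_ * _).
by apply: eq_bigr => i _; rewrite !mxE.
Qed.

(** Here W disappears: integrating out the second group leaves only |W^T s|^2 = |s|^2, which is why
    [Zr] does not depend on W. *)
Lemma sqn_wdot (s : m.-tuple R) : sdot (wdot s) (wdot s) = sqt s.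
Proof.
rewrite sqt_tcol -(@sqn_orthogonal _ _ W^T); last first.
  by rewrite /orthogonal_mx trmxK orthogonal_mxT.
apply: eq_bigr => j _; rewrite -expr2; congr (_ ^+ 2).
by rewrite mxE; apply: eq_bigr => i _; rewrite !mxE mulrC.
Qed.

Lemma phi_cat a b (s t : m.-tuple R) (u : r.-tuple R) :
  phi a b (cat_tuple s (cat_tuple t u)) =
  gexp a (fun=> 0) s * gexp a (fun j => - b * wdot s j) t * gexp (a + b) (fun=> 0) u.
Proof.
have d0 k (v : k.-tuple R) : dott (fun=> 0) v = 0.
  by rewrite /dott big1// => i _; rewrite mul0r.
have dZ : dott (fun j => - b * wdot s j) t = - b * dott (wdot s) t.
  by rewrite /dott mulr_sumr; apply: eq_bigr => i _; rewrite mulrA.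
rewrite /phi qrefl_cat !sqt_cat bilE /gexp !d0 dZ -!expRD; congr expR.
by field.
Qed.

Lemma gauss_dom_phi a b : `|b| < a ->
  forall x, phi a b x <= expR (- ((a - `|b|) / 2 * sqt x)).
Proof.
move=> ab x; rewrite ler_expR.
have : - (b * qW x) <= `|b| * sqt x.
  by rewrite (le_trans (ler_norm _))// normrN normrM ler_wpM2l// qrefl_le.
lra.
Qed.

Lemma coupling_gt0 (a b : R) : `|b| < a -> 0 < (a ^+ 2 - b ^+ 2) / a.
Proof.
move=> ab; have a0 : 0 < a by exact: le_lt_trans ab.
rewrite divr_gt0// subr_gt0 -(real_normK (num_real b)).
by rewrite ltrXn2r ?nnegrE ?normr_ge0 ?ltW.
Qed.

Lemma addr_gt0_norm (a b : R) : `|b| < a -> 0 < a + b.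
Proof. by rewrite ltr_norml => /andP[]; rewrite ltrNl; lra. Qed.

Lemma gexp_coupling (a b : R) (s : m.-tuple R) : 0 < a ->
  gexp a (fun=> 0) s * expR (b ^+ 2 * sqt s / (2 * a)) =
  gexp ((a ^+ 2 - b ^+ 2) / a) (fun=> 0) s.
Proof.
move=> a0; rewrite /gexp -expRD; congr expR.
rewrite (_ : dott _ _ = 0); last by rewrite /dott big1// => i _; rewrite mul0r.
by field; rewrite gt_eqF.
Qed.

Lemma sdot_wdot b (s : m.-tuple R) :
  sdot (fun j => - b * wdot s j) (fun j => - b * wdot s j) = b ^+ 2 * sqt s.
Proof.
by rewrite -sqn_wdot /sdot mulr_sumr; apply: eq_bigr => i _; ring.
Qed.

Lemma iint_phi a b : `|b| < a -> iint (fun x => (phi a b x)%:E) = (Zr a b)%:E.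
Proof.
move=> ab; have a0 : 0 < a by exact: le_lt_trans ab.
have mg k (c : R) (h : 'I_k -> R) : measurable_fun setT (fun t => (gexp c h t)%:E).
  by apply/measurable_EFinP; exact: measurable_gexp.
have g0 k (c : R) (h : 'I_k -> R) t : (0 <= (gexp c h t)%:E)%E.
  by rewrite lee_fin expR_ge0.
rewrite iint_cat.
under eq_fun => s.
  rewrite iint_cat.
  under eq_fun => t.
    under eq_fun do rewrite phi_cat EFinM.
    rewrite iintZ//; last by rewrite lee_fin mulr_ge0 ?expR_ge0.
    rewrite (iint_gexp _ (addr_gt0_norm ab)) sdot0 mul0r expR0 mulr1.
    rewrite -EFinM mulrAC EFinM.
    over.
  rewrite iintZ//; last by rewrite lee_fin mulr_ge0 ?expR_ge0// exprn_ge0 ?sqrtr_ge0.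
  rewrite (iint_gexp _ a0) sdot_wdot -EFinM.
  rewrite [X in X%:E](_ : _ = (gZ (a + b) ^+ r * gZ a ^+ m) *
      gexp ((a ^+ 2 - b ^+ 2) / a) (fun=> 0) s); last first.
    by rewrite -gexp_coupling//; ring.
  rewrite EFinM.
  over.
rewrite iintZ//; last by rewrite lee_fin mulr_ge0// exprn_ge0 ?sqrtr_ge0.
rewrite (iint_gexp _ (coupling_gt0 ab)) sdot0 mul0r expR0 mulr1 -EFinM.
by congr EFin; rewrite /Zr exprMn; ring.
Qed.

Definition left_coef (c : 'I_m -> R) (k : 'I_n) : R :=
  match fintype.split k with inl i => c i | inr _ => 0 end.
Definition mid_coef (j : 'I_m) (k : 'I_n) : R := (k == rshift m (lshift r j))%:R.

Lemma dott_left_coef c (s : m.-tuple R) (v : (m + r).-tuple R) :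
  dott (left_coef c) (cat_tuple s v) = dott c s.
Proof.
rewrite /dott big_split_ord /= [X in _ + X]big1 ?addr0; last first.
  by move=> i _; rewrite /left_coef (unsplitK (inr i)) mul0r.
apply: eq_bigr => i _; rewrite /left_coef (unsplitK (inl i)).
by rewrite tnth_lshift.
Qed.

Lemma dott_mid_coef j (x : n.-tuple R) :
  dott (mid_coef j) x = tnth x (rshift m (lshift r j)).
Proof.
rewrite /dott (bigD1 (rshift m (lshift r j)))//= /mid_coef eqxx mul1r big1 ?addr0//.
by move=> k /negPf ->; rewrite mul0r.
Qed.

Lemma gauss_dom_moment_phi a b (c d : 'I_n -> R) : `|b| < a ->
  gauss_dom (fun x => dott c x * dott d x * phi a b x).
Proof.
move=> ab; pose e := (a - `|b|) / 2.
have e0 : 0 < e by rewrite /e; lra.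
have [C [k [C0 k0 hC]]] := gauss_dom_quad_gexp (fun=> 0) 0 c 0 d (mulr_gt0 (ltr0Sn R 1) e0).
exists C, k; split => // x; apply: le_trans (hC x).
rewrite /quad_gexp !add0r !normrM ler_wpM2l ?mulr_ge0//.
rewrite [`|phi _ _ _|]ger0_norm ?expR_ge0// [leRHS]ger0_norm ?expR_ge0//.
apply: le_trans (gauss_dom_phi ab x) _; rewrite ler_expR.
rewrite (_ : dott _ _ = 0); last by rewrite /dott big1// => i _; rewrite mul0r.
by rewrite /e; lra.
Qed.

(** The covariance is read from the off-diagonal block of the inverse of [reflin a b]. Given s, the
    second group has mean - (b / a) W^T s, and s has the Schur complement as precision. *)
Lemma Rint_phi_moment a b c j : `|b| < a ->
  Defs.Rint (fun x => dott (left_coef c) x * dott (mid_coef j) x * phi a b x) =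
  - b / (a ^+ 2 - b ^+ 2) * sdot c (fun i => W i j) * Zr a b.
Proof.
move=> ab; have a0 : 0 < a by exact: le_lt_trans ab.
have ab0 : 0 < a + b by exact: addr_gt0_norm.
have g0 := coupling_gt0 ab.
have mphi (c1 c2 : 'I_n -> R) :
    measurable_fun setT (fun x => dott c1 x * dott c2 x * phi a b x).
  apply: measurable_funM; last exact: measurable_phi.
  by apply: measurable_funM; exact: measurable_dott.
have iq k p' (h : 'I_k -> R) q1 q2 q3 q4 : 0 < p' ->
    (tmeas R k).-integrable setT (EFin \o quad_gexp p' h q1 q2 q3 q4).
  move=> p0; apply: integrable_gauss_dom; first exact: measurable_quad_gexp.
  exact: gauss_dom_quad_gexp.
pose K := gZ (a + b) ^+ r.
pose dj i : R := (i == j)%:R.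
have E1 s t : Defs.Rint (fun u => dott (left_coef c) (cat_tuple s (cat_tuple t u)) *
    dott (mid_coef j) (cat_tuple s (cat_tuple t u)) *
    phi a b (cat_tuple s (cat_tuple t u))) =
    dott c s * gexp a (fun=> 0) s * K *
    quad_gexp a (fun j => - b * wdot s j) 0 dj 1 (fun=> 0) t.
  have djE : dott dj t = tnth t j.
    rewrite /dott (bigD1 j)//= /dj eqxx mul1r big1 ?addr0//.
    by move=> k /negPf ->; rewrite mul0r.
  have d0 k (v : k.-tuple R) : dott (fun=> 0) v = 0.
    by rewrite /dott big1// => i _; rewrite mul0r.
  rewrite (_ : (fun u => _) = fun u => dott c s * tnth t j * gexp a (fun=> 0) s *
      gexp a (fun j => - b * wdot s j) t * quad_gexp (a + b) (fun=> 0) 1 (fun=> 0) 1 (fun=> 0) u).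
    rewrite RintZl; last exact: iq.
    rewrite Rint_quad_gexp// !sdot0 !mul0r !addr0 !mul1r expR0 mulr1.
    by rewrite /quad_gexp djE d0 /K; ring.
  apply/funext => u; rewrite phi_cat dott_left_coef dott_mid_coef.
  rewrite tnth_rshift tnth_lshift /quad_gexp !d0; ring.
have E2 s : Defs.Rint (fun t => dott c s * gexp a (fun=> 0) s * K *
    quad_gexp a (fun j => - b * wdot s j) 0 dj 1 (fun=> 0) t) =
    K * gZ a ^+ m * (- b / a) *
    quad_gexp ((a ^+ 2 - b ^+ 2) / a) (fun=> 0) 0 c 0 (fun i => W i j) s.
  rewrite RintZl; last exact: iq.
  rewrite Rint_quad_gexp// sdot_wdot.
  rewrite /quad_gexp -gexp_coupling//.
  have -> : sdot dj (fun j => - b * wdot s j) = - b * dott (fun i => W i j) s.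
    rewrite /sdot (bigD1 j)//= /dj eqxx mul1r big1 ?addr0; last first.
      by move=> k /negPf ->; rewrite mul0r.
    by congr (_ * _); apply: eq_bigr => i _; rewrite mulrC.
  rewrite (_ : sdot dj (fun=> 0) = 0); last first.
    by rewrite /sdot big1// => i _; rewrite mulr0.
  rewrite sdot0; ring.
rewrite Rint_cat; [|exact: mphi|exact: gauss_dom_moment_phi].
transitivity (Defs.Rint (fun s => K * gZ a ^+ m * (- b / a) *
    quad_gexp ((a ^+ 2 - b ^+ 2) / a) (fun=> 0) 0 c 0 (fun i => W i j) s)).
  congr Defs.Rint; apply/funext => s; rewrite -E2 Rint_cat.
  - by congr Defs.Rint; apply/funext => t; rewrite -E1.
  - exact: (measurable_cat_section s (mphi (left_coef c) (mid_coef j))).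
  - exact: (gauss_dom_cat_section s
      (gauss_dom_moment_phi (left_coef c) (mid_coef j) ab)).
rewrite RintZl; last exact: iq.
rewrite Rint_quad_gexp// !(sdot0, mul0r, expR0, add0r, mulr1) /Zr exprMn -/K.
rewrite (_ : sdot c (fun=> 0) = 0); last first.
  by rewrite /sdot big1// => i _; rewrite mulr0.
have ab2 : 0 < a ^+ 2 - b ^+ 2 by move: g0; rewrite pmulr_lgt0 ?invr_gt0.
by field; rewrite !gt_eqF.
Qed.

End reflection_gaussian.

Section covariance.
Variables (R : realType) (m r : nat) (W : 'M[R]_m).
Hypothesis HW : orthogonal_mx W.
Local Notation n := (m + (m + r))%N.

Definition cov (a b e : R) : 'M[R]_(n + n) := block_mx (reflin r W a b) 0 0 e%:M.

Lemma sqr_gZ (a : R) : 0 < a -> gZ a ^+ 2 = 2 * pi / a.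
Proof.
by move=> a0; rewrite sqr_sqrtr// divr_ge0 ?ltW// mulr_gt0 ?pi_gt0.
Qed.

Lemma Zr_gt0 (a b : R) : `|b| < a -> 0 < Zr m r a b.
Proof.
move=> ab; have a0 : 0 < a by exact: le_lt_trans ab.
rewrite mulr_gt0 ?exprn_gt0 ?mulr_gt0 ?gZ_gt0 ?coupling_gt0//.
exact: addr_gt0_norm.
Qed.

Lemma subr_sqr_gt0 (a b : R) : `|b| < a -> 0 < a ^+ 2 - b ^+ 2.
Proof.
move=> ab; have a0 : 0 < a by exact: le_lt_trans ab.
by have := coupling_gt0 ab; rewrite pmulr_lgt0 ?invr_gt0.
Qed.

Lemma sqr_Zr (a b : R) : `|b| < a -> Zr m r a b ^+ 2 =
  ((2 * pi) ^+ 2 / (a ^+ 2 - b ^+ 2)) ^+ m * (2 * pi / (a + b)) ^+ r.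
Proof.
move=> ab; have a0 : 0 < a by exact: le_lt_trans ab.
have ab2 := subr_sqr_gt0 ab.
rewrite exprMn -!exprM ![(_ * 2)%N]mulnC !exprM.
rewrite [(gZ (a + b)) ^+ 2]sqr_gZ; last exact: addr_gt0_norm.
rewrite [(gZ a * _) ^+ 2]exprMn !sqr_gZ ?coupling_gt0//; congr (_ ^+ m * _).
by field; rewrite !gt_eqF.
Qed.

Definition inv1 (a b : R) := a / (a ^+ 2 - b ^+ 2).
Definition inv2 (a b : R) := - b / (a ^+ 2 - b ^+ 2).

Lemma inv_lt (a b : R) : `|b| < a -> `|inv2 a b| < inv1 a b.
Proof.
move=> ab; have ab2 := subr_sqr_gt0 ab.
rewrite /inv2 /inv1 normrM normrN [`|_^-1|]gtr0_norm ?invr_gt0//.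
by rewrite ltr_pM2r ?invr_gt0.
Qed.

(** Both sides are nonnegative products of square roots, so their squares are compared. *)
Lemma pdf_normalizer (a b e : R) : `|b| < a -> 0 < e ->
  (2 * pi) ^+ n * Num.sqrt (\det (cov a b e)) =
  Zr m r (inv1 a b) (inv2 a b) * gZ e^-1 ^+ n.
Proof.
move=> ab e0; have a0 : 0 < a by exact: le_lt_trans ab.
have ab2 := subr_sqr_gt0 ab; have abD := addr_gt0_norm ab.
rewrite /cov det_ublock det_reflin// det_scalar.
set D := _ * _ * _; have D0 : 0 < D by rewrite !mulr_gt0 ?exprn_gt0.
have Z0 := Zr_gt0 (inv_lt ab).
apply/eqP; rewrite -(@eqrXn2 _ 2)//; first last.
- by rewrite mulr_ge0 ?exprn_ge0 ?ltW ?gZ_gt0 ?invr_gt0.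
- by rewrite mulr_ge0 ?exprn_ge0 ?sqrtr_ge0// mulr_ge0 ?pi_ge0.
rewrite exprMn sqr_sqrtr ?(ltW D0)// [eqbRHS]exprMn sqr_Zr ?inv_lt//.
rewrite -[in eqbRHS]exprM [(_ * 2)%N in eqbRHS]mulnC exprM sqr_gZ ?invr_gt0//.
rewrite -exprM /D.
have -> : inv1 a b ^+ 2 - inv2 a b ^+ 2 = (a ^+ 2 - b ^+ 2)^-1.
  by rewrite /inv1 /inv2; field; rewrite gt_eqF.
have -> : inv1 a b + inv2 a b = (a + b)^-1.
  rewrite /inv1 /inv2; field; rewrite !gt_eqF//=.
rewrite !invrK; set P := 2 * pi; set d := a ^+ 2 - b ^+ 2; set f := a + b.
rewrite [(P ^+ 2 * d) ^+ m]exprMn [(P * f) ^+ r]exprMn [(P * e) ^+ n]exprMn.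
rewrite (_ : P ^+ (n * 2) = (P ^+ 2) ^+ m * P ^+ r * P ^+ n); last first.
  by rewrite -exprM -!exprD; congr (_ ^+ _); lia.
move: ((P ^+ 2) ^+ m) (P ^+ r) (P ^+ n) (d ^+ m) (f ^+ r) (e ^+ n) => *.
by apply/eqP; ring.
Qed.

Lemma gauss_pdf_cov (a b e : R) (x p : n.-tuple R) : `|b| < a -> 0 < e ->
  gauss_pdf (cov a b e) (cat_tuple x p) =
  (Zr m r (inv1 a b) (inv2 a b) * gZ e^-1 ^+ n)^-1 *
  phi W (inv1 a b) (inv2 a b) x * gexp e^-1 (fun=> 0) p.
Proof.
move=> ab e0; have a0 : 0 < a by exact: le_lt_trans ab.
have ab2 := subr_sqr_gt0 ab; have abD := addr_gt0_norm ab.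
rewrite /gauss_pdf pdf_normalizer// mulrC -mulrA; congr (_ * _).
rewrite /phi /gexp -expRD; congr expR.
have ne0 : e != 0 by rewrite gt_eqF.
have U1 : reflin r W a b \in unitmx.
  by rewrite unitmxE unitfE det_reflin// mulf_neq0 ?expf_neq0 ?gt_eqF.
have U2 : (e%:M : 'M[R]_n) \in unitmx.
  by rewrite unitmxE unitfE det_scalar expf_neq0.
rewrite /cov invmx_block_diag; last by rewrite block_diag_mx_unit U1.
rewrite reflin_inv//; last by rewrite -subr_eq0 gt_eqF.
rewrite invmx_scalar tcol_cat tr_col_mx mul_row_block !mulmx0 addr0 add0r.
rewrite mul_row_col mxE quad_reflin mul_mx_scalar -scalemxAl [X in _ + X]mxE sqnE mxE mulr1n.
rewrite -sqt_tcol (_ : dott _ _ = 0); last by rewrite /dott big1// => i _; rewrite mul0r.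
by rewrite /inv1 /inv2; ring.
Qed.

End covariance.

(** * Changes of variables on tuples *)

Section tuple_change_of_variables.
Variable R : realType.
Local Notation leb := (@lebesgue_measure R).

Definition afft k (l : R) (c x : k.-tuple R) : k.-tuple R :=
  [tuple l * tnth x i + tnth c i | i < k].
Definition addt k (x y : k.-tuple R) : k.-tuple R :=
  [tuple tnth x i + tnth y i | i < k].
Definition subt k (x y : k.-tuple R) : k.-tuple R :=
  [tuple tnth x i - tnth y i | i < k].

Lemma measurable_tuple_fun d (T : measurableType d) k (f : 'I_k -> T -> R) :
  (forall i, measurable_fun setT (f i)) ->
  measurable_fun setT (fun x => [tuple f i x | i < k]).
Proof.
move=> mf; apply/measurable_fun_tnthP => i.
by rewrite (_ : _ \o _ = f i)//; apply/funext => x /=; rewrite tnth_mktuple.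
Qed.

Lemma measurable_afft k l c : measurable_fun setT (@afft k l c).
Proof.
apply: measurable_tuple_fun => i; apply: measurable_funD => //.
by apply: measurable_funM => //; exact: measurable_tnth.
Qed.

Lemma measurable_addt k : measurable_fun setT
  (fun p : k.-tuple R * k.-tuple R => addt p.1 p.2).
Proof.
apply: measurable_tuple_fun => i; apply: measurable_funD => //.
  by apply: (measurableT_comp (measurable_tnth i)).
by apply: (measurableT_comp (measurable_tnth i)).
Qed.

Lemma measurable_subt k : measurable_fun setT
  (fun p : k.-tuple R * k.-tuple R => subt p.1 p.2).
Proof.
apply: measurable_tuple_fun => i; apply: measurable_funB => //.
  by apply: (measurableT_comp (measurable_tnth i)).
by apply: (measurableT_comp (measurable_tnth i)).
Qed.

Lemma afft_cons k l (c : k.+1.-tuple R) x t :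
  afft l c (cons_tuple x t) =
  cons_tuple (l * x + tnth c ord0) (afft l [tuple of behead c] t).
Proof.
apply: eq_from_tnth => i; rewrite tnth_mktuple.
case: (unliftP ord0 i) => [j|] -> //.
rewrite !tnth_consS tnth_mktuple; congr (_ + _).
by rewrite [in LHS](tuple_eta c) tnthS.
Qed.

Lemma iint_afft k l c (f : k.-tuple R -> \bar R) : 0 < l ->
  measurable_fun setT f -> (forall t, 0 <= f t)%E ->
  iint f = ((l ^+ k)%:E * iint (fun t => f (afft l c t)))%E.
Proof.
move=> l0; elim: k c f => [|k IH] c f mf f0.
  by rewrite /= expr0 mul1e [afft _ _ _]tuple0.
pose c' := [tuple of behead c].
have mG : measurable_fun setT
    (fun p : R * k.-tuple R => f (cons_tuple p.1 (afft l c' p.2))).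
  apply: (measurableT_comp mf); apply: measurable_cons => //.
  by apply: (measurableT_comp (measurable_afft l c')).
have mF : measurable_fun setT (fun p : R * k.-tuple R => f (cons_tuple p.1 p.2)).
  by apply: (measurableT_comp mf); exact: measurable_cons.
have m1 : measurable_fun setT (fun x : R => iint (fun t => f (cons_tuple x (afft l c' t)))).
  by apply: (@measurable_iint _ _ _ _ (fun x t => f (cons_tuple x (afft l c' t)))).
have -> : iint f = (\int[leb]_x ((l ^+ k)%:E *
    iint (fun t => f (cons_tuple x (afft l c' t)))))%E.
  rewrite /=; apply: eq_integral => x _; rewrite (IH c')//.
  exact: (measurableT_comp mF (measurable_pair1 x)).
rewrite ge0_integralZl//; last by rewrite lee_fin exprn_ge0// ltW.
  rewrite (@ge0_integral_affine R l (tnth c ord0) (fun x : R =>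
    iint (fun t => f (cons_tuple x (afft l c' t)))))//.
    rewrite muleA -EFinM -exprSr; congr (_ * _)%E.
    rewrite /=; apply: eq_integral => x _; congr iint; apply/funext => t.
    by rewrite afft_cons.
  by move=> x; exact: iint_ge0.
by move=> x _; exact: iint_ge0.
Qed.

Lemma iint_swap j k (F : j.-tuple R -> k.-tuple R -> \bar R) :
  measurable_fun setT (fun p : j.-tuple R * k.-tuple R => F p.1 p.2) ->
  (forall x y, 0 <= F x y)%E ->
  iint (fun x => iint (F x)) = iint (fun y => iint (fun x => F x y)).
Proof.
move=> mF F0.
have mF' : measurable_fun setT (fun p : k.-tuple R * j.-tuple R => F p.2 p.1).
  have ms : measurable_fun setT (fun p : k.-tuple R * j.-tuple R => (p.2, p.1)).
    exact: (measurable_fun_pair measurable_snd measurable_fst).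
  exact: (measurableT_comp mF ms).
rewrite iintE; [|exact: (measurable_iint mF)|by move=> x; exact: iint_ge0].
rewrite iintE; [|exact: (measurable_iint mF')|by move=> x; exact: iint_ge0].
transitivity (\int[tmeas R j]_x \int[tmeas R k]_y F x y)%E.
  apply: eq_integral => x _; rewrite iintE//.
  exact: (measurableT_comp mF (measurable_pair1 x)).
rewrite (fubini_tonelli (fun p => F p.1 p.2))//=.
apply: eq_integral => y _; rewrite iintE//.
exact: (measurableT_comp mF (measurable_pair2 y)).
Qed.

(** For fixed x the shift z = x + y turns x - y into 2 x - z. After exchanging the integrals,
    scaling x by 2 yields the Jacobian. *)
Lemma iint_addt_subt k (F : k.-tuple R -> k.-tuple R -> \bar R) :
  measurable_fun setT (fun p : k.-tuple R * k.-tuple R => F p.1 p.2) ->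
  (forall x y, 0 <= F x y)%E ->
  iint (fun x => iint (fun y => F (addt x y) (subt x y))) =
  ((2 ^- k)%:E * iint (fun z => iint (F z)))%E.
Proof.
move=> mF F0.
pose neg (x : k.-tuple R) : k.-tuple R := [tuple - tnth x i | i < k].
have mneg : measurable_fun setT neg.
  apply: measurable_tuple_fun => i; apply: measurableT_comp => //.
  exact: measurable_tnth.
have mas : measurable_fun setT
    (fun p : k.-tuple R * k.-tuple R => F (addt p.1 p.2) (subt p.1 p.2)).
  exact: (measurableT_comp mF
    (measurable_fun_pair (measurable_addt (k := k)) (measurable_subt (k := k)))).
have mH : measurable_fun setT
    (fun p : k.-tuple R * k.-tuple R => F p.2 (afft 2 (neg p.2) p.1)).
  suff ma : measurable_fun setT
      (fun p : k.-tuple R * k.-tuple R => afft 2 (neg p.2) p.1).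
    exact: (measurableT_comp mF (measurable_fun_pair measurable_snd ma)).
  apply: measurable_tuple_fun => i; apply: measurable_funD.
    apply: measurable_funM => //.
    by apply: (measurableT_comp (measurable_tnth i)).
  apply: (measurableT_comp (measurable_tnth i)).
  by apply: (measurableT_comp mneg).
have -> : iint (fun x => iint (fun y => F (addt x y) (subt x y))) =
    iint (fun x => iint (fun z => F z (afft 2 (neg z) x))).
  congr iint; apply/funext => x.
  rewrite (@iint_afft k 1 (neg x))//; last first.
    exact: (measurableT_comp mas (measurable_pair1 x)).
  rewrite expr1n mul1e; congr iint; apply/funext => z.
  congr (F _ _); apply: eq_from_tnth => i; rewrite !tnth_mktuple; ring.
rewrite iint_swap// -iintZ//; first last.
- by move=> z; exact: iint_ge0.
- exact: (measurable_iint mF).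
congr iint; apply/funext => z.
rewrite [in RHS](@iint_afft k 2 (neg z))//; last first.
  exact: (measurableT_comp mF (measurable_pair1 z)).
by rewrite muleA -EFinM mulVf ?mul1e// expf_neq0.
Qed.

(** Infinite values are covered, since [fine] sends +oo to 0 on both sides. *)
Lemma fine_mulr (k : R) (x : \bar R) : 0 < k -> (0 <= x)%E ->
  fine (k%:E * x)%E = k * fine x.
Proof.
by move=> k0; case: x => [x||]//= _; rewrite gt0_muley ?lte_fin//= mulr0.
Qed.

Lemma Rint2_addt_subt k (F : k.-tuple R -> k.-tuple R -> R) :
  measurable_fun setT (fun p : k.-tuple R * k.-tuple R => F p.1 p.2) ->
  Rint2 (fun x y => F (addt x y) (subt x y)) = 2 ^- k * Rint2 F.
Proof.
move=> mF; rewrite /Rint2.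
have H (G : k.-tuple R -> k.-tuple R -> R) :
    measurable_fun setT (fun p : k.-tuple R * k.-tuple R => G p.1 p.2) ->
    fine (iint (fun x => iint (fun y => (Num.max (G (addt x y) (subt x y)) 0)%:E))) =
    2 ^- k * fine (iint (fun x => iint (fun y => (Num.max (G x y) 0)%:E))).
  move=> mG; have g0 s t : (0 <= (Num.max (G s t) 0)%:E)%E.
    by rewrite lee_fin le_max lexx orbT.
  rewrite (iint_addt_subt (F := fun x y => (Num.max (G x y) 0)%:E))//; last first.
    by apply/measurable_EFinP; exact: measurable_maxr.
  rewrite fine_mulr ?invr_gt0 ?exprn_gt0//.
  by apply: iint_ge0 => s; exact: iint_ge0.
rewrite H// (H (fun x y => - F x y)); last exact: measurableT_comp.
by rewrite mulrBr.
Qed.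

End tuple_change_of_variables.

(** * Matrix elements between one-photon states *)

Section kernel.
Variables (R : realType) (m r : nat) (W : 'M[R]_m).
Hypothesis HW : orthogonal_mx W.
Local Notation n := (m + (m + r))%N.

Lemma qrefl_scale (k : R) (x y : n.-tuple R) :
  (forall i, tnth y i = k * tnth x i) -> qrefl W y = k ^+ 2 * qrefl W x.
Proof.
move=> h; have -> : qrefl W y = ((k *: tcol x)^T *m refl r W *m (k *: tcol x)) 0 0.
  by congr ((_^T *m _ *m _) 0 0); apply/matrixP => i j; rewrite !mxE h.
have tZ (A : 'cV[R]_n) : (k *: A)^T = k *: A^T by exact: linearZ.
by rewrite tZ -!scalemxAl -scalemxAr scalerA mxE expr2.
Qed.

Lemma phi_scale (k a b : R) (x y : n.-tuple R) :
  (forall i, tnth y i = k * tnth x i) ->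
  phi W a b y = phi W (k ^+ 2 * a) (k ^+ 2 * b) x.
Proof.
move=> h; rewrite /phi (qrefl_scale h).
have -> : sqt y = k ^+ 2 * sqt x.
  by rewrite /sqt mulr_sumr; apply: eq_bigr => i _; rewrite h exprMn.
by congr expR; field.
Qed.

(** Without position-momentum correlation the p-integral is the Fourier transform of a Gaussian of
    variance e, hence a Gaussian of precision e in x - y. Taking the midpoint (x + y) / 2 divides
    the position precision by 4 in the variable x + y. *)
Lemma gauss_state_cov (a b e : R) (x y : n.-tuple R) : `|b| < a -> 0 < e ->
  gauss_state (cov r W a b e) x y =
  ((Zr m r (inv1 a b) (inv2 a b))^-1 *
     phi W (inv1 a b / 4) (inv2 a b / 4) (addt x y) *
     gexp e (fun=> 0) (subt x y), 0).
Proof.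
move=> ab e0; have ei0 : 0 < e^-1 by rewrite invr_gt0.
rewrite /gauss_state.
set mid := [tuple _ | i < n].
pose z (i : 'I_n) := tnth x i - tnth y i.
set K := (Zr m r (inv1 a b) (inv2 a b) * gZ e^-1 ^+ n)^-1 *
  phi W (inv1 a b) (inv2 a b) mid.
have ic th : (tmeas R n).-integrable setT (EFin \o cos_gexp e^-1 th z).
  by apply: integrable_gauss_dom; [exact: measurable_cos_gexp|exact: gauss_dom_cos_gexp].
have dE p : \sum_(i < n) tnth p i * (tnth x i - tnth y i) = dott z p.
  by apply: eq_bigr => i _; rewrite mulrC.
congr (_, _).
  rewrite (_ : (fun p => _) = fun p => K * cos_gexp e^-1 0 z p); last first.
    apply/funext => p; rewrite gauss_pdf_cov// dE /cos_gexp add0r /K; ring.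
  rewrite RintZl// Rint_cos_gexp// cos0 mul1r /K.
  rewrite (@phi_scale 2^-1 _ _ (addt x y)); last first.
    by move=> i; rewrite !tnth_mktuple mulrC.
  have gn0 : gZ e^-1 ^+ n != 0 by rewrite expf_neq0// gt_eqF ?gZ_gt0.
  rewrite (_ : expR _ = gexp e (fun=> 0) (subt x y)); last first.
    rewrite /gexp (_ : dott _ _ = 0); last by rewrite /dott big1// => i _; rewrite mul0r.
    rewrite addr0 (_ : sqt (subt x y) = sdot z z).
      by congr expR; field; rewrite gt_eqF.
    by apply: eq_bigr => i _; rewrite tnth_mktuple expr2.
  rewrite (_ : 2^-1 ^+ 2 * inv1 a b = inv1 a b / 4); last by field.
  rewrite (_ : 2^-1 ^+ 2 * inv2 a b = inv2 a b / 4); last by field.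
  have Z0 : Zr m r (inv1 a b) (inv2 a b) != 0.
    by apply: lt0r_neq0; apply: Zr_gt0; exact: inv_lt.
  by field; rewrite ?gn0 ?Z0.
(* The sine is a cosine with phase - pi / 2; the integral is proportional to the cosine of that
   phase, so the kernel is real. *)
rewrite (_ : (fun p => _) = fun p => K * cos_gexp e^-1 (- (pi / 2)) z p); last first.
  apply/funext => p; rewrite gauss_pdf_cov// dE /cos_gexp addrC cosBpihalf /K; ring.
by rewrite RintZl// Rint_cos_gexp// cosN cos_pihalf mul0r mulr0.
Qed.

Definition real_fun (f : n.-tuple R -> R) : n.-tuple R -> R * R := fun x => (f x, 0).

Lemma melt_real (f g : n.-tuple R -> R) (K : Defs.kernel R n) :
  (melt (real_fun f) K (real_fun g)).1 =
  Rint2 (fun x y => f x * (K x y).1 * g y).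
Proof.
rewrite /melt /=; congr Rint2; apply/funext => x; apply/funext => y.
by rewrite /= /real_fun /=; ring.
Qed.

Lemma ip_real (f g : n.-tuple R -> R) :
  ip (real_fun f) (real_fun g) = (Defs.Rint (fun x => f x * g x), 0).
Proof.
rewrite /ip; congr (_, _).
  by congr Defs.Rint; apply/funext => x; rewrite /real_fun /=; ring.
rewrite (_ : (fun x => _) = fun=> 0); last first.
  by apply/funext => x; rewrite /real_fun /=; ring.
by rewrite /Defs.Rint oppr0 subrr.
Qed.

(* First excited state, in the direction c, of the oscillator whose ground state has
   position variance 1/(4e). *)
Definition one_photon (e : R) (c : 'I_n -> R) (x : n.-tuple R) : R :=
  Num.sqrt (4 * e / gZ (4 * e) ^+ n) * dott c x * gexp (2 * e) (fun=> 0) x.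

Lemma gexp0E k a (x : k.-tuple R) : gexp a (fun=> 0) x = expR (- (a / 2 * sqt x)).
Proof.
by rewrite /gexp (_ : dott _ _ = 0) ?addr0// /dott big1// => i _; rewrite mul0r.
Qed.

Lemma Rint_one_photon (e : R) (c d : 'I_n -> R) : 0 < e ->
  Defs.Rint (fun x => one_photon e c x * one_photon e d x) = sdot c d.
Proof.
move=> e0; have e40 : 0 < 4 * e by rewrite mulr_gt0.
set k := 4 * e / gZ (4 * e) ^+ n.
have g0 : 0 < gZ (4 * e) ^+ n by rewrite exprn_gt0// gZ_gt0.
have k0 : 0 < k by rewrite divr_gt0.
have sdot0r c' : @sdot R n c' (fun=> 0) = 0.
  by rewrite /sdot big1// => i _; rewrite mulr0.
rewrite (_ : (fun x => _) = fun x => k * quad_gexp (4 * e) (fun=> 0) 0 c 0 d x).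
  rewrite RintZl; last first.
    by apply: integrable_gauss_dom; [exact: measurable_quad_gexp|exact: gauss_dom_quad_gexp].
  rewrite Rint_quad_gexp// !sdot0r !mul0r expR0 /k; field.
  by rewrite !gt_eqF.
apply/funext => x; rewrite /one_photon /quad_gexp !gexp0E !add0r -/k.
have hE : expR (- (4 * e / 2 * sqt x)) =
    expR (- (2 * e / 2 * sqt x)) * expR (- (2 * e / 2 * sqt x)).
  by rewrite -expRD; congr expR; field.
by rewrite hE -[k in RHS](sqr_sqrtr (ltW k0)); ring.
Qed.

Lemma measurable_one_photon e c : measurable_fun setT (one_photon e c).
Proof.
apply: measurable_funM; last exact: measurable_gexp.
by apply: measurable_funM => //; exact: measurable_dott.
Qed.

Lemma gauss_dom_one_photon e c : 0 < e -> gauss_dom (one_photon e c).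
Proof.
move=> e0; have e20 : 0 < 2 * e by rewrite mulr_gt0.
have [C [k [C0 k0 hC]]] := gauss_dom_quad_gexp (fun=> 0) 0 c
  (Num.sqrt (4 * e / gZ (4 * e) ^+ n)) (fun=> 0) e20.
exists C, k; split => // x; apply: le_trans (hC x).
rewrite /quad_gexp /one_photon add0r (_ : dott (fun=> 0) x = 0); last first.
  by rewrite /dott big1// => i _; rewrite mul0r.
by rewrite addr0 [in leRHS](mulrC (dott c x)).
Qed.

Lemma L2fun_one_photon e c : 0 < e -> L2fun (real_fun (one_photon e c)).
Proof.
move=> e0; split; first exact: measurable_one_photon.
split; first by [].
have mf : measurable_fun setT (fun x => (one_photon e c x * one_photon e c x)%:E).
  by apply/measurable_EFinP; apply: measurable_funM; exact: measurable_one_photon.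
have E x : cabs (real_fun (one_photon e c) x) ^+ 2 = one_photon e c x * one_photon e c x.
  by rewrite /cabs /real_fun /= expr0n /= addr0 sqr_sqrtr ?sqr_ge0// expr2.
under eq_fun do rewrite E.
have [C [k [C0 k0 hC]]] := gauss_dom_one_photon c e0.
apply: (@le_lt_trans _ _ (iint (fun x : n.-tuple R =>
  ((C ^+ 2)%:E * (expR (- ((k + k) * sqt x)))%:E)%E))).
  apply: le_iint => //.
  - by move=> x; rewrite lee_fin -expr2 sqr_ge0.
  - apply: emeasurable_funM => //; apply/measurable_EFinP.
    do 2 (apply: measurableT_comp => //); apply: measurable_funM => //.
    exact: measurable_sqt.
  - move=> x; rewrite -EFinM lee_fin mulrDl opprD expRD.
    have := hC x; set f := one_photon e c x; set E' := expR _ => h.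
    rewrite (_ : C ^+ 2 * (E' * E') = (C * E') * (C * E')); last by ring.
    by apply: le_trans (ler_norm (f * f)) _; rewrite (normrM f f) ler_pM.
rewrite iintZ ?lee_fin ?sqr_ge0//.
- rewrite iint_exp_sqt ?addr_gt0// -EFinM; exact: ltry.
- apply/measurable_EFinP.
  do 2 (apply: measurableT_comp => //); apply: measurable_funM => //.
  exact: measurable_sqt.
Qed.

End kernel.

Section matrix_elements.
Variables (R : realType) (m r : nat) (W : 'M[R]_m).
Hypothesis HW : orthogonal_mx W.
Local Notation n := (m + (m + r))%N.

(** The shape 1 + |u| is submultiplicative, |u + v| <= (1 + |u|) (1 + |v|), which separates the
    variables x + y and x - y in a domination bound. *)
Lemma one_add_dott_le_exp k (b : R) (c : 'I_k -> R) : 0 < b ->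
  exists2 C, 0 <= C & forall t, 1 + `|dott c t| <= C * expR (b * sqt t).
Proof.
move=> b0; have [C C0 hC] := affine_le_exp 0 c b0.
exists (1 + C); first by rewrite addr_ge0.
move=> t; rewrite mulrDl mul1r lerD//.
  by rewrite -[leLHS]expR0 ler_expR mulr_ge0 ?sqt_ge0// ltW.
by have := hC t; rewrite add0r.
Qed.

(* Obtained by integrating in the coordinates x + y and x - y: 2 ^- n is the Jacobian
   and the last but one factor the covariance of two coupled coordinates of x + y. *)
Definition kappa (a b e : R) : R :=
  2 ^- n * (4 * e / gZ (4 * e) ^+ n / (4 * Zr m r (inv1 a b) (inv2 a b)) *
  gZ (2 * e) ^+ n *
  (- (inv2 a b / 4) / ((inv1 a b / 4 + e) ^+ 2 - (inv2 a b / 4) ^+ 2)) *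
  Zr m r (inv1 a b / 4 + e) (inv2 a b / 4)).

(** The integrand of the matrix element in z = x + y and w = x - y. The two photon Gaussians
    contribute exp(- e (|z|^2 + |w|^2) / 2), which adds e to both precisions; x = (z + w) / 2 and y
    = (z - w) / 2 give the affine factors and the 4 in the denominator. *)
Let F (a b e : R) (c d : 'I_n -> R) (z w : n.-tuple R) : R :=
  4 * e / gZ (4 * e) ^+ n / (4 * Zr m r (inv1 a b) (inv2 a b)) *
  phi W (inv1 a b / 4 + e) (inv2 a b / 4) z *
  quad_gexp (2 * e) (fun=> 0) (dott c z) c (dott d z) (fun i => - d i) w.

Let measurable_F a b e c d :
  measurable_fun setT (fun p : n.-tuple R * n.-tuple R => F a b e c d p.1 p.2).
Proof.
have mfst k (f : k.-tuple R -> R) l : measurable_fun setT f ->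
    measurable_fun setT (fun p : k.-tuple R * l.-tuple R => f p.1).
  by move=> mf; apply: (measurableT_comp mf).
have msnd k (f : k.-tuple R -> R) l : measurable_fun setT f ->
    measurable_fun setT (fun p : l.-tuple R * k.-tuple R => f p.2).
  by move=> mf; apply: (measurableT_comp mf).
apply: measurable_funM.
  by apply: measurable_funM => //; apply: mfst; exact: measurable_phi.
apply: measurable_funM; last by apply: msnd; exact: measurable_gexp.
apply: measurable_funM; apply: measurable_funD;
  by [apply: mfst; exact: measurable_dott|apply: msnd; exact: measurable_dott].
Qed.

Let gauss_dom_F a b e c d : `|b| < a -> 0 < e -> pair_gauss_dom (F a b e c d).
Proof.
move=> ab e0; set A := inv1 a b / 4 + e; set B := inv2 a b / 4.
have AB : `|B| < A.
  have := inv_lt ab; rewrite /A /B [`|_ / 4|]normrM [`|(4^-1 : R)|]ger0_norm ?invr_ge0//.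
  move: (inv1 a b) `|inv2 a b| => u v; lra.
(* A decay rate available in both variables. In each of them the two affine factors use up nu / 4
   apiece, leaving nu / 2. *)
pose nu := Num.min ((A - `|B|) / 2) e.
have nu0 : 0 < nu by rewrite lt_min e0 andbT; lra.
have nu1 : nu <= (A - `|B|) / 2 by rewrite ge_min lexx.
have nu2 : nu <= e by rewrite ge_min lexx orbT.
have b0 : 0 < nu / 4 by rewrite divr_gt0.
have [C1 C10 hC1] := one_add_dott_le_exp c b0.
have [C2 C20 hC2] := one_add_dott_le_exp d b0.
set k := 4 * e / gZ (4 * e) ^+ n / (4 * Zr m r (inv1 a b) (inv2 a b)).
exists (`|k| * (C1 * C2) ^+ 2), (nu / 2); split; rewrite ?divr_gt0//.
  by rewrite mulr_ge0// sqr_ge0.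
have N (x f g1 g2 y : R) : `|x * f * (g1 * g2 * y)| = `|x| * (`|f| * (`|g1| * (`|g2| * `|y|))).
  by rewrite !normrM !mulrA.
move=> z w; rewrite /F -/A -/B -/k /quad_gexp N.
have dN : dott (fun i => - d i) w = - dott d w.
  by rewrite /dott -sumrN; apply: eq_bigr => i _; rewrite mulNr.
rewrite dN gexp0E.
have h1 : `|dott c z + dott c w| <= (C1 * expR (nu / 4 * sqt z)) * (C1 * expR (nu / 4 * sqt w)).
  apply: (@le_trans _ _ ((1 + `|dott c z|) * (1 + `|dott c w|))).
    rewrite (le_trans (ler_normD _ _))//.
    have := normr_ge0 (dott c z); have := normr_ge0 (dott c w); nra.
  by rewrite ler_pM ?addr_ge0.
have h2 : `|dott d z - dott d w| <= (C2 * expR (nu / 4 * sqt z)) * (C2 * expR (nu / 4 * sqt w)).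
  apply: (@le_trans _ _ ((1 + `|dott d z|) * (1 + `|dott d w|))).
    rewrite (le_trans (ler_normB _ _))//.
    have := normr_ge0 (dott d z); have := normr_ge0 (dott d w); nra.
  by rewrite ler_pM ?addr_ge0.
have h3 : `|phi W A B z| <= expR (- (nu * sqt z)).
  rewrite ger0_norm ?expR_ge0// (le_trans (gauss_dom_phi HW AB z))// ler_expR lerN2.
  by rewrite ler_wpM2r ?sqt_ge0.
have h4 : `|expR (- (2 * e / 2 * sqt w))| <= expR (- (nu * sqt w)).
  rewrite ger0_norm ?expR_ge0// ler_expR lerN2 ler_wpM2r ?sqt_ge0//; lra.
rewrite -[leRHS]mulrA -[leRHS]mulrA ler_wpM2l//.
apply: (@le_trans _ _ (expR (- (nu * sqt z)) *
  (((C1 * expR (nu / 4 * sqt z)) * (C1 * expR (nu / 4 * sqt w))) *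
  (((C2 * expR (nu / 4 * sqt z)) * (C2 * expR (nu / 4 * sqt w))) *
   expR (- (nu * sqt w)))))).
  apply: ler_pM; [by []| |exact: h3|].
    by do 2 apply: mulr_ge0 => //.
  apply: ler_pM; [by []| |exact: h1|].
    by apply: mulr_ge0.
  exact: ler_pM.
have E t : expR (- (nu / 2 * sqt t)) =
    expR (- (nu * sqt t)) * (expR (nu / 4 * sqt t) * expR (nu / 4 * sqt t)) :> R.
  by rewrite -!expRD; congr expR; field.
rewrite !E le_eqVlt; apply/orP; left; apply/eqP; ring.
Qed.

(** The two photons live in disjoint groups of modes, so the isotropic integral over x - y adds no
    covariance, and the matrix element comes from the coupling in x + y alone. *)
Let sdot_left_mid c j : sdot (@left_coef R m r c) (fun i => - @mid_coef R m r j i) = 0.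
Proof.
rewrite /sdot (bigD1 (rshift m (lshift r j)))//= big1 ?addr0.
  by rewrite /left_coef (unsplitK (inr _)) mul0r.
by move=> k /negPf h; rewrite /mid_coef h oppr0 mulr0.
Qed.

Lemma melt_gauss (a b e : R) c j : `|b| < a -> 0 < e ->
  (melt (real_fun (one_photon e (@left_coef R m r c))) (gauss_state (cov r W a b e))
     (real_fun (one_photon e (@mid_coef R m r j)))).1 =
  kappa a b e * sdot c (fun i => W i j).
Proof.
move=> ab e0; rewrite melt_real.
set c1 := @left_coef R m r c; set d1 := @mid_coef R m r j.
have k0 : 0 <= 4 * e / gZ (4 * e) ^+ n.
  by rewrite divr_ge0 ?mulr_ge0 ?exprn_ge0 ?(ltW e0)// ltW// gZ_gt0// mulr_gt0.
have Z0 : Zr m r (inv1 a b) (inv2 a b) != 0.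
  by apply: lt0r_neq0; apply: Zr_gt0; exact: inv_lt.
have AB : `|inv2 a b / 4| < inv1 a b / 4 + e.
  have := inv_lt ab; rewrite [`|_ / 4|]normrM [`|(4^-1 : R)|]ger0_norm ?invr_ge0//.
  move: (inv1 a b) `|inv2 a b| => u v; lra.
have e20 : 0 < 2 * e by rewrite mulr_gt0.
have -> : (fun x y => one_photon e c1 x * (gauss_state (cov r W a b e) x y).1 *
    one_photon e d1 y) = fun x y => F a b e c1 d1 (addt x y) (subt x y).
  apply/funext => x; apply/funext => y; rewrite gauss_state_cov//= /F /one_photon.
  set k := 4 * e / _.
  have dc (c' : 'I_n -> R) : dott c' (addt x y) = dott c' x + dott c' y.
    by rewrite /dott -big_split; apply: eq_bigr => i _; rewrite tnth_mktuple mulrDr.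
  have ds (c' : 'I_n -> R) : dott c' (subt x y) = dott c' x - dott c' y.
    by rewrite /dott -sumrB; apply: eq_bigr => i _; rewrite tnth_mktuple mulrBr.
  have dN : dott (fun i => - d1 i) (subt x y) = - (dott d1 x - dott d1 y).
    by rewrite -ds /dott -sumrN; apply: eq_bigr => i _; rewrite mulNr.
  have sE : sqt (addt x y) + sqt (subt x y) = 2 * (sqt x + sqt y).
    rewrite /sqt -!big_split mulr_sumr; apply: eq_bigr => i _ /=.
    by rewrite !tnth_mktuple; ring.
  have gE : phi W (inv1 a b / 4) (inv2 a b / 4) (addt x y) *
      gexp e (fun=> 0) (subt x y) * (gexp (2 * e) (fun=> 0) x * gexp (2 * e) (fun=> 0) y) =
      phi W (inv1 a b / 4 + e) (inv2 a b / 4) (addt x y) *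
      gexp (2 * e) (fun=> 0) (subt x y).
    rewrite !gexp0E /phi -!expRD; congr expR.
    have -> : sqt x = (sqt (addt x y) + sqt (subt x y)) / 2 - sqt y by rewrite sE; field.
    by field.
  rewrite /quad_gexp !dc ds dN.
  transitivity (Num.sqrt k ^+ 2 * dott c1 x * dott d1 y *
    (Zr m r (inv1 a b) (inv2 a b))^-1 * (phi W (inv1 a b / 4) (inv2 a b / 4) (addt x y) *
      gexp e (fun=> 0) (subt x y) * (gexp (2 * e) (fun=> 0) x * gexp (2 * e) (fun=> 0) y))).
    by ring.
  rewrite gE sqr_sqrtr//; field; exact: Z0.
rewrite Rint2_addt_subt; last exact: measurable_F.
rewrite Rint2E; [|exact: measurable_F|exact: gauss_dom_F].
pose k := 4 * e / gZ (4 * e) ^+ n / (4 * Zr m r (inv1 a b) (inv2 a b)).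
have -> : (fun z => Defs.Rint (F a b e c1 d1 z)) = fun z =>
    k * gZ (2 * e) ^+ n * (dott c1 z * dott d1 z * phi W (inv1 a b / 4 + e) (inv2 a b / 4) z).
  apply/funext => z; rewrite /F RintZl; last first.
    by apply: integrable_gauss_dom; [exact: measurable_quad_gexp|exact: gauss_dom_quad_gexp].
  have sdot0r c' : @sdot R n c' (fun=> 0) = 0.
    by rewrite /sdot big1// => i _; rewrite mulr0.
  rewrite Rint_quad_gexp// sdot_left_mid !sdot0r !mul0r !addr0 expR0 mulr1.
  by rewrite /k; ring.
rewrite RintZl; last first.
  apply: integrable_gauss_dom; last exact: gauss_dom_moment_phi.
  apply: measurable_funM; last exact: measurable_phi.
  by apply: measurable_funM; exact: measurable_dott.
rewrite Rint_phi_moment// /kappa -/k; ring.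
Qed.

End matrix_elements.

(** * A linear test controlled by the trace distance *)

Section trace_test.
Variables (R : realType) (m r : nat).
Local Notation n := (m + (m + r))%N.

Lemma Rint2_prod k (h : k.-tuple R -> k.-tuple R -> R) :
  (tmeas R k \x tmeas R k)%E.-integrable setT (EFin \o (fun p => h p.1 p.2)) ->
  Rint2 h = \int[(tmeas R k \x tmeas R k)%E]_p h p.1 p.2.
Proof.
move=> ih; have mH := measurable_int _ ih.
have H (g : k.-tuple R -> k.-tuple R -> R) :
    measurable_fun setT (fun p : k.-tuple R * k.-tuple R => g p.1 p.2) ->
    iint (fun x => iint (fun y => (Num.max (g x y) 0)%:E)) =
    (\int[tmeas R k \x tmeas R k]_p (Num.max (g p.1 p.2) 0)%:E)%E.
  move=> mg.
  have mg' : measurable_fun setT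
      (fun p : k.-tuple R * k.-tuple R => (Num.max (g p.1 p.2) 0)%:E).
    by apply/measurable_EFinP; exact: measurable_maxr.
  have g0 s t : (0 <= (Num.max (g s t) 0)%:E)%E by rewrite lee_fin le_max lexx orbT.
  rewrite iintE; [|exact: (measurable_iint mg')|by move=> s; exact: iint_ge0].
  rewrite fubini_tonelli1//; apply: eq_integral => s _; rewrite iintE//.
  exact: (measurableT_comp mg' (measurable_pair1 s)).
have mh : measurable_fun setT (fun p : k.-tuple R * k.-tuple R => h p.1 p.2).
  exact/measurable_EFinP.
rewrite /Rint2 H// (H (fun x y => - h x y)); last exact: measurableT_comp.
rewrite /Rintegral [in RHS]integralE [RHS]fineB; first last.
- exact: integrable_neg_fin_num.
- exact: integrable_pos_fin_num.
by congr (fine _ - fine _); apply: eq_integral => p _;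
  rewrite ?funeposE ?funenegE /= EFin_max.
Qed.

(** The kernel of an arbitrary density is only known to be square integrable, so |f K g| <= |K|^2 +
    f^2 g^2 is used. Integrability is what makes the matrix element additive in the kernel. *)
Lemma integrable_melt (K : Defs.kernel R n) (f g : n.-tuple R -> R) :
  measurable_fun setT (fun p : n.-tuple R * n.-tuple R => (K p.1 p.2).1) ->
  measurable_fun setT (fun p : n.-tuple R * n.-tuple R => (K p.1 p.2).2) ->
  (iint (fun x => iint (fun y => ((cabs (K x y)) ^+ 2)%:E)) < +oo)%E ->
  measurable_fun setT f -> gauss_dom f -> measurable_fun setT g -> gauss_dom g ->
  (tmeas R n \x tmeas R n)%E.-integrable setT
    (EFin \o (fun p => f p.1 * (K p.1 p.2).1 * g p.2)).
Proof.
move=> mK1 mK2 K2 mf df mg dg.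
have mf1 : measurable_fun setT (fun p : n.-tuple R * n.-tuple R => f p.1).
  by apply: (measurableT_comp mf).
have mg2 : measurable_fun setT (fun p : n.-tuple R * n.-tuple R => g p.2).
  by apply: (measurableT_comp mg).
pose c2 (p : n.-tuple R * n.-tuple R) := (K p.1 p.2).1 ^+ 2 + (K p.1 p.2).2 ^+ 2.
have cE x y : cabs (K x y) ^+ 2 = c2 (x, y).
  by rewrite /cabs sqr_sqrtr// addr_ge0 ?sqr_ge0.
have mc2 : measurable_fun setT c2.
  by apply: measurable_funD; apply: measurable_funX.
have c20 p : 0 <= c2 p by rewrite addr_ge0 ?sqr_ge0.
have ic : (tmeas R n \x tmeas R n)%E.-integrable setT (EFin \o c2).
  apply/integrable12ltyP; first exact/measurable_EFinP.
  move: K2; under eq_fun do under eq_fun do rewrite cE.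
  have mEc : measurable_fun setT (fun p : n.-tuple R * n.-tuple R => (c2 (p.1, p.2))%:E).
    apply/measurable_EFinP; apply: eq_measurable_fun mc2 => p _.
    by rewrite -surjective_pairing.
  have iE : iint (fun x => iint (fun y => (c2 (x, y))%:E)) =
      (\int[tmeas R n]_x \int[tmeas R n]_y (c2 (x, y))%:E)%E.
    rewrite iintE//.
    - apply: eq_integral => s _; rewrite iintE//.
        exact: (measurableT_comp mEc (measurable_pair1 s)).
      by move=> t; rewrite lee_fin.
    - apply: (measurable_iint (G := fun x y => (c2 (x, y))%:E) mEc) => x y.
      by rewrite lee_fin.
    - by move=> s; apply: iint_ge0 => t; rewrite lee_fin.
  rewrite iE => hlt; have -> : (\int[tmeas R n]_x \int[tmeas R n]_y
      `|(EFin \o c2) (x, y)| = \int[tmeas R n]_x \int[tmeas R n]_y (c2 (x, y))%:E)%E.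
    apply: eq_integral => s _; apply: eq_integral => t _.
    by rewrite gee0_abs// lee_fin.
  exact: hlt.
have ifg : (tmeas R n \x tmeas R n)%E.-integrable setT
    (EFin \o (fun p => f p.1 ^+ 2 * g p.2 ^+ 2)).
  apply: (integrable_pair_gauss_dom (h := fun x y => f x ^+ 2 * g y ^+ 2)).
    by apply: measurable_funM; apply: measurable_funX.
  have [C1 [a1 [C10 a10 h1]]] := df; have [C2 [a2 [C20 a20 h2]]] := dg.
  pose a := Num.min a1 a2.
  have a0 : 0 < a by rewrite lt_min a10.
  exists ((C1 * C2) ^+ 2), a; split => //; first exact: sqr_ge0.
  move=> s t.
  have k (C b x : R) u : 0 <= C -> a <= b -> `|x| <= C * expR (- (b * sqt u)) ->
      `|x ^+ 2| <= C ^+ 2 * expR (- (a * sqt (u : n.-tuple R))).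
    move=> C0 ab hx; rewrite normrX.
    apply: (@le_trans _ _ ((C * expR (- (b * sqt u))) ^+ 2)).
      by rewrite lerXn2r ?nnegrE ?mulr_ge0 ?expR_ge0.
    rewrite exprMn ler_wpM2l ?sqr_ge0// -expRM_natl ler_expR.
    have := sqt_ge0 u; nra.
  have k1 := k _ _ _ s C10 (_ : a <= a1) (h1 s).
  have k2 := k _ _ _ t C20 (_ : a <= a2) (h2 t).
  rewrite normrM; apply: (@le_trans _ _ ((C1 ^+ 2 * expR (- (a * sqt s))) *
    (C2 ^+ 2 * expR (- (a * sqt t))))).
    apply: ler_pM => //; [apply: k1|apply: k2]; by rewrite ge_min lexx ?orbT.
  by rewrite le_eqVlt; apply/orP; left; apply/eqP; ring.
have iD := integrableD measurableT ic ifg.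
apply: le_integrable iD => //.
  apply/measurable_EFinP; apply: measurable_funM => //.
  by apply: measurable_funM.
move=> p _; rewrite /= lee_fin [leRHS]ger0_norm; last first.
  by rewrite addr_ge0// mulr_ge0 ?sqr_ge0.
rewrite !normrM /c2 -[f p.1 ^+ 2](real_normK (num_real _)) -[g p.2 ^+ 2](real_normK (num_real _)).
rewrite -[(K p.1 p.2).1 ^+ 2](real_normK (num_real _)).
have := sqr_ge0 (K p.1 p.2).2.
move: (_ ^+ 2) => u; move: `|f _| `|g _| `|(K _ _).1| => x y z u0.
have h1 := sqr_ge0 (x * y - z); have h2 := sqr_ge0 (x * y); have h3 := sqr_ge0 z.
have e1 : (x * y - z) ^+ 2 = x ^+ 2 * y ^+ 2 - 2 * (x * z * y) + z ^+ 2 by ring.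
have e2 : (x * y) ^+ 2 = x ^+ 2 * y ^+ 2 by ring.
by rewrite e1 in h1; rewrite e2 in h2; lra.
Qed.

Lemma Rint2_sub k (f g : k.-tuple R -> k.-tuple R -> R) :
  (tmeas R k \x tmeas R k)%E.-integrable setT (EFin \o (fun p => f p.1 p.2)) ->
  (tmeas R k \x tmeas R k)%E.-integrable setT (EFin \o (fun p => g p.1 p.2)) ->
  Rint2 (fun x y => f x y - g x y) = Rint2 f - Rint2 g.
Proof.
move=> fi gi; rewrite !Rint2_prod//; first by rewrite RintegralB.
exact: (integrableB measurableT fi gi).
Qed.

Section test.
Variables (W : 'M[R]_m).
Hypothesis HW : orthogonal_mx W.

Lemma integrable_gauss_state_melt (a b e : R) (f g : n.-tuple R -> R) :
  `|b| < a -> 0 < e ->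
  measurable_fun setT f -> gauss_dom f -> measurable_fun setT g -> gauss_dom g ->
  (tmeas R n \x tmeas R n)%E.-integrable setT
    (EFin \o (fun p => f p.1 * (gauss_state (cov r W a b e) p.1 p.2).1 * g p.2)).
Proof.
move=> ab e0 mf [C1 [a1 [C10 a10 h1]]] mg [C2 [a2 [C20 a20 h2]]].
set Z := (Zr m r (inv1 a b) (inv2 a b))^-1.
have AB : `|inv2 a b / 4| < inv1 a b / 4.
  have := inv_lt ab; rewrite [`|_ / 4|]normrM [`|(4^-1 : R)|]ger0_norm ?invr_ge0//.
  move: (inv1 a b) `|inv2 a b| => u v; lra.
have E x y : (gauss_state (cov r W a b e) x y).1 = Z *
    phi W (inv1 a b / 4) (inv2 a b / 4) (addt x y) * gexp e (fun=> 0) (subt x y).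
  by rewrite gauss_state_cov.
apply: (integrable_pair_gauss_dom (h := fun x y =>
  f x * (gauss_state (cov r W a b e) x y).1 * g y)).
  under eq_fun do rewrite E.
  apply: measurable_funM; last by apply: (measurableT_comp mg).
  apply: measurable_funM; first by apply: (measurableT_comp mf).
  apply: measurable_funM.
    apply: measurable_funM => //.
    exact: (measurableT_comp (@measurable_phi R m r W _ _) (measurable_addt (k := n))).
  exact: (measurableT_comp (@measurable_gexp R n e (fun=> 0)) (measurable_subt (k := n))).
pose q := Num.min a1 a2.
have q0 : 0 < q by rewrite lt_min a10.
exists (C1 * `|Z| * C2), q; split => //; first by rewrite !mulr_ge0.
move=> s t; rewrite E.
have h1' : `|f s| <= C1 * expR (- (q * sqt s)).
  apply: le_trans (h1 s) _; rewrite ler_wpM2l// ler_expR lerN2 ler_wpM2r ?sqt_ge0//.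
  by rewrite ge_min lexx.
have h2' : `|g t| <= C2 * expR (- (q * sqt t)).
  apply: le_trans (h2 t) _; rewrite ler_wpM2l// ler_expR lerN2 ler_wpM2r ?sqt_ge0//.
  by rewrite ge_min lexx orbT.
have p1 : `|phi W (inv1 a b / 4) (inv2 a b / 4) (addt s t)| <= 1.
  rewrite ger0_norm ?expR_ge0// (le_trans (gauss_dom_phi HW AB _))//.
  rewrite -[leRHS]expR0 ler_expR oppr_le0 mulr_ge0 ?sqt_ge0//; lra.
have g1 : `|gexp e (fun=> 0) (subt s t)| <= 1.
  rewrite gexp0E ger0_norm ?expR_ge0// -[leRHS]expR0 ler_expR oppr_le0.
  by rewrite mulr_ge0 ?sqt_ge0// divr_ge0// ltW.
rewrite [`|_ * g t|]normrM [`|f s * _|]normrM.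
rewrite [leRHS](_ : _ = (C1 * expR (- (q * sqt s))) * (`|Z| * 1 * 1) *
  (C2 * expR (- (q * sqt t)))); last by ring.
apply: ler_pM; [by apply: mulr_ge0|by []| |exact: h2'].
apply: ler_pM; [by []|by []|exact: h1'|].
rewrite [`|Z * _ * _|]normrM [`|Z * _|]normrM.
by apply: ler_pM; [apply: mulr_ge0|by []|apply: ler_pM|].
Qed.

(** Rotating only the left photons by the columns of V makes the sum of the m matrix elements
    proportional to tr(V^T W). *)
Definition test_left (e : R) (V : 'M[R]_m) (j : 'I_m) : n.-tuple R -> R * R :=
  real_fun (one_photon e (@left_coef R m r (fun i => V i j))).
Definition test_right (e : R) (j : 'I_m) : n.-tuple R -> R * R :=
  real_fun (one_photon e (@mid_coef R m r j)).

Lemma orthonormal_test_left e V : 0 < e -> orthogonal_mx V ->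
  Defs.orthonormal (test_left e V).
Proof.
move=> e0 HV; split=> [i|i j]; first exact: L2fun_one_photon.
rewrite /test_left ip_real Rint_one_photon//; congr (_, _).
rewrite /sdot big_split_ord /= [X in _ + X]big1 ?addr0; last first.
  by move=> k _; rewrite /left_coef (unsplitK (inr k)) mul0r.
have /matrixP/(_ i j) := HV; rewrite !mxE => h.
transitivity (\sum_k V^T i k * V k j).
  by apply: eq_bigr => k _; rewrite /left_coef (unsplitK (inl k)) mxE.
by rewrite h; case: (i == j).
Qed.

Lemma orthonormal_test_right e : 0 < e -> Defs.orthonormal (test_right e).
Proof.
move=> e0; split=> [i|i j]; first exact: L2fun_one_photon.
rewrite /test_right ip_real Rint_one_photon//; congr (_, _).
rewrite /sdot (bigD1 (rshift m (lshift r i)))//= big1 ?addr0; last first.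
  by move=> k /negPf h; rewrite /mid_coef h mul0r.
rewrite /mid_coef eqxx mul1r (inj_eq (@rshift_inj _ _)) (inj_eq (@lshift_inj _ _)).
by case: (i == j).
Qed.

Definition test_value (K : Defs.kernel R n) (e : R) (V : 'M[R]_m) : R :=
  \sum_(j < m) (melt (test_left e V j) K (test_right e j)).1.

Lemma test_value_gauss a b e V : `|b| < a -> 0 < e ->
  test_value (gauss_state (cov r W a b e)) e V = kappa m r a b e * \tr (V^T *m W).
Proof.
move=> ab e0; rewrite /test_value /mxtrace mulr_sumr; apply: eq_bigr => j _.
rewrite melt_gauss//; congr (_ * _); rewrite /sdot mxE.
by apply: eq_bigr => i _; rewrite mxE.
Qed.

(** The supremum defining [trnorm] includes the two test systems, so it bounds the sum of the moduli
    of the matrix elements of the difference, and hence of their real parts. The factor 2 undoes the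
    one half in [Dtr]. *)
Lemma test_value_close (K : Defs.kernel R n) a b e V (eps : R) :
  `|b| < a -> 0 < e -> orthogonal_mx V -> is_density K ->
  (Dtr K (gauss_state (cov r W a b e)) <= eps%:E)%E ->
  `|test_value K e V - kappa m r a b e * \tr (V^T *m W)| <= 2 * eps.
Proof.
move=> ab e0 HV [mK1 [mK2 [K2 _]]] hD.
rewrite -test_value_gauss//; set rho := gauss_state _ in hD *.
pose D : Defs.kernel R n := fun x y =>
  ((K x y).1 - (rho x y).1, (K x y).2 - (rho x y).2).
have htr : (trnorm D <= (2 * eps)%:E)%E.
  by move: hD; rewrite /Dtr -/D muleC lee_pdivrMr// -EFinM [eps * 2]mulrC.
have hsup : ((\sum_(j < m) cabs (melt (test_left e V j) D (test_right e j)))%:E <=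
    (2 * eps)%:E)%E.
  apply: le_trans htr; apply: ereal_sup_ubound.
  exists m, (test_right e), (test_left e V); split; first exact: orthonormal_test_right.
  by split; first exact: orthonormal_test_left.
rewrite lee_fin in hsup; apply: le_trans hsup.
rewrite /test_value -sumrB; apply: le_trans (ler_norm_sum _ _ _) _.
apply: ler_sum => j _.
have dl : gauss_dom (one_photon e (@left_coef R m r (fun i => V i j))).
  exact: gauss_dom_one_photon.
have dr : gauss_dom (one_photon e (@mid_coef R m r j)).
  exact: gauss_dom_one_photon.
have ml := measurable_one_photon e (@left_coef R m r (fun i => V i j)).
have mr := measurable_one_photon e (@mid_coef R m r j).
have -> : (melt (test_left e V j) K (test_right e j)).1 -
    (melt (test_left e V j) rho (test_right e j)).1 =
    (melt (test_left e V j) D (test_right e j)).1.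
  rewrite !melt_real -Rint2_sub.
  - by congr Rint2; apply/funext => x; apply/funext => y; rewrite /D /=; ring.
  - exact: integrable_melt.
  - exact: integrable_gauss_state_melt.
by rewrite /cabs -sqrtr_sqr ler_wsqrtr// lerDl sqr_ge0.
Qed.

End test.

End trace_test.

(** * Many measurement outcomes *)

Section weighted_product_integral.
Variables (R : realType) (k : nat).
Local Notation T := (k.-tuple R).

(** [het_int] with a general weight, which will be an outcome density, the reference density or the
    unnormalised p^2 / q. *)
Fixpoint hint (w : T -> R) (N : nat) : (N.-tuple T -> \bar R) -> \bar R :=
  match N as N0 return (N0.-tuple T -> \bar R) -> \bar R with
  | 0 => fun F => F [tuple]
  | N'.+1 => fun F =>
      iint (fun xi => ((w xi)%:E * hint w (fun rest => F (cons_tuple xi rest)))%E)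
  end.

Lemma hint_ge0 (w : T -> R) N (F : N.-tuple T -> \bar R) : (forall x, 0 <= w x) ->
  (forall d, 0 <= F d)%E -> (0 <= hint w F)%E.
Proof.
move=> w0; elim: N F => [|N IH] F F0 //=.
by apply: iint_ge0 => x; rewrite mule_ge0 ?lee_fin ?w0// IH.
Qed.

Lemma measurable_hint d (X : measurableType d) (w : T -> R) N (H : X -> N.-tuple T -> \bar R) :
  measurable_fun setT w -> (forall x, 0 <= w x) ->
  measurable_fun setT (fun p : X * N.-tuple T => H p.1 p.2) ->
  (forall x t, 0 <= H x t)%E ->
  measurable_fun setT (fun x => hint w (H x)).
Proof.
move=> mw w0; elim: N d X H => [|N IH] d X H mH H0 /=.
  exact: (measurableT_comp mH (measurable_pair2 [tuple])).
apply: (measurable_iint (G := fun x xi =>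
  ((w xi)%:E * hint w (fun rest => H x (cons_tuple xi rest)))%E)); last first.
  by move=> x t; rewrite mule_ge0 ?lee_fin ?w0// hint_ge0.
apply: emeasurable_funM.
  by apply/measurable_EFinP; apply: (measurableT_comp mw).
apply: (IH _ (X * T)%type (fun p rest => H p.1 (cons_tuple p.2 rest))) => //.
have m1 : measurable_fun setT (fun p : (X * T) * N.-tuple T =>
    cons_tuple p.1.2 p.2 : N.+1.-tuple T).
  by apply: measurable_cons => //; apply: measurableT_comp.
have m2 : measurable_fun setT (fun p : (X * T) * N.-tuple T => p.1.1).
  by apply: measurableT_comp.
exact: (measurableT_comp mH (measurable_fun_pair m2 m1)).
Qed.

Section weight.
Variables (w : T -> R).
Hypotheses (mw : measurable_fun setT w) (w0 : forall x, 0 <= w x).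

Let sec N (F : N.+1.-tuple T -> \bar R) : measurable_fun setT F ->
  measurable_fun setT (fun p : T * N.-tuple T => F (cons_tuple p.1 p.2)).
Proof. by move=> mF; apply: (measurableT_comp mF); exact: measurable_cons. Qed.

Let sec1 N (F : N.+1.-tuple T -> \bar R) x : measurable_fun setT F ->
  measurable_fun setT (fun t : N.-tuple T => F (cons_tuple x t)).
Proof. by move=> mF; exact: (measurableT_comp (sec mF) (measurable_pair1 x)). Qed.

Lemma measurable_hint_cons N (F : N.+1.-tuple T -> \bar R) :
  measurable_fun setT F -> (forall d, 0 <= F d)%E ->
  measurable_fun setT
    (fun xi => ((w xi)%:E * hint w (fun rest => F (cons_tuple xi rest)))%E).
Proof.
move=> mF F0; apply: emeasurable_funM; first exact/measurable_EFinP.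
exact: (measurable_hint (H := fun x t => F (cons_tuple x t)) mw w0 (sec mF)).
Qed.

Lemma le_hint N (F G : N.-tuple T -> \bar R) :
  measurable_fun setT F -> (forall d, 0 <= F d)%E ->
  measurable_fun setT G -> (forall d, F d <= G d)%E ->
  (hint w F <= hint w G)%E.
Proof.
elim: N F G => [|N IH] F G mF F0 mG FG /=; first exact: FG.
have G0 d : (0 <= G d)%E by exact: le_trans (FG d).
apply: le_iint.
- exact: measurable_hint_cons.
- by move=> x; rewrite mule_ge0 ?lee_fin// hint_ge0.
- exact: measurable_hint_cons.
- move=> x; rewrite lee_wpmul2l ?lee_fin//; apply: IH => //; exact: sec1.
Qed.

Lemma hintD N (F G : N.-tuple T -> \bar R) :
  measurable_fun setT F -> (forall d, 0 <= F d)%E ->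
  measurable_fun setT G -> (forall d, 0 <= G d)%E ->
  hint w (fun d => F d + G d)%E = (hint w F + hint w G)%E.
Proof.
elim: N F G => [|N IH] F G mF F0 mG G0 //=.
rewrite -iintD.
- congr iint; apply/funext => x; rewrite IH//; [|exact: sec1|exact: sec1].
  by rewrite ge0_muleDr// hint_ge0.
- exact: measurable_hint_cons.
- by move=> x; rewrite mule_ge0 ?lee_fin// hint_ge0.
- exact: measurable_hint_cons.
- by move=> x; rewrite mule_ge0 ?lee_fin// hint_ge0.
Qed.

Lemma hint_cst N (c v : R) : 0 <= c -> iint (fun x => (w x)%:E) = v%:E ->
  hint w (fun _ : N.-tuple T => c%:E) = (c * v ^+ N)%:E.
Proof.
move=> c0 hv; have v0 : 0 <= v.
  by rewrite -lee_fin -hv; apply: iint_ge0 => x; rewrite lee_fin.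
elim: N => [|N IH] /=; first by rewrite expr0 mulr1.
under eq_fun do rewrite IH muleC.
rewrite iintZ ?hv ?lee_fin ?mulr_ge0 ?exprn_ge0//; last exact/measurable_EFinP.
by rewrite -EFinM exprSr mulrA.
Qed.

Lemma hint0 N : hint w (fun _ : N.-tuple T => 0%E) = 0%E.
Proof.
have i0 j : iint (fun _ : j.-tuple R => 0%E) = 0%E :> \bar R.
  by elim: j => [//|j IH] /=; under eq_integral do rewrite IH; rewrite integral0.
by elim: N => [//|N IH] /=; under eq_fun do rewrite IH mule0; exact: i0.
Qed.

Lemma hint_sum (I : eqType) (L : seq I) N (G : I -> N.-tuple T -> \bar R) :
  (forall i, measurable_fun setT (G i)) -> (forall i d, 0 <= G i d)%E ->
  hint w (fun d => \sum_(i <- L) G i d)%E = (\sum_(i <- L) hint w (G i))%E.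
Proof.
move=> mG G0; elim: L => [|i L IH].
  rewrite big_nil; under eq_fun do rewrite big_nil.
  exact: hint0.
rewrite big_cons -IH -hintD//.
- by congr hint; apply/funext => d; rewrite big_cons.
- exact: emeasurable_sum.
- by move=> d; apply: sume_ge0.
Qed.

End weight.

(* Tensorised form of p <= l q + p^2 / (4 l q); the induction works because the
   multiplier l may depend on the first outcome. *)
Lemma hint_le_chi2 (p q x : T -> R) :
  measurable_fun setT p -> (forall t, 0 < p t) ->
  measurable_fun setT q -> (forall t, 0 < q t) ->
  measurable_fun setT x -> (forall t, p t ^+ 2 <= q t * x t) ->
  forall N (G : N.-tuple T -> \bar R) (l : R), 0 < l ->
  measurable_fun setT G -> (forall d, 0 <= G d <= 1)%E ->
  (hint p G <= l%:E * hint q G + ((4 * l)^-1)%:E * hint x (fun _ : N.-tuple T => 1%:E))%E.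
Proof.
move=> mp p0 mq q0 mx px.
have x0 t : 0 <= x t.
  by rewrite -(pmulr_rge0 _ (q0 t)) (le_trans _ (px t))// sqr_ge0.
elim=> [|N IH] G l l0 mG G01 /=.
  have /andP[] := G01 [tuple]; case: (G [tuple]) => [g||]//.
  rewrite -!EFinM -EFinD !lee_fin => g0 g1.
  (* This square gives 1 <= l + 1 / (4 l); the bound at a value g in [0, 1] follows because it is
     affine in g. *)
  have : 0 <= (2 * l - 1) ^+ 2 / (4 * l) by rewrite divr_ge0 ?sqr_ge0// mulr_ge0// ltW.
  have -> : (2 * l - 1) ^+ 2 / (4 * l) = l + (4 * l)^-1 - 1 by field; rewrite gt_eqF.
  have : 0 <= (4 * l)^-1 by rewrite invr_ge0 mulr_ge0// ltW.
  by move: ((4 * l)^-1) => v; nra.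
have G0 d : (0 <= G d)%E by have /andP[] := G01 d.
have sec xi : measurable_fun setT (fun t : N.-tuple T => G (cons_tuple xi t)).
  have m1 : measurable_fun setT (fun p : T * N.-tuple T => cons_tuple p.1 p.2 : N.+1.-tuple T).
    exact: measurable_cons.
  exact: (measurableT_comp (measurableT_comp mG m1) (measurable_pair1 xi)).
have q0' t : 0 <= q t by exact: ltW.
have p0' t : 0 <= p t by exact: ltW.
have i4l : 0 <= (4 * l)^-1 by rewrite invr_ge0 mulr_ge0// ltW.
set X := hint x (fun _ : N.-tuple T => 1%:E).
have X0 : (0 <= X)%E by apply: hint_ge0 => // d; rewrite lee_fin.
set Q := fun xi => hint q (fun rest : N.-tuple T => G (cons_tuple xi rest)).
have Q0 xi : (0 <= Q xi)%E by exact: hint_ge0.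
have mqQ : measurable_fun setT (fun xi => ((q xi)%:E * Q xi)%E).
  exact: (measurable_hint_cons mq q0' mG G0).
have mxX : measurable_fun setT (fun xi : T => ((x xi)%:E * X)%E).
  by apply: emeasurable_funM => //; exact/measurable_EFinP.
have qQ0 t : (0 <= (q t)%:E * Q t)%E by rewrite mule_ge0 ?lee_fin// q0'.
have xX0 t : (0 <= (x t)%:E * X)%E by rewrite mule_ge0 ?lee_fin// x0.
rewrite -(iintZ (k := l%:E) _ mqQ qQ0) ?lee_fin ?(ltW l0)//.
rewrite -(iintZ (k := ((4 * l)^-1)%:E) _ mxX xX0) ?lee_fin//.
rewrite -iintD; first last.
- by move=> t; rewrite mule_ge0 ?lee_fin.
- exact: emeasurable_funM.
- by move=> t; rewrite mule_ge0 ?lee_fin ?(ltW l0).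
- exact: emeasurable_funM.
apply: le_iint.
- exact: (measurable_hint_cons mp p0' mG G0).
- by move=> xi; rewrite mule_ge0 ?lee_fin ?p0'// hint_ge0.
- by apply: emeasurable_funD; exact: emeasurable_funM.
(* With this multiplier p lx = l q, and p / (4 lx) = p^2 / (4 l q) is at most x / (4 l). *)
- move=> xi; pose lx := l * q xi / p xi.
  have lx0 : 0 < lx by rewrite divr_gt0// mulr_gt0.
  have pn0 := lt0r_neq0 (p0 xi); have qn0 := lt0r_neq0 (q0 xi).
  have ln0 := lt0r_neq0 l0.
  have h := IH _ _ lx0 (sec xi) (fun d => G01 (cons_tuple xi d)).
  apply: (@le_trans _ _ ((p xi)%:E * (lx%:E * Q xi + ((4 * lx)^-1)%:E * X))%E).
    by rewrite lee_wpmul2l ?lee_fin.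
  rewrite ge0_muleDr; first last.
  + by rewrite mule_ge0// lee_fin invr_ge0 mulr_ge0// ltW.
  + by rewrite mule_ge0// lee_fin ltW.
  apply: leeD.
    rewrite !muleA -!EFinM (_ : p xi * lx = l * q xi)//.
    by rewrite /lx; field.
  rewrite !muleA -!EFinM lee_wpmul2r// lee_fin.
  rewrite (_ : p xi * (4 * lx)^-1 = (4 * l)^-1 * (p xi ^+ 2 / q xi)); last first.
    by rewrite /lx; field; rewrite qn0 ln0 pn0.
  by rewrite ler_wpM2l// ler_pdivrMr// mulrC.
Qed.

End weighted_product_integral.

Section seed.
Context d (T : measurableType d) (R : realType).
Local Notation leb := (@lebesgue_measure R).

Definition seedint (E : set (T * R)) (x : T) : \bar R :=
  (\int[leb]_(u in `[0%R, 1%R]) (\1_E (x, u))%:E)%E.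

Lemma seedint_ge0 (E : set (T * R)) x : (0 <= seedint E x)%E.
Proof. by apply: integral_ge0 => u _; rewrite lee_fin. Qed.

Let msec (E : set (T * R)) (x : T) : measurable E ->
  measurable_fun setT (fun u : R => (\1_E (x, u) : R)%:E).
Proof.
move=> mE; apply/measurable_EFinP.
have mi : measurable_fun setT (\1_E : T * R -> R) by exact: measurable_indic.
exact: (measurableT_comp mi (measurable_pair1 x)).
Qed.

Lemma measurable_seedint (E : set (T * R)) : measurable E -> measurable_fun setT (seedint E).
Proof.
move=> mE; pose E' := E `&` (setT `*` `[0%R, 1%R]%classic).
have mE' : measurable E' by apply: measurableI => //; exact: measurableX.
have mi : measurable_fun setT (fun p : T * measurableTypeR R => (\1_E' p : R)%:E).
  by apply/measurable_EFinP; exact: measurable_indic.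
rewrite (_ : seedint E = fubini_F leb (fun p => (\1_E' p)%:E)).
  exact: measurable_fun_fubini_tonelli_F.
apply/funext => x; rewrite /seedint integral_mkcond /fubini_F.
apply: eq_integral => u _; rewrite patchE !indicE /E' in_setI in_setX.
by rewrite in_setT /=; case: ifP => _; rewrite ?andbT ?andbF.
Qed.

Lemma sum_seedint_le (I : eqType) (L : seq I) (E : I -> set (T * R)) (K : R) x :
  (forall i, measurable (E i)) ->
  (forall u, \sum_(i <- L) (\1_(E i) (x, u) : R) <= K) ->
  (\sum_(i <- L) seedint (E i) x <= K%:E)%E.
Proof.
move=> mE hK; rewrite /seedint -ge0_integral_sum//; first last.
- by move=> i; apply: measurable_funTS; exact: msec.
apply: (@le_trans _ _ (\int[leb]_(u in `[0%R, 1%R]) K%:E)%E).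
  apply: ge0_le_integral => //.
  - by move=> u _; apply: sume_ge0 => i _; rewrite lee_fin.
  - by apply: emeasurable_sum => i; apply: measurable_funTS; exact: msec.
  - by move=> u _; rewrite sumEFin lee_fin.
by rewrite integral_cst//= lebesgue_measure_itv/= lte01 oppr0 adde0 mule1.
Qed.

Lemma seedint_le1 (E : set (T * R)) x : measurable E -> (seedint E x <= 1)%E.
Proof.
move=> mE; have := @sum_seedint_le bool [:: true] (fun=> E) 1 x (fun=> mE).
rewrite big_seq1; apply => u; rewrite big_seq1.
by rewrite indicE lern1 leq_b1.
Qed.

End seed.

Section counting_bound.
Variables (R : realType) (k N : nat) (I : eqType) (L : seq I).
Local Notation T := (k.-tuple R).
Variables (q : T -> R) (p x : I -> T -> R) (E : I -> set (N.-tuple T * R)) (X K : R).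
Hypotheses (mq : measurable_fun setT q) (q0 : forall t, 0 < q t)
  (q1 : iint (fun t => (q t)%:E) = 1%:E).
Hypotheses (mp : forall i, i \in L -> measurable_fun setT (p i))
  (p0 : forall i, i \in L -> forall t, 0 < p i t)
  (mx : forall i, i \in L -> measurable_fun setT (x i))
  (px : forall i, i \in L -> forall t, p i t ^+ 2 <= q t * x i t)
  (x1 : forall i, i \in L -> iint (fun t => (x i t)%:E) = X%:E).
Hypotheses (mE : forall i, measurable (E i))
  (EK : forall du, \sum_(i <- L) (\1_(E i) du : R) <= K)
  (pE : forall i, i \in L -> ((2 / 3)%:E <= hint (p i) (seedint (E i)))%E).

(** Once every success probability is transferred to the common reference q, the events can be added
    inside a single integral, where at most K of them overlap. The multiplier l is left for the
    caller to choose. *)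
Lemma counting_bound (l : R) : 0 < l ->
  (size L)%:R * (2 / 3) <= l * K + (size L)%:R * (X ^+ N / (4 * l)).
Proof.
move=> l0.
have q0' t : 0 <= q t by exact: ltW.
have mS i : measurable_fun setT (seedint (E i)) by exact: measurable_seedint.
have K0 : 0 <= K.
  by apply: le_trans (EK point); apply: sumr_ge0 => i _; rewrite indicE ler0n.
have H i : i \in L -> ((2 / 3)%:E <=
    l%:E * hint q (seedint (E i)) + (X ^+ N / (4 * l))%:E)%E.
  move=> iL; apply: le_trans (pE iL) _.
  have x0 t : 0 <= x i t.
    by rewrite -(pmulr_rge0 _ (q0 t)) (le_trans _ (px iL t))// sqr_ge0.
  have := hint_le_chi2 (mp iL) (p0 iL) mq q0 (mx iL) (px iL) l0 (mS i).
  rewrite (hint_cst (mx iL) x0 N _ (x1 iL))// mul1r -EFinM [_^-1 * _]mulrC.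
  by apply => d; rewrite seedint_ge0 seedint_le1.
have cst (c : R) : \sum_(i <- L) c = (size L)%:R * c.
  by rewrite big_const_seq count_predT iter_addr_0 mulr_natl.
have : (\sum_(i <- L) (2 / 3)%:E <=
    \sum_(i <- L) (l%:E * hint q (seedint (E i)) + (X ^+ N / (4 * l))%:E))%E.
  by rewrite big_seq [leRHS]big_seq; apply: lee_sum => i /H.
rewrite big_split /= !sumEFin !cst.
rewrite -ge0_sume_distrr; last by move=> i _; apply: hint_ge0 => // d; exact: seedint_ge0.
rewrite -hint_sum//; last by move=> i d; exact: seedint_ge0.
have hq : (hint q (fun d => \sum_(i <- L) seedint (E i) d) <= K%:E)%E.
  have -> : K%:E = hint q (fun _ : N.-tuple T => K%:E).
    by rewrite (hint_cst mq q0' N K0 q1) expr1n mulr1.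
  apply: le_hint => //.
  - exact: emeasurable_sum.
  - by move=> d; apply: sume_ge0 => i _; exact: seedint_ge0.
  - by move=> d; exact: sum_seedint_le.
move=> h; rewrite -lee_fin EFinD; apply: le_trans h _.
by rewrite leeD2r// EFinM lee_wpmul2l// lee_fin ltW.
Qed.

End counting_bound.

(** * Heterodyne statistics *)

Section heterodyne_chi2.
Variables (R : realType) (m r : nat) (a e : R).
Local Notation n := (m + (m + r))%N.
Hypotheses (a0 : 0 < a) (e0 : 0 < e).

Definition fstt (xi : (n + n).-tuple R) : n.-tuple R := [tuple tnth xi (lshift n i) | i < n].
Definition sndt (xi : (n + n).-tuple R) : n.-tuple R := [tuple tnth xi (rshift n i) | i < n].

Lemma cat_fst_snd xi : cat_tuple (fstt xi) (sndt xi) = xi.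
Proof.
apply: eq_from_tnth => i; case: (split_ordP i) => j ->.
  by rewrite tnth_lshift tnth_mktuple.
by rewrite tnth_rshift tnth_mktuple.
Qed.

Lemma fst_cat x p : fstt (cat_tuple x p) = x.
Proof. by apply: eq_from_tnth => i; rewrite tnth_mktuple tnth_lshift. Qed.

Lemma snd_cat x p : sndt (cat_tuple x p) = p.
Proof. by apply: eq_from_tnth => i; rewrite tnth_mktuple tnth_rshift. Qed.

Lemma measurable_fstt : measurable_fun setT fstt.
Proof.
apply/measurable_fun_tnthP => i; rewrite (_ : _ \o _ = @tnth _ _ ^~ (lshift n i)).
  exact: measurable_tnth.
by apply/funext => xi /=; rewrite tnth_mktuple.
Qed.

Lemma measurable_sndt : measurable_fun setT sndt.
Proof.
apply/measurable_fun_tnthP => i; rewrite (_ : _ \o _ = @tnth _ _ ^~ (rshift n i)).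
  exact: measurable_tnth.
by apply/funext => xi /=; rewrite tnth_mktuple.
Qed.

Lemma iint_fst_snd (f g : n.-tuple R -> R) (u v : R) :
  measurable_fun setT f -> (forall x, 0 <= f x) -> iint (fun x => (f x)%:E) = u%:E ->
  measurable_fun setT g -> (forall x, 0 <= g x) -> iint (fun x => (g x)%:E) = v%:E ->
  iint (fun xi => (f (fstt xi) * g (sndt xi))%:E) = (u * v)%:E.
Proof.
move=> mf f0 fu mg g0 gv; rewrite iint_cat.
have v0 : (0 <= v%:E)%E by rewrite -gv; apply: iint_ge0 => x; rewrite lee_fin.
under eq_fun => x.
  under eq_fun => p do rewrite fst_cat snd_cat EFinM.
  rewrite iintZ ?lee_fin//; last exact/measurable_EFinP.
  rewrite gv muleC.
over.
rewrite iintZ//.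
  by rewrite fu -EFinM mulrC.
exact/measurable_EFinP.
Qed.

Lemma iint_gexp0 k (c : R) : 0 < c ->
  iint (fun t : k.-tuple R => (gexp c (fun=> 0) t)%:E) = (gZ c ^+ k)%:E.
Proof.
move=> c0; have c20 : 0 < c / 2 by rewrite divr_gt0.
rewrite -[in RHS](_ : 2 * (c / 2) = c); last by field.
rewrite -iint_exp_sqt//; congr iint; apply/funext => t; rewrite /gexp.
by rewrite (_ : dott _ _ = 0) ?addr0// /dott big1// => i _; rewrite mul0r.
Qed.

(** The density of the outcome with the coupling b removed, hence common to all W. *)
Definition het_ref (xi : (n + n).-tuple R) : R :=
  (gZ a^-1 ^+ n * gZ e^-1 ^+ n)^-1 *
  (gexp a^-1 (fun=> 0) (fstt xi) * gexp e^-1 (fun=> 0) (sndt xi)).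

Let gZn0 k c : 0 < c -> 0 < gZ c ^+ k :> R.
Proof. by move=> c0; rewrite exprn_gt0// gZ_gt0. Qed.

Let ia0 : 0 < a^-1. Proof. by rewrite invr_gt0. Qed.
Let ie0 : 0 < e^-1. Proof. by rewrite invr_gt0. Qed.

Lemma het_ref_gt0 xi : 0 < het_ref xi.
Proof. by rewrite !mulr_gt0 ?expR_gt0// invr_gt0 mulr_gt0// gZn0. Qed.

Let measurable_prod (f g : n.-tuple R -> R) (c : R) :
  measurable_fun setT f -> measurable_fun setT g ->
  measurable_fun setT (fun xi => c * (f (fstt xi) * g (sndt xi))).
Proof.
move=> mf mg; apply: measurable_funM => //; apply: measurable_funM.
  exact: (measurableT_comp mf measurable_fstt).
exact: (measurableT_comp mg measurable_sndt).
Qed.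

Lemma measurable_het_ref : measurable_fun setT het_ref.
Proof. by apply: measurable_prod; exact: measurable_gexp. Qed.

Let iint_prodZ (f g : n.-tuple R -> R) (c u v : R) : 0 <= c ->
  measurable_fun setT f -> (forall x, 0 <= f x) -> iint (fun x => (f x)%:E) = u%:E ->
  measurable_fun setT g -> (forall x, 0 <= g x) -> iint (fun x => (g x)%:E) = v%:E ->
  iint (fun xi => (c * (f (fstt xi) * g (sndt xi)))%:E) = (c * (u * v))%:E.
Proof.
move=> c0 mf f0 fu mg g0 gv; under eq_fun do rewrite EFinM.
rewrite iintZ ?lee_fin//; last by move=> t; rewrite lee_fin mulr_ge0.
  by rewrite (iint_fst_snd mf f0 fu mg g0 gv).
apply/measurable_EFinP; apply: measurable_funM.
  exact: (measurableT_comp mf measurable_fstt).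
exact: (measurableT_comp mg measurable_sndt).
Qed.

Lemma iint_het_ref : iint (fun xi => (het_ref xi)%:E) = 1%:E.
Proof.
rewrite (iint_prodZ _ _ _ (iint_gexp0 n ia0) _ _ (iint_gexp0 n ie0)).
- by rewrite mulVf// gt_eqF// mulr_gt0// gZn0.
- by rewrite invr_ge0 ltW// mulr_gt0// gZn0.
- exact: measurable_gexp.
- by move=> x; exact: expR_ge0.
- exact: measurable_gexp.
- by move=> x; exact: expR_ge0.
Qed.

Variables (W : 'M[R]_m) (b : R).
Hypotheses (HW : orthogonal_mx W) (ab : `|b| < a).

Let i1 := inv1 a b.
Let i2 := inv2 a b.
Let Z0 : 0 < Zr m r i1 i2. Proof. exact: Zr_gt0 (inv_lt ab). Qed.

Lemma gauss_pdf_fst_snd xi : gauss_pdf (cov r W a b e) xi =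
  (Zr m r i1 i2 * gZ e^-1 ^+ n)^-1 * (phi W i1 i2 (fstt xi) * gexp e^-1 (fun=> 0) (sndt xi)).
Proof. by rewrite -{1}(cat_fst_snd xi) gauss_pdf_cov// mulrA. Qed.

Lemma gauss_pdf_gt0 xi : 0 < gauss_pdf (cov r W a b e) xi.
Proof.
by rewrite gauss_pdf_fst_snd !mulr_gt0 ?expR_gt0// invr_gt0 mulr_gt0// gZn0.
Qed.

Lemma measurable_gauss_pdf : measurable_fun setT (gauss_pdf (cov r W a b e)).
Proof.
rewrite (funext gauss_pdf_fst_snd); apply: measurable_prod; last exact: measurable_gexp.
exact: measurable_phi.
Qed.

Let c1 := 2 * i1 - a^-1.
Let c2 := 2 * i2.

(** Positivity of the precision of p^2 / q, without which the chi-square integral would diverge: c1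
    - |c2| = (a - |b|)^2 / (a (a^2 - b^2)). *)
Let c12 : `|c2| < c1.
Proof.
have D := subr_sqr_gt0 ab.
have b2 := real_normK (num_real b).
rewrite /c2 /c1 /i1 /i2 /inv1 /inv2 !normrM normrN [`|2|]ger0_norm// [`|_^-1|]gtr0_norm ?invr_gt0//.
rewrite -subr_gt0 (_ : _ - _ = (a - `|b|) ^+ 2 / (a * (a ^+ 2 - b ^+ 2))).
  by rewrite divr_gt0 ?mulr_gt0// subr_gt0.
by rewrite sqrrB b2; field; rewrite !gt_eqF.
Qed.

Definition het_chi_fun (xi : (n + n).-tuple R) : R :=
  (gZ a^-1 ^+ n / (Zr m r i1 i2 ^+ 2 * gZ e^-1 ^+ n)) *
  (phi W c1 c2 (fstt xi) * gexp e^-1 (fun=> 0) (sndt xi)).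

(** The integral of p^2 / q: one plus the chi-square divergence of a single outcome from the
    reference. *)
Definition het_chi : R := gZ a^-1 ^+ n * Zr m r c1 c2 / Zr m r i1 i2 ^+ 2.

Lemma measurable_het_chi_fun : measurable_fun setT het_chi_fun.
Proof. by apply: measurable_prod; [exact: measurable_phi|exact: measurable_gexp]. Qed.

Lemma het_chi_funP xi : gauss_pdf (cov r W a b e) xi ^+ 2 = het_ref xi * het_chi_fun xi.
Proof.
rewrite gauss_pdf_fst_snd /het_ref /het_chi_fun.
have : phi W i1 i2 (fstt xi) ^+ 2 = gexp a^-1 (fun=> 0) (fstt xi) * phi W c1 c2 (fstt xi).
  rewrite /phi /gexp expr2 -!expRD; congr expR.
  rewrite (_ : dott _ _ = 0) ?addr0; last by rewrite /dott big1// => i _; rewrite mul0r.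
  by rewrite /c1 /c2; field; rewrite gt_eqF.
move=> hp; rewrite [LHS]exprMn [X in _ * X = _]exprMn hp.
have ga := gt_eqF (gZn0 n ia0); have ge := gt_eqF (gZn0 n ie0); have gz := gt_eqF Z0.
move: ga ge gz; move: (gZ a^-1 ^+ n) (gZ e^-1 ^+ n) (Zr m r i1 i2) => u v w.
move: (phi _ _ _ _) (gexp _ _ _) (gexp _ _ _) => ? ? ? u0 v0 w0.
by field; rewrite u0 v0 w0.
Qed.

Lemma iint_het_chi_fun : iint (fun xi => (het_chi_fun xi)%:E) = het_chi%:E.
Proof.
have ga := gt_eqF (gZn0 n ia0); have ge := gt_eqF (gZn0 n ie0); have gz := gt_eqF Z0.
rewrite (iint_prodZ _ _ _ (iint_phi r HW c12) _ _ (iint_gexp0 n ie0)).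
- by congr EFin; rewrite /het_chi; field; rewrite ge gz.
- apply: divr_ge0; first exact/ltW/gZn0.
  by apply: mulr_ge0; [exact: sqr_ge0 | exact/ltW/gZn0].
- exact: measurable_phi.
- by move=> x; exact: expR_ge0.
- exact: measurable_gexp.
- by move=> x; exact: expR_ge0.
Qed.

(** An eigendirection with variance a + b and one with variance a - b contribute the same squared
    factor a^2 / (a^2 - b^2), so only the total number n of modes matters. *)
Lemma sqr_het_chi : het_chi ^+ 2 = (a ^+ 2 / (a ^+ 2 - b ^+ 2)) ^+ n.
Proof.
have D := subr_sqr_gt0 ab; have abp := addr_gt0_norm ab.
have abm : 0 < a - b by apply: addr_gt0_norm; rewrite normrN.
have Dn := gt_eqF D; have an := gt_eqF a0; have pn := gt_eqF abp; have mn := gt_eqF abm.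
have P0 : 0 < 2 * pi :> R by rewrite mulr_gt0 ?pi_gt0.
have Pn := gt_eqF P0.
rewrite /het_chi expr_div_n [(_ * Zr _ _ _ _) ^+ 2]exprMn [Zr _ _ c1 c2 ^+ 2]sqr_Zr//.
rewrite [Zr _ _ i1 i2 ^+ 2]sqr_Zr; last exact: inv_lt.
rewrite -[in LHS]exprM [(n * 2)%N in LHS]mulnC exprM sqr_gZ//.
have -> : i1 ^+ 2 - i2 ^+ 2 = (a ^+ 2 - b ^+ 2)^-1.
  by rewrite /i1 /i2 /inv1 /inv2; field; rewrite Dn.
have -> : i1 + i2 = (a + b)^-1.
  by rewrite /i1 /i2 /inv1 /inv2; field; rewrite Dn pn.
have -> : c1 ^+ 2 - c2 ^+ 2 = (a ^+ 2)^-1.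
  by rewrite /c1 /c2 /i1 /i2 /inv1 /inv2; field; rewrite Dn an.
have -> : c1 + c2 = (a - b) / (a * (a + b)).
  by rewrite /c1 /c2 /i1 /i2 /inv1 /inv2; field; rewrite Dn an pn.
rewrite !invrK !exprD; set P := 2 * pi; set d := a ^+ 2 - b ^+ 2.
rewrite [((P ^+ 2 * d) ^+ m * (P * (a + b)) ^+ r) ^+ 2]exprMn -!exprM ![(_ * 2)%N]mulnC !exprM.
have regroup (x y z u v : R) : x ^+ m * (x ^+ m * x ^+ r) * (y ^+ m * z ^+ r) / (u ^+ m * v ^+ r) =
    (x * x * y / u) ^+ m * (x * z / v) ^+ r.
  by rewrite !exprMn !exprVn invfM; ring.
rewrite regroup.
rewrite [RHS]mulrA -[_ ^+ m * _ ^+ m]exprMn; congr (_ ^+ m * _ ^+ r).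
  by field; rewrite Dn Pn.
by rewrite /d; field; rewrite Dn Pn an pn mn.
Qed.

End heterodyne_chi2.

(** * Physicality, energy bound and vacuum noise *)

Section covariance_constraints.
Variables (R : realType) (m r : nat) (W : 'M[R]_m).
Hypothesis HW : orthogonal_mx W.
Local Notation n := (m + (m + r))%N.

Lemma tcol_mktuple k (X : 'cV[R]_k) : tcol [tuple X i 0 | i < k] = X.
Proof. by apply/matrixP => i j; rewrite mxE tnth_mktuple (ord1 j). Qed.

Lemma reflin_bounds (a b : R) (X : 'cV[R]_n) :
  (a - `|b|) * sqn X <= (X^T *m reflin r W a b *m X) 0 0 <= (a + `|b|) * sqn X.
Proof.
rewrite -(tcol_mktuple X) quad_reflin -sqt_tcol; set x := [tuple _ | _ < _].
have : `|b * qrefl W x| <= `|b| * sqt x by rewrite normrM ler_wpM2l// qrefl_le.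
rewrite ler_norml => /andP[h1 h2]; rewrite mulrBl mulrDl; lra.
Qed.

Lemma sqn_ge0 k (X : 'cV[R]_k) : 0 <= sqn X.
Proof. by apply: sumr_ge0 => i _; exact: sqr_ge0. Qed.

Lemma sqnE00 k (X : 'cV[R]_k) : (X^T *m X) 0 0 = sqn X.
Proof. by rewrite sqnE mxE mulr1n. Qed.

Lemma sqn_col k l (X : 'cV[R]_k) (Y : 'cV[R]_l) : sqn (col_mx X Y) = sqn X + sqn Y.
Proof.
by rewrite /sqn big_split_ord /=; congr (_ + _); apply: eq_bigr => i _;
   rewrite ?col_mxEu ?col_mxEd.
Qed.

Lemma reflin_tr (a b : R) : (reflin r W a b)^T = reflin r W a b.
Proof.
have tD (A B : 'M[R]_n) : (A + B)^T = A^T + B^T by exact: linearD.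
have tZ k (A : 'M[R]_n) : (k *: A)^T = k *: A^T by exact: linearZ.
by rewrite /reflin tD tZ tr_scalar_mx refl_tr.
Qed.

Lemma sqn_reflin_le (a b : R) (X : 'cV[R]_n) : 0 <= a ->
  sqn (reflin r W a b *m X) <= (a + `|b|) ^+ 2 * sqn X.
Proof.
move=> a0; rewrite -sqnE00 trmx_mul reflin_tr mulmxA.
rewrite -[X^T *m _ *m _]mulmxA.
have -> : reflin r W a b *m reflin r W a b = reflin r W (a ^+ 2 + b ^+ 2) (2 * a * b).
  rewrite {1 2}/reflin mulmxDl !mulmxDr -!scalemxAl -!scalemxAr refl_sqr//.
  rewrite !mul_scalar_mx mul_mx_scalar /reflin.
  move: refl => P; apply/matrixP => i j; rewrite !mxE.
  by case: (i == j); rewrite /= ?mulr1n ?mulr0n; ring.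
have /andP[_] := reflin_bounds (a ^+ 2 + b ^+ 2) (2 * a * b) X.
rewrite (_ : _ + `|_| = (a + `|b|) ^+ 2)// !normrM (ger0_norm a0) ger0_norm//.
by rewrite sqrrD (real_normK (num_real b)); ring.
Qed.

(** The symplectic term splits into two position-momentum products. Each is absorbed by (4 e)^-1
    |A|^2 + e |B|^2, whose coefficients have product 1/4, and a - |b| bounds the position form from
    below. *)
Lemma cov_qcm (a b e : R) : 0 < e -> (4 * e)^-1 <= a - `|b| -> is_qcm (cov r W a b e).
Proof.
move=> e0 he; split.
  by rewrite /cov tr_block_mx reflin_tr !trmx0 tr_scalar_mx.
have block (X P : 'cV[R]_n) : ((col_mx X P)^T *m cov r W a b e *m col_mx X P) 0 0 =
    (X^T *m reflin r W a b *m X) 0 0 + e * sqn P.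
  rewrite /cov tr_col_mx mul_row_block !mulmx0 addr0 add0r mul_row_col mxE.
  by rewrite mul_mx_scalar -scalemxAl [X in _ + X]mxE sqnE00.
move=> u v; rewrite -(vsubmxK u) -(vsubmxK v).
set X := usubmx u; set P := dsubmx u; set Y := usubmx v; set Q := dsubmx v.
have entry (A B C : 'M[R]_1) : (A + B - C) 0 0 = A 0 0 + B 0 0 - C 0 0 by rewrite !mxE.
rewrite entry !block.
rewrite /Omega tr_col_mx mul_row_block !mulmx0 addr0 add0r !mulmx1 mul_row_col.
rewrite mulmxN mulmx1 mulNmx [(_ + X^T *m Q) 0 0]mxE [(- (P^T *m Y)) 0 0]mxE.
have /andP[hX _] := reflin_bounds a b X; have /andP[hY _] := reflin_bounds a b Y.
have dot (c : R) (A B : 'cV[R]_n) : c ^+ 2 = 1 ->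
    c * (A^T *m B) 0 0 <= (a - `|b|) * sqn A + e * sqn B.
  move=> c1; apply: (@le_trans _ _ ((4 * e)^-1 * sqn A + e * sqn B)); last first.
    by rewrite lerD2r ler_wpM2r// sqn_ge0.
  rewrite mxE /sqn !mulr_sumr -big_split; apply: ler_sum => i _; rewrite !mxE.
  have : 0 <= (4 * e)^-1 * (A i 0 - c * (2 * e * B i 0)) ^+ 2.
    by rewrite mulr_ge0 ?sqr_ge0// invr_ge0 mulr_ge0// ltW.
  suff -> : (4 * e)^-1 * (A i 0 - c * (2 * e * B i 0)) ^+ 2 =
    (4 * e)^-1 * A i 0 ^+ 2 + c ^+ 2 * (e * B i 0 ^+ 2) - c * (A i 0 * B i 0).
    by rewrite c1 mul1r /=; lra.
  by field; rewrite gt_eqF.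
have PY : (P^T *m Y) 0 0 = (Y^T *m P) 0 0.
  by rewrite !mxE; apply: eq_bigr => i _; rewrite !mxE mulrC.
have := dot 1 X Q (expr1n _ _); have := dot (-1) Y P; rewrite sqrrN expr1n => /(_ erefl).
rewrite mul1r mulN1r PY; lra.
Qed.

Lemma mx_opnorm_cov (a b e : R) : 0 <= a -> a + `|b| <= e ->
  (mx_opnorm (cov r W a b e) <= e%:E)%E.
Proof.
move=> a0 abe; have e0 : 0 <= e by apply: le_trans abe; rewrite addr_ge0.
have vE k (X : 'cV[R]_k) : vnorm X = Num.sqrt (sqn X).
  by rewrite /vnorm sqnE00.
apply: ge_ereal_sup => _ [v /= v1 <-]; rewrite lee_fin !vE -(vsubmxK v).
rewrite /cov mul_block_col !mul0mx addr0 add0r mul_scalar_mx sqn_col.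
rewrite -[leRHS](ger0_norm e0) -sqrtr_sqr ler_wsqrtr//.
have v1' : sqn v <= 1.
  by rewrite -(sqr_sqrtr (sqn_ge0 v)) -vE expr_le1// vE sqrtr_ge0.
have -> : sqn (e *: dsubmx v) = e ^+ 2 * sqn (dsubmx v).
  by rewrite /sqn mulr_sumr; apply: eq_bigr => i _; rewrite mxE exprMn.
apply: (@le_trans _ _ (e ^+ 2 * (sqn (usubmx v) + sqn (dsubmx v)))); last first.
  by rewrite -sqn_col vsubmxK -[leRHS]mulr1 ler_wpM2l// sqr_ge0.
rewrite mulrDr lerD2r (le_trans (sqn_reflin_le _ _ a0))// ler_wpM2r ?sqn_ge0//.
by rewrite ler_sqr ?nnegrE// addr_ge0.
Qed.

(** Used with c = 1/2. Vacuum noise raises the position variance but leaves b unchanged, so the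
    relative coupling falls from order eta to order eta / E; this is the source of the factor
    E^2. *)
Lemma cov_add_scalar (a b e c : R) :
  cov r W a b e + c%:M = cov r W (a + c) b (e + c).
Proof.
rewrite /cov (scalar_mx_block n n) add_block_mx !addr0; congr block_mx.
  by rewrite /reflin [(a + c)%:M](raddfD (@scalar_mx R n)) addrAC.
by rewrite [RHS](raddfD (@scalar_mx R n)).
Qed.

End covariance_constraints.

Lemma het_intE (R : realType) n (C : 'M[R]_(n + n)) N (F : N.-tuple ((n + n).-tuple R) -> \bar R) :
  het_int C F = hint (gauss_pdf C) F.
Proof.
elim: N F => [//|N IH] F /=; congr iint; apply/funext => xi.
by rewrite IH.
Qed.

(** * The lower bound *)

Section overlap_size.
Variables (R : realType) (m r : nat) (e eta : R).
Local Notation n := (m + (m + r))%N.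
Hypotheses (e0 : 0 < e) (eta0 : 0 < eta).

(** The difference of [amp] and [coup] is exactly 1 / (4 e), the smallest position variance that the
    uncertainty relation allows next to momentum variance e. *)
Definition amp : R := (1 + eta) / (4 * e).
Definition coup : R := eta / (4 * e).

Let e40 : 0 < 4 * e. Proof. by rewrite mulr_gt0. Qed.

Lemma coup_ge0 : 0 <= coup.
Proof. by rewrite divr_ge0 ?ltW. Qed.

Lemma ampE : amp = (4 * e)^-1 + coup.
Proof. by rewrite /amp /coup; field; rewrite gt_eqF. Qed.

Lemma coup_lt_amp : `|coup| < amp.
Proof. by rewrite ger0_norm ?coup_ge0// ampE ltrDr invr_gt0. Qed.

Let A := inv1 amp coup / 4 + e.
Let B := inv2 amp coup / 4.

Let ed0 : e != 0. Proof. by rewrite gt_eqF. Qed.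
Let h0 : 1 + eta != 0. Proof. by rewrite gt_eqF// addr_gt0. Qed.
Let h20 : 1 + 2 * eta != 0. Proof. by rewrite gt_eqF// addr_gt0// mulr_gt0. Qed.

Let D : amp ^+ 2 - coup ^+ 2 = (1 + 2 * eta) / (4 * e) ^+ 2.
Proof. by rewrite /amp /coup; field. Qed.

Let i1E : inv1 amp coup = 4 * e * (1 + eta) / (1 + 2 * eta).
Proof. by rewrite /inv1 D /amp; field; rewrite h20. Qed.

Let i2E : inv2 amp coup = - (4 * e * eta / (1 + 2 * eta)).
Proof. by rewrite /inv2 D /coup; field; rewrite h20. Qed.

Let BA : `|B| < A.
Proof.
have := inv_lt coup_lt_amp; rewrite /A /B [`|_ / 4|]normrM [`|(4^-1 : R)|]ger0_norm// => h.
by rewrite ltr_pwDr// ler_wpM2r// ltW.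
Qed.

Lemma kappa_ge0 : 0 <= kappa m r amp coup e.
Proof.
have gZ0 (c : R) : 0 < c -> 0 <= gZ c ^+ n by move=> c0; rewrite exprn_ge0// ltW// gZ_gt0.
rewrite /kappa -/A -/B; apply: mulr_ge0; first by rewrite invr_ge0 exprn_ge0.
apply: mulr_ge0; last exact/ltW/Zr_gt0.
apply: mulr_ge0.
  apply: mulr_ge0; last by apply: gZ0; rewrite mulr_gt0.
  apply: divr_ge0; first by rewrite divr_ge0 ?gZ0// ltW.
  by rewrite mulr_ge0//; exact/ltW/Zr_gt0/inv_lt/coup_lt_amp.
apply: divr_ge0; last exact/ltW/subr_sqr_gt0.
rewrite /B i2E mulNr opprK divr_ge0// divr_ge0 ?mulr_ge0 ?addr_ge0 ?mulr_ge0 ?ltW//.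
Qed.

(** The value is free of e: squeezing the test photons like the state removes the energy scale. It
    is about (eta / 4)^2 as long as eta (m + r) is bounded. *)
Lemma sqr_kappa : kappa m r amp coup e ^+ 2 =
  (eta / (4 * (1 + eta))) ^+ 2 / (1 + eta) ^+ (m + r).
Proof.
have AB2 : A ^+ 2 - B ^+ 2 = 4 * e ^+ 2 * (1 + eta) / (1 + 2 * eta).
  by rewrite /A /B i1E i2E; field.
have AB : A + B = 2 * e * (1 + eta) / (1 + 2 * eta).
  by rewrite /A /B i1E i2E; field.
have i12 : inv1 amp coup ^+ 2 - inv2 amp coup ^+ 2 = 16 * e ^+ 2 / (1 + 2 * eta).
  by rewrite i1E i2E; field.
have iD : inv1 amp coup + inv2 amp coup = 4 * e / (1 + 2 * eta).
  by rewrite i1E i2E; field.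
have factor : - B / (A ^+ 2 - B ^+ 2) = eta / (4 * e * (1 + eta)).
  by rewrite AB2 /B i2E; field; rewrite h20 h0 ed0.
have P0 : 0 < 2 * pi :> R by rewrite mulr_gt0 ?pi_gt0.
have Pn := lt0r_neq0 P0.
have ZZ : Zr m r A B ^+ 2 =
    Zr m r (inv1 amp coup) (inv2 amp coup) ^+ 2 * (2 ^+ n / (1 + eta) ^+ (m + r)).
  rewrite !sqr_Zr//; last exact: inv_lt coup_lt_amp.
  rewrite AB2 AB i12 iD; set P := 2 * pi.
  have -> : P ^+ 2 / (4 * e ^+ 2 * (1 + eta) / (1 + 2 * eta)) =
    P ^+ 2 / (16 * e ^+ 2 / (1 + 2 * eta)) * (2 * 2 / (1 + eta)).
    by field; rewrite h20 h0 ed0.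
  have -> : P / (2 * e * (1 + eta) / (1 + 2 * eta)) =
    P / (4 * e / (1 + 2 * eta)) * (2 / (1 + eta)).
    by field; rewrite h20 h0 ed0.
  set u := P ^+ 2 / _; set v := P / _; rewrite !exprMn !exprD !exprVn invfM; ring.
have gg : (gZ (2 * e) ^+ n) ^+ 2 = (gZ (4 * e) ^+ n) ^+ 2 * 2 ^+ n.
  rewrite -!exprM ![(n * 2)%N]mulnC !exprM !sqr_gZ ?mulr_gt0// -exprMn.
  by congr (_ ^+ n); field.
have Z0 := lt0r_neq0 (Zr_gt0 m r (inv_lt coup_lt_amp)).
have g0 : gZ (4 * e) ^+ n != 0 by rewrite expf_neq0// lt0r_neq0// gZ_gt0.
have t0 : 2 ^+ n != 0 :> R by rewrite expf_neq0.
have q0 : (1 + eta) ^+ (m + r) != 0 by rewrite expf_neq0.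
rewrite /kappa -/A -/B factor; move: ZZ gg Z0 g0 t0 q0.
move: (Zr m r A B) (Zr m r _ _) (gZ (2 * e) ^+ n) (gZ (4 * e) ^+ n) (2 ^+ n) ((1 + eta) ^+ _).
move=> z' z g' g t q ZZ gg z0 g0 t0 q0; rewrite !exprMn ZZ gg.
by field; rewrite ?z0 ?g0 ?t0 ?q0 ?h0 ?ed0.
Qed.

End overlap_size.

(** A quarter of the exponent is at most 4/15; exp(4/15) <= 1 / (1 - 4/15) = 15/11, and (15/11)^4 <
    4. *)
Lemma expR_lt4 (R : realType) (x : R) : x <= 16 / 15 -> expR x < 4.
Proof.
move=> hx; apply: (@le_lt_trans _ _ (expR (4 / 15) ^+ 4)).
  by rewrite -expRM_natl ler_expR; lra.
have h : expR (4 / 15) <= 15 / 11 :> R.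
  have := expR_ge1Dx (- (4 / 15) : R); have := expRxMexpNx_1 (4 / 15 : R).
  by have := expR_gt0 (4 / 15 : R); move: (expR _) (expR _) => u v; nra.
apply: (@le_lt_trans _ _ ((15 / 11) ^+ 4)); last by lra.
by rewrite lerXn2r ?nnegrE ?expR_ge0.
Qed.

(** The constant 128 makes eta m / 16 = 8 eps, so the squared right-hand side is (8 eps)^2 / (1 +
    eta)^(m + r + 2), and the denominator must stay below 4. This holds because eta (m + r + 2) <=
    128 eps (1 + 3/5) < 16/15. *)
Lemma kappa_separates (R : realType) m r (e eps eta : R) : 0 < e -> 0 < eps ->
  eps < 5 / 1000 -> (5 <= m)%N -> (r <= 1)%N -> eta = 128 * eps / m%:R ->
  4 * eps < kappa m r (amp e eta) (coup e eta) e * (m%:R / 4).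
Proof.
move=> e0 eps0 eps1 m5 r1 etaE.
have m5' : 5 <= m%:R :> R by rewrite (ler_nat R 5 m).
have m0 : 0 < m%:R :> R by apply: lt_le_trans m5'.
have eta0 : 0 < eta by rewrite etaE divr_gt0 ?mulr_gt0.
have etam : eta * m%:R = 128 * eps by rewrite etaE divfK// gt_eqF.
have pow4 : (1 + eta) ^+ (m + r + 2) < 4.
  apply: le_lt_trans (_ : expR (eta * (m + r + 2)%:R) < 4); last first.
    apply: expR_lt4; rewrite !natrD.
    have : r%:R <= 1 :> R by rewrite (ler_nat R r 1).
    by nra.
  by rewrite mulrC expRM_natl lerXn2r ?nnegrE ?expR_ge0 ?expR_ge1Dx// addr_ge0// ltW.
have k0 : 0 <= kappa m r (amp e eta) (coup e eta) e by exact: kappa_ge0.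
rewrite -(@ltr_pXn2r _ 2)// ?nnegrE; first last.
- by rewrite mulr_ge0// divr_ge0// ltW.
- by rewrite mulr_ge0// ltW.
rewrite [ltRHS]exprMn sqr_kappa//.
rewrite [ltRHS](_ : _ = (8 * eps) ^+ 2 / (1 + eta) ^+ (m + r + 2)); last first.
  have -> : 8 * eps = eta * m%:R / 16 by rewrite etam; field.
  have p0 : (1 + eta) ^+ (m + r) != 0 by rewrite expf_neq0// gt_eqF// addr_gt0.
  rewrite [(1 + eta) ^+ (m + r + 2)]exprD; move: p0; move: (_ ^+ (m + r)) => p p0.
  by field; rewrite p0 gt_eqF// addr_gt0.
rewrite ltr_pdivlMr; last by rewrite exprn_gt0// addr_gt0.
have : 0 < eps ^+ 2 by rewrite exprn_gt0.
rewrite [(4 * eps) ^+ 2]exprMn [(8 * eps) ^+ 2]exprMn.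
by move: pow4; move: (_ ^+ (m + r + 2)) (eps ^+ 2) => p s; nra.
Qed.

(** The vacuum noise gives a^2 - b^2 >= 1/4, hence the ratio 1 + b^2 / (a^2 - b^2) is at most 1 + 4
    b^2. *)
Lemma ratio_le_expR (R : realType) (a b : R) : 0 <= b -> 2^-1 + b <= a ->
  a ^+ 2 / (a ^+ 2 - b ^+ 2) <= expR (4 * b ^+ 2).
Proof.
move=> b0 ba; apply: le_trans (expR_ge1Dx _).
have D : 4^-1 <= a ^+ 2 - b ^+ 2 by nra.
have D0 : 0 < a ^+ 2 - b ^+ 2 by apply: lt_le_trans D.
rewrite ler_pdivrMr// mulrDl mul1r -lerBlDl opprB addrC subrK.
have : 0 <= b ^+ 2 by exact: sqr_ge0.
by move: (b ^+ 2) (a ^+ 2) D => u v; nra.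
Qed.

(** The value 81/16 is the square of 9/4, and 15/8 is 3 m^2 / 40 at m = 5, as needed in
    [sample_count]. *)
Lemma expR_ge_81_16 (R : realType) (x : R) : 15 / 8 <= x -> 81 / 16 <= expR x.
Proof.
move=> hx; apply: (@le_trans _ _ ((1 + 15 / 64) ^+ 8)); first lra.
apply: (@le_trans _ _ (expR (15 / 64) ^+ 8)).
  by rewrite lerXn2r ?nnegrE ?expR_ge0 ?expR_ge1Dx.
by rewrite -expRM_natl ler_expR; lra.
Qed.

(** Squared, the two bounds on X compare (16/81) exp(m^2 / 8) with exp(4 coup^2 n N). The part 3 m^2
    / 40 of the exponent absorbs 16/81 and leaves m^2 / 20. As coup = 32 eps / (m E), this reads m^4
    E^2 <= 5 2^14 eps^2 n N; replacing m by n costs 256, and 256 5 2^14 <= 4^13. *)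
Lemma sample_count (R : realType) (m r N : nat) (E eps eta X : R) :
  (5 <= m)%N -> (r <= 1)%N -> 1 < E -> 0 < eps -> eta = 128 * eps / m%:R ->
  X ^+ 2 <= expR (4 * (coup E eta) ^+ 2) ^+ (m + (m + r)) ->
  4 / 9 * expR (m%:R ^+ 2 / 16) <= X ^+ N ->
  4 ^- 13 * E ^+ 2 * (m + (m + r))%:R ^+ 3 / eps ^+ 2 <= N%:R.
Proof.
move=> m5 r1 E1 eps0 etaE hX hN.
have m5' : 5 <= m%:R :> R by rewrite (ler_nat R 5 m).
have m0 : 0 < m%:R :> R by apply: lt_le_trans m5'.
have E0 : 0 < E by apply: lt_trans E1.
set n := (m + (m + r))%N in hX *.
have nm : n%:R <= 4 * m%:R :> R by rewrite -natrM ler_nat /n; lia.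
have n0 : 0 < n%:R :> R by rewrite ltr0n /n; lia.
have {}hN : 16 / 81 * expR (m%:R ^+ 2 / 8) <= expR (4 * (coup E eta) ^+ 2 * (n * N)%:R).
  have -> : 16 / 81 * expR (m%:R ^+ 2 / 8) = (4 / 9 * expR (m%:R ^+ 2 / 16)) ^+ 2 :> R.
    by rewrite exprMn -[expR (_ / 16) ^+ 2]expRM_natl; congr (_ * expR _); field.
  apply: (@le_trans _ _ ((X ^+ N) ^+ 2)).
    have p0 : 0 <= 4 / 9 * expR (m%:R ^+ 2 / 16) :> R by rewrite mulr_ge0 ?expR_ge0.
    by rewrite lerXn2r ?nnegrE// (le_trans p0).
  rewrite -exprM mulnC exprM [X in expR X]mulrC expRM_natl exprM.
  by rewrite lerXn2r ?nnegrE ?sqr_ge0// exprn_ge0// expR_ge0.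
have hM : m%:R ^+ 2 / 20 <= 4 * (coup E eta) ^+ 2 * (n * N)%:R.
  rewrite -ler_expR; apply: le_trans hN.
  rewrite (_ : m%:R ^+ 2 / 8 = 3 * m%:R ^+ 2 / 40 + m%:R ^+ 2 / 20); last by field.
  rewrite expRD mulrA ler_peMl ?expR_ge0//.
  have : 81 / 16 <= expR (3 * m%:R ^+ 2 / 40) :> R by apply: expR_ge_81_16; nra.
  by lra.
have En := lt0r_neq0 E0; have mn := lt0r_neq0 m0.
have hm4 : m%:R ^+ 4 * E ^+ 2 <= (5 * 2 ^+ 14) * eps ^+ 2 * (n%:R * N%:R).
  have -> : m%:R ^+ 4 * E ^+ 2 = 20 * m%:R ^+ 2 * E ^+ 2 * (m%:R ^+ 2 / 20) by field.
  apply: le_trans (ler_wpM2l _ hM) _; first by rewrite mulr_ge0 ?sqr_ge0// mulr_ge0 ?sqr_ge0.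
  rewrite natrM le_eqVlt; apply/orP; left; apply/eqP.
  by rewrite /coup etaE; field; rewrite En mn.
rewrite ler_pdivrMr ?exprn_gt0// -(ler_pM2r n0).
have hn4 : n%:R ^+ 4 <= 256 * m%:R ^+ 4 :> R.
  have -> : 256 * m%:R ^+ 4 = (4 * m%:R) ^+ 4 :> R by rewrite exprMn; congr (_ * _); ring.
  by rewrite lerXn2r ?nnegrE ?mulr_ge0// ltW.
have {hm4 hn4} h : n%:R ^+ 4 * E ^+ 2 <= 256 * (5 * 2 ^+ 14 * eps ^+ 2 * (n%:R * N%:R)).
  apply: le_trans (_ : 256 * (m%:R ^+ 4 * E ^+ 2) <= _); last by rewrite ler_pM2l.
  by rewrite mulrA ler_wpM2r ?sqr_ge0.
have y0 : 0 <= eps ^+ 2 * (n%:R * N%:R) by rewrite mulr_ge0 ?sqr_ge0// mulr_ge0.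
rewrite (_ : _ * n%:R = 4 ^- 13 * (n%:R ^+ 4 * E ^+ 2)); last by ring.
apply: le_trans (ler_wpM2l _ h) _; first by rewrite invr_ge0 exprn_ge0.
have -> : N%:R * eps ^+ 2 * n%:R = eps ^+ 2 * (n%:R * N%:R) :> R by ring.
rewrite -[_ * _ ^+ 2 * _]mulrA; move: (eps ^+ 2 * _) y0 => y y0.
by rewrite mulrC ler_pdivrMr ?exprn_gt0//; lra.
Qed.

Section learning.
Variables (R : realType) (m r N : nat) (E eps : R).
Local Notation n := (m + (m + r))%N.
Variable A : algorithm R n N.
Hypotheses (m5 : (5 <= m)%N) (r1 : (r <= 1)%N) (E1 : 1 < E)
  (eps0 : 0 < eps) (eps1 : eps < 5 / 1000).
Hypothesis dens : forall d u, is_density (A d u).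

Let eta : R := 128 * eps / m%:R.
Let S (W : 'M[R]_m) := cov r W (amp E eta) (coup E eta) E.
Let L := orthogonal_family R m.
Let K : R := (size L)%:R * expR (- (m%:R ^+ 2 / 16)).

Let m0 : 0 < m%:R :> R. Proof. by rewrite ltr0n; lia. Qed.
Let E0 : 0 < E. Proof. exact: lt_trans E1. Qed.
Let eta0 : 0 < eta. Proof. by rewrite divr_gt0 ?mulr_gt0. Qed.
Let ab : `|coup E eta| < amp E eta. Proof. exact: coup_lt_amp. Qed.
Let k := kappa m r (amp E eta) (coup E eta) E.

Let eta1 : eta <= 1.
Proof.
have : 5 <= m%:R :> R by rewrite (ler_nat R 5 m).
by move=> m5'; rewrite /eta ler_pdivrMr// mul1r; move: m5' eps1; lra.
Qed.

(** The test with V is within 2 eps of both kappa m and kappa tr(V^T W), so kappa (m - tr(V^T W)) <=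
    4 eps < kappa m / 4. *)
Lemma close_of_success (V W : 'M[R]_m) d u : orthogonal_mx V -> orthogonal_mx W ->
  (Dtr (A d u) (gauss_state (S V)) <= eps%:E)%E ->
  (Dtr (A d u) (gauss_state (S W)) <= eps%:E)%E ->
  3 / 4 * m%:R <= \tr (V^T *m W).
Proof.
move=> HV HW hV hW.
have := test_value_close HV ab E0 HV (dens d u) hV.
have := test_value_close HW ab E0 HV (dens d u) hW.
rewrite HV mxtrace1 -/k !ler_norml => /andP[_ h1] /andP[h2 _].
have k0 : 0 <= k by exact: kappa_ge0.
have hk : 4 * eps < k * (m%:R / 4) by exact: kappa_separates.
rewrite leNgt; apply/negP => ht.
have : k * (m%:R / 4) <= k * (m%:R - \tr (V^T *m W)) by rewrite ler_wpM2l//; lra.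
by rewrite mulrBr; lra.
Qed.

(** Either no event contains the point, or one member V whose event does is taken as centre, and all
    other accepted members have large overlap with V. *)
Lemma sum_success_le (Ev : 'M[R]_m -> set (N.-tuple ((n + n).-tuple R) * R)) :
  (forall W, W \in L ->
     Ev W `<=` [set du | (Dtr (A du.1 du.2) (gauss_state (S W)) <= eps%:E)%E]) ->
  forall du, \sum_(W <- L) (\1_(Ev W) du : R) <= K.
Proof.
move=> hE du; have K0 : 0 <= K by rewrite mulr_ge0 ?expR_ge0.
have [/hasP[V VL /set_mem VE]|] := boolP (has (fun V => du \in Ev V) L); last first.
  rewrite -all_predC => /allP h; rewrite big_seq big1// => W /h /= /negPf hW.
  by rewrite indicE hW.
have HV := orthogonal_familyP VL.
apply: le_trans (count_close_orthogonal HV).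
rewrite -sum1_count natr_sum [leRHS]big_mkcond /= big_seq [leRHS]big_seq.
apply: ler_sum => W WL; rewrite indicE.
case: (boolP (du \in Ev W)) => [/set_mem hW|_]; last by case: ifP.
by rewrite (close_of_success HV (orthogonal_familyP WL) (hE _ VL _ VE) (hE _ WL _ hW)).
Qed.

Lemma learning_lower_bound :
  (forall S : 'M[R]_(n + n), is_qcm S -> (mx_opnorm S <= E%:E)%E -> learns_whp A S eps) ->
  4 ^- 13 * E ^+ 2 * n%:R ^+ 3 / eps ^+ 2 <= N%:R.
Proof.
move=> learns.
have c0 : 0 <= coup E eta by exact: coup_ge0.
have iE : (4 * E)^-1 <= 4^-1 by rewrite lef_pV2 ?posrE ?mulr_gt0//; move: E1; lra.
have cE : coup E eta <= 4^-1.
  by rewrite /coup -[leRHS]mul1r ler_pM ?invr_ge0// ?ltW// mulr_gt0.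
(* Outside the family the empty event is used, so that [choice] yields a function measurable at
   every W. *)
have ev W : exists Ev : set (N.-tuple ((n + n).-tuple R) * R), measurable Ev /\
    (W \in L -> Ev `<=` [set du | (Dtr (A du.1 du.2) (gauss_state (S W)) <= eps%:E)%E] /\
     ((2 / 3)%:E <= het_int (S W + 2^-1%:M) (seedint Ev))%E).
  have [WL|_] := boolP (W \in L); last by exists set0.
  have HW := orthogonal_familyP WL.
  have [||Ev [mE [sE pE]]] := learns (S W).
  - by apply: cov_qcm => //; rewrite ger0_norm// ampE// addrK.
  - apply: mx_opnorm_cov => //; first exact: le_trans (ltW ab).
    rewrite ger0_norm// ampE//; move: E1 iE cE; lra.
  by exists Ev.
have [Ev hEv] := choice ev.
(* Parameters of the heterodyne outcome: the vacuum term is added to both variances, the coupling is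
   kept. *)
pose a := amp E eta + 2^-1; pose b := coup E eta; pose e := E + 2^-1.
have a0 : 0 < a by rewrite addr_gt0// (le_lt_trans _ ab).
have e0 : 0 < e by rewrite addr_gt0.
have ba : `|b| < a by rewrite (lt_trans ab)// ltrDl.
pose X := het_chi m r a b.
(* This multiplier turns the overlap term into |L| / 3, half of the success mass; the chi-square
   term must supply the other third, which forces X^N >= (4/9) exp(m^2 / 16). *)
have l0 : 0 < expR (m%:R ^+ 2 / 16) / 3 :> R by rewrite divr_gt0 ?expR_gt0.
have HL W : W \in L -> orthogonal_mx W by exact: orthogonal_familyP.
have hc : (size L)%:R * (2 / 3) <= expR (m%:R ^+ 2 / 16) / 3 * K +
    (size L)%:R * (X ^+ N / (4 * (expR (m%:R ^+ 2 / 16) / 3))).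
  apply: (@counting_bound R (n + n) N 'M[R]_m L (@het_ref R m r a e)
    (fun W => gauss_pdf (cov r W a b e)) (fun W => @het_chi_fun R m r a e W b) Ev X K) => //.
  - exact: measurable_het_ref.
  - exact: het_ref_gt0.
  - exact: iint_het_ref.
  - by move=> W /HL HW; exact: measurable_gauss_pdf.
  - by move=> W /HL HW t; exact: gauss_pdf_gt0.
  - by move=> W _; exact: measurable_het_chi_fun.
  - by move=> W /HL HW t; rewrite het_chi_funP.
  - by move=> W /HL HW; exact: iint_het_chi_fun.
  - by move=> W; have [] := hEv W.
  - by apply: sum_success_le => W WL; have [_ /(_ WL)[]] := hEv W.
  - move=> W WL; have [_ /(_ WL)[_]] := hEv W.
    by rewrite het_intE /S cov_add_scalar.
have L0 : 0 < (size L)%:R :> R by rewrite ltr0n size_orthogonal_family_gt0.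
apply: (@sample_count R m r N E eps eta X) => //.
  rewrite sqr_het_chi// lerXn2r ?nnegrE ?expR_ge0//.
    by rewrite divr_ge0 ?sqr_ge0//; exact/ltW/subr_sqr_gt0.
  by apply: ratio_le_expR => //; rewrite addrC lerD2r; apply: le_trans (ltW ab); exact: ler_norm.
move: hc; rewrite /K; set p := expR (m%:R ^+ 2 / 16).
have p0 : 0 < p by exact: expR_gt0.
rewrite expRN -/p (_ : p / 3 * _ = (size L)%:R * 3^-1); last by field; rewrite gt_eqF.
rewrite -mulrDr ler_pM2l// => hc.
have : 3^-1 <= X ^+ N / (4 * (p / 3)) by lra.
by rewrite ler_pdivlMr ?mulr_gt0 ?divr_gt0//; lra.
Qed.

End learning.

Theorem theorem4 (R : realType) :
  exists c : R, 0 < c /\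
  forall (Ebar eps : R) (n N : nat) (A : algorithm R n N),
    1 < Ebar -> 0 < eps -> eps < 5%:R / 1000%:R -> (10 <= n)%N ->
    (forall d u, is_density (A d u)) ->
    (forall S : 'M[R]_(n + n), is_qcm S -> (mx_opnorm S <= Ebar%:E)%E ->
       learns_whp A S eps) ->
    c * Ebar ^+ 2 * n%:R ^+ 3 / eps ^+ 2 <= N%:R.
Proof.
exists (4 ^- 13); split; first by rewrite invr_gt0 exprn_gt0.
move=> E eps n N A E1 eps0 eps1 n10 dens learns.
have nE : n = (n./2 + (n./2 + odd n))%N by rewrite addnA addnn addnC odd_double_half.
have m5 : (5 <= n./2)%N by lia.
(* Abstracting the half and the parity leaves n equal to a sum of fresh variables, so it can be
   rewritten inside the type of [A]. *)
move: (odd n) (leq_b1 (odd n)) (n./2) nE m5 => o o1 m nE m5.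
by move: A dens learns; rewrite nE => A dens learns; exact: learning_lower_bound dens learns.
Qed.
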